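(* Let $(H_i)_{i\in I}$ be a family of complex Hilbert spaces and let $A=\bigoplus_{i\in I}^{c_0}K(H_i)$ be the corresponding compact C$^*$-algebra. Then, for every real Banach space $Y$, every surjective isometry from the unit sphere of $A$ onto the unit sphere of $Y$ admits a (unique) extension to a surjective real linear isometry from $A$ onto $Y$.
   Context: $K(H_i)$ is the C$^*$-algebra of compact linear operators on $H_i$; the $c_0$-sum consists of families $(x_i)_{i\in I}$ with $x_i\in K(H_i)$ and $(\|x_i\|)_{i}\in c_0(I)$, with norm $\sup_i\|x_i\|$. Unit spheres carry the metric induced by the norm. An isometry is a distance-preserving map; no linearity is assumed. *)

(* Defs.v *)
From HB Require Import structures.
From mathcomp Require Import all_boot all_order all_algebra.
From mathcomp Require Import sesquilinear complex.
From mathcomp Require Import all_classical all_reals all_analysis.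

Set Implicit Arguments.
Unset Strict Implicit.
Unset Printing Implicit Defensive.
Import Order.TTheory GRing.Theory Num.Theory.
Import numFieldNormedType.Exports.

Local Open Scope classical_set_scope.
Local Open Scope ring_scope.
Local Open Scope complex_scope.

(** The norm of a normed space over [R[i]] takes its values in [R[i]], where
    [0 <= z] entails that [z] is real; suprema are computed in [R] on the real
    part of the norm. *)

(** The library's [{dot H for conjc}] is the type of positive definite
    sesquilinear forms, linear in the first argument and conjugate-linear in
    the second. *)
HB.mixin Record CompleteNormedModule_isHilbert (R : realType) (H : Type)
    & CompleteNormedModule R[i] H := {
  hdot : {dot H for @conjc R};
  hdot_norm : forall x : H, hdot x x = `|x| ^+ 2
}.

#[short(type="hilbertType")]
HB.structure Definition Hilbert (R : realType) :=
  {H of CompleteNormedModule R[i] H & CompleteNormedModule_isHilbert R H}.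

Section real_norm.
Variables (R : realType) (V : normedModType R[i]).

Lemma Re_norm (x : V) : (complex.Re `|x|)%:C = `|x|.
Proof. by rewrite RRe_real// normr_real. Qed.

Lemma Re_norm_ge0 (x : V) : 0 <= complex.Re `|x|.
Proof. by rewrite -ler0c Re_norm. Qed.

Lemma Re_normD (x y : V) :
  complex.Re `|x + y| <= complex.Re `|x| + complex.Re `|y|.
Proof. by rewrite -lecR rmorphD/= !Re_norm ler_normD. Qed.

Lemma Re_normZ (a : R[i]) (x : V) :
  complex.Re `|a *: x| = complex.Re `|a| * complex.Re `|x|.
Proof.
have Ra : (complex.Re `|a|)%:C = `|a| by rewrite RRe_real// normr_real.
apply: (fmorph_inj (real_complex R)).
by rewrite rmorphM/= Ra !Re_norm normrZ.
Qed.

Lemma compact_Re_norm_bounded (A : set V) : compact A ->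
  exists M : R, forall x, A x -> complex.Re `|x| <= M.
Proof.
move=> /compact_near_coveringP cA.
have [] := cA R +oo%R (fun M x => complex.Re `|x| <= M).
  move=> x _; near=> y M => /=.
  have -> : y = y - x + x by rewrite subrK.
  apply: (le_trans (Re_normD _ _)).
  apply: (@le_trans _ _ (1 + complex.Re `|x|)).
    rewrite lerD2r -lecR Re_norm distrC ltW//.
  by near: M; apply: nbhs_pinfty_ge; rewrite num_real.
move=> M [_ AM].
by exists (M + 1) => x Ax; apply: (AM (M + 1)) => //; rewrite ltrDl.
Unshelve. all: by end_near. Qed.

End real_norm.

Section compact_operator.
Variables (R : realType) (V : normedModType R[i]).

Definition compact_operator (T : V -> V) :=
  linear T /\ precompact (T @` [set x | `|x| <= 1]).

Record compact_op := CompactOp {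
  compact_op_fun :> V -> V;
  compact_opP : compact_operator compact_op_fun
}.

HB.instance Definition _ := gen_eqMixin compact_op.
HB.instance Definition _ := gen_choiceMixin compact_op.

Implicit Types S T : compact_op.

Lemma compact_op_ext S T : (forall x, S x = T x) -> S = T.
Proof.
case: S T => [s sP] [t tP] /= /funext st; rewrite st in sP *.
by rewrite (Prop_irrelevance sP tP).
Qed.

Lemma compact_opL T a x y : T (a *: x + y) = a *: T x + T y.
Proof. by case: (compact_opP T) => + _; apply. Qed.

Lemma compact_operator0 : compact_operator (fun=> 0).
Proof.
split; first by move=> a x y; rewrite scaler0 addr0.
apply: (@precompact_subset _ _ [set 0]); first by move=> _ [x _ <-].
by apply: compact_precompact; [exact: norm_hausdorff|exact: compact_set1].
Qed.

Lemma compact_operatorD S T : compact_operator (fun x => S x + T x).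
Proof.
have [_ cS] := compact_opP S; have [_ cT] := compact_opP T.
split.
  by move=> a x y; rewrite !compact_opL scalerDr addrACA.
rewrite !precompactE in cS cT.
have := @continuous_compact _ _ (fun z : V * V => z.1 + z.2) _
  (continuous_subspaceT (@add_continuous V)) (compact_setX cS cT).
move=> /(compact_precompact (@norm_hausdorff _ V)).
apply: precompact_subset => _ [x x1 <-].
by exists (S x, T x) => //; split; apply: subset_closure; exists x.
Qed.

Lemma compact_operatorZ (a : R[i]) T : compact_operator (fun x => a *: T x).
Proof.
have [_ cT] := compact_opP T.
split.
  by move=> b x y; rewrite compact_opL scalerDr !scalerA mulrC.
rewrite precompactE in cT.
have := @continuous_compact _ _ (fun z : V => a *: z) _
  (continuous_subspaceT (@scaler_continuous _ V a)) cT.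
move=> /(compact_precompact (@norm_hausdorff _ V)).
apply: precompact_subset => _ [x x1 <-].
by exists (T x) => //; apply: subset_closure; exists x.
Qed.

Lemma compact_operatorN T : compact_operator (fun x => - T x).
Proof.
have := compact_operatorZ (-1) T.
by congr compact_operator; apply/funext => x; rewrite scaleN1r.
Qed.

Definition cop_zero := CompactOp compact_operator0.
Definition cop_add S T := CompactOp (compact_operatorD S T).
Definition cop_opp T := CompactOp (compact_operatorN T).
Definition cop_scale a T := CompactOp (compact_operatorZ a T).

Fact cop_addA : associative cop_add.
Proof. by move=> S T U; apply: compact_op_ext => x /=; rewrite addrA. Qed.
Fact cop_addC : commutative cop_add.
Proof. by move=> S T; apply: compact_op_ext => x /=; rewrite addrC. Qed.
Fact cop_add0 : left_id cop_zero cop_add.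
Proof. by move=> T; apply: compact_op_ext => x /=; rewrite add0r. Qed.
Fact cop_addN : left_inverse cop_zero cop_opp cop_add.
Proof. by move=> T; apply: compact_op_ext => x /=; rewrite addNr. Qed.

HB.instance Definition _ :=
  GRing.isZmodule.Build compact_op cop_addA cop_addC cop_add0 cop_addN.

Fact cop_scaleA a b T : cop_scale a (cop_scale b T) = cop_scale (a * b) T.
Proof. by apply: compact_op_ext => x /=; rewrite scalerA. Qed.
Fact cop_scale1 : left_id 1 cop_scale.
Proof. by move=> T; apply: compact_op_ext => x /=; rewrite scale1r. Qed.
Fact cop_scaleDr : right_distributive cop_scale +%R.
Proof. by move=> a S T; apply: compact_op_ext => x /=; rewrite scalerDr. Qed.
Fact cop_scaleDl T : {morph cop_scale^~ T : a b / a + b}.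
Proof. by move=> a b; apply: compact_op_ext => x /=; rewrite scalerDl. Qed.

HB.instance Definition _ := GRing.Zmodule_isLmodule.Build R[i] compact_op
  cop_scaleA cop_scale1 cop_scaleDr cop_scaleDl.

Lemma compact_op0E x : (0 : compact_op) x = 0. Proof. by []. Qed.
Lemma compact_opDE S T x : (S + T) x = S x + T x. Proof. by []. Qed.
Lemma compact_opNE T x : (- T) x = - T x. Proof. by []. Qed.
Lemma compact_opZE a T x : (a *: T) x = a *: T x. Proof. by []. Qed.

Definition operator_norm T : R :=
  sup [set complex.Re `|T x| | x in [set x | `|x| <= 1]].

Lemma operator_norm_has_sup T :
  has_sup [set complex.Re `|T x| | x in [set x | `|x| <= 1]].
Proof.
split; first by exists (complex.Re `|T 0|), 0 => //=; rewrite normr0.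
have [_] := compact_opP T; rewrite precompactE.
move=> /compact_Re_norm_bounded[M TM]; exists M => _ [x x1 <-].
by apply: TM; apply: subset_closure; exists x.
Qed.

Lemma operator_norm_ub T x : `|x| <= 1 -> complex.Re `|T x| <= operator_norm T.
Proof.
move=> x1; apply: ub_le_sup; last by exists x.
by case: (operator_norm_has_sup T).
Qed.

Lemma operator_norm_le T M :
  (forall x, `|x| <= 1 -> complex.Re `|T x| <= M) -> operator_norm T <= M.
Proof.
move=> TM; apply: ge_sup; first by case: (operator_norm_has_sup T).
by move=> _ [x x1 <-]; exact: TM.
Qed.

Lemma operator_norm_ge0 T : 0 <= operator_norm T.
Proof.
apply: (le_trans (Re_norm_ge0 (T 0))); apply: operator_norm_ub.
by rewrite normr0.
Qed.

Definition cop_norm T : R[i] := (operator_norm T)%:C.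

Fact cop_normD S T : cop_norm (S + T) <= cop_norm S + cop_norm T.
Proof.
rewrite /cop_norm -rmorphD/= lecR; apply: operator_norm_le => x x1.
by apply: (le_trans (Re_normD _ _)); rewrite lerD// operator_norm_ub.
Qed.

Fact cop_normZ (a : R[i]) T : cop_norm (a *: T) = `|a| * cop_norm T.
Proof.
have leZ (b : R[i]) (c : R) S : c%:C = `|b| ->
    operator_norm (b *: S) <= c * operator_norm S.
  move=> bc; apply: operator_norm_le => x x1.
  rewrite -lecR Re_norm compact_opZE normrZ -bc -Re_norm -rmorphM lecR.
  by apply: ler_wpM2l; [rewrite -ler0c bc|exact: operator_norm_ub].
have [c ca] : exists c : R, c%:C = `|a|.
  by exists (complex.Re `|a|); rewrite RRe_real// normr_real.
rewrite /cop_norm -ca -rmorphM; congr _%:C.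
apply/eqP; rewrite eq_le leZ//=.
have [a0|a0] := eqVneq a 0.
  have [->] : c%:C = 0 by rewrite ca a0 normr0.
  by rewrite mul0r operator_norm_ge0.
have c0 : 0 < c by rewrite -ltcR ca rmorph0 normr_gt0.
have := leZ a^-1 c^-1 (a *: T); rewrite scalerA mulVf// scale1r.
rewrite ler_pdivlMl//; apply.
by rewrite normfV -ca fmorphV.
Qed.

Fact cop_norm_eq0 T : cop_norm T = 0 -> T = 0.
Proof.
move=> [T0].
have T0x x : `|x| <= 1 -> T x = 0.
  move=> x1; apply/eqP; rewrite -normr_le0 -Re_norm lecR -T0.
  exact: operator_norm_ub.
apply: compact_op_ext => x; rewrite compact_op0E.
have [->|x0] := eqVneq x 0; first by rewrite T0x// normr0.
have nx0 : `|x| != 0 by rewrite normr_eq0.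
have := compact_opL T `|x| (`|x|^-1 *: x) 0.
rewrite scalerA divff// scale1r !addr0 => ->.
rewrite !T0x ?normr0// ?scaler0 ?addr0//.
by rewrite normrZ normfV normr_id mulVf.
Qed.

HB.instance Definition _ := Lmodule_isNormed.Build R[i] compact_op
  cop_normD cop_normZ cop_norm_eq0.

Lemma compact_op_normE T : `|T| = (operator_norm T)%:C. Proof. by []. Qed.

End compact_operator.

Section c0_sum.
Variables (R : realType) (I : Type) (V : I -> normedModType R[i]).

Definition vanishing (x : forall i, V i) :=
  forall e : R, 0 < e -> finite_set [set i | e <= complex.Re `|x i|].

Record c0_sum := C0Sum {
  c0_fun :> forall i, V i;
  c0P : vanishing c0_fun
}.

HB.instance Definition _ := gen_eqMixin c0_sum.
HB.instance Definition _ := gen_choiceMixin c0_sum.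

Implicit Types x y : c0_sum.

Lemma c0_sum_ext x y : (forall i, x i = y i) -> x = y.
Proof.
case: x y => [x xP] [y yP] /= xy.
have {}xy : x = y by exact: functional_extensionality_dep.
by rewrite xy in xP *; rewrite (Prop_irrelevance xP yP).
Qed.

Lemma vanishing0 : vanishing (fun=> 0).
Proof.
move=> e e0; rewrite (_ : [set _ | _] = set0)//.
by apply/seteqP; split=> // i /=; rewrite normr0 leNgt e0.
Qed.

Lemma vanishingD x y : vanishing (fun i => x i + y i).
Proof.
move=> e e0; have e20 : 0 < e / 2 by rewrite divr_gt0.
apply: (@sub_finite_set _ _ ([set i | e / 2 <= complex.Re `|x i|] `|`
                             [set i | e / 2 <= complex.Re `|y i|])).
  move=> i /= exy; have [|xe] := leP (e / 2) (complex.Re `|x i|); first by left.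
  have [|ye] := leP (e / 2) (complex.Re `|y i|); first by right.
  have := le_lt_trans (le_trans exy (Re_normD _ _)) (ltrD xe ye).
  by rewrite -splitr ltxx.
by rewrite finite_setU; split; exact: c0P.
Qed.

Lemma vanishingZ (a : R[i]) x : vanishing (fun i => a *: x i).
Proof.
move=> e e0.
have [c ca] : exists c : R, c%:C = `|a|.
  by exists (complex.Re `|a|); rewrite RRe_real// normr_real.
have c0 : 0 <= c by rewrite -ler0c ca.
have c1 : 0 < c + 1 by rewrite ltr_wpDl.
apply: sub_finite_set (c0P x (divr_gt0 e0 c1)) => i /= eax.
rewrite ler_pdivrMr//; apply: (le_trans eax).
rewrite -lecR Re_norm normrZ -ca -Re_norm -rmorphM lecR mulrC.
by rewrite ler_wpM2l ?Re_norm_ge0// lerDl.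
Qed.

Lemma vanishingN x : vanishing (fun i => - x i).
Proof.
have := vanishingZ (-1) x; congr vanishing.
by apply: functional_extensionality_dep => i; rewrite scaleN1r.
Qed.

Definition c0_zero := C0Sum vanishing0.
Definition c0_add x y := C0Sum (vanishingD x y).
Definition c0_opp x := C0Sum (vanishingN x).
Definition c0_scale a x := C0Sum (vanishingZ a x).

Fact c0_addA : associative c0_add.
Proof. by move=> x y z; apply: c0_sum_ext => i /=; rewrite addrA. Qed.
Fact c0_addC : commutative c0_add.
Proof. by move=> x y; apply: c0_sum_ext => i /=; rewrite addrC. Qed.
Fact c0_add0 : left_id c0_zero c0_add.
Proof. by move=> x; apply: c0_sum_ext => i /=; rewrite add0r. Qed.
Fact c0_addN : left_inverse c0_zero c0_opp c0_add.
Proof. by move=> x; apply: c0_sum_ext => i /=; rewrite addNr. Qed.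

HB.instance Definition _ :=
  GRing.isZmodule.Build c0_sum c0_addA c0_addC c0_add0 c0_addN.

Fact c0_scaleA a b x : c0_scale a (c0_scale b x) = c0_scale (a * b) x.
Proof. by apply: c0_sum_ext => i /=; rewrite scalerA. Qed.
Fact c0_scale1 : left_id 1 c0_scale.
Proof. by move=> x; apply: c0_sum_ext => i /=; rewrite scale1r. Qed.
Fact c0_scaleDr : right_distributive c0_scale +%R.
Proof. by move=> a x y; apply: c0_sum_ext => i /=; rewrite scalerDr. Qed.
Fact c0_scaleDl x : {morph c0_scale^~ x : a b / a + b}.
Proof. by move=> a b; apply: c0_sum_ext => i /=; rewrite scalerDl. Qed.

HB.instance Definition _ := GRing.Zmodule_isLmodule.Build R[i] c0_sum
  c0_scaleA c0_scale1 c0_scaleDr c0_scaleDl.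

Lemma c0_sum0E i : (0 : c0_sum) i = 0. Proof. by []. Qed.
Lemma c0_sumDE x y i : (x + y) i = x i + y i. Proof. by []. Qed.
Lemma c0_sumNE x i : (- x) i = - x i. Proof. by []. Qed.
Lemma c0_sumZE a x i : (a *: x) i = a *: x i. Proof. by []. Qed.

(** For an empty index set this is [sup set0 = 0]. *)
Definition sup_norm x : R := sup [set complex.Re `|x i| | i in [set: I]].

Lemma sup_norm_has_ubound x :
  has_ubound [set complex.Re `|x i| | i in [set: I]].
Proof.
have /(finite_image (fun i => complex.Re `|x i|)) := c0P x (@ltr01 R).
move=> /finite_seqP[s xs]; exists (\big[Num.max/1]_(r <- s) r) => _ [i _ <-].
have [xi1|xi1] := leP 1 (complex.Re `|x i|).
  have : [set` s] (complex.Re `|x i|) by rewrite -xs; exists i.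
  by move=> xis; exact: (@le_bigmax_seq _ _ _ s 1 _ xpredT id xis).
by apply: (le_trans (ltW xi1)); exact: bigmax_ge_id.
Qed.

Lemma sup_norm_ub x i : complex.Re `|x i| <= sup_norm x.
Proof. by apply: ub_le_sup; [exact: sup_norm_has_ubound|exists i]. Qed.

Lemma sup_norm_le x M : 0 <= M ->
  (forall i, complex.Re `|x i| <= M) -> sup_norm x <= M.
Proof.
move=> M0 xM; rewrite /sup_norm.
have [->|] := eqVneq [set complex.Re `|x i| | i in [set: I]] set0.
  by rewrite sup0.
move=> /set0P ?; apply: ge_sup => // _ [i _ <-]; exact: xM.
Qed.

Lemma sup_norm_ge0 x : 0 <= sup_norm x.
Proof.
rewrite /sup_norm.
have [->|] := eqVneq [set complex.Re `|x i| | i in [set: I]] set0.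
  by rewrite sup0.
by move=> /set0P[_ [i _ _]]; exact: le_trans (Re_norm_ge0 _) (sup_norm_ub x i).
Qed.

Definition c0_norm x : R[i] := (sup_norm x)%:C.

Fact c0_normD x y : c0_norm (x + y) <= c0_norm x + c0_norm y.
Proof.
rewrite /c0_norm -rmorphD/= lecR; apply: sup_norm_le => [|i].
  by rewrite addr_ge0// sup_norm_ge0.
by apply: (le_trans (Re_normD _ _)); rewrite lerD// sup_norm_ub.
Qed.

Fact c0_normZ (a : R[i]) x : c0_norm (a *: x) = `|a| * c0_norm x.
Proof.
have leZ (b : R[i]) (c : R) y : c%:C = `|b| ->
    sup_norm (b *: y) <= c * sup_norm y.
  move=> bc; have c0 : 0 <= c by rewrite -ler0c bc.
  apply: sup_norm_le => [|i]; first by rewrite mulr_ge0// sup_norm_ge0.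
  rewrite -lecR Re_norm c0_sumZE normrZ -bc -Re_norm -rmorphM lecR.
  by rewrite ler_wpM2l// sup_norm_ub.
have [c ca] : exists c : R, c%:C = `|a|.
  by exists (complex.Re `|a|); rewrite RRe_real// normr_real.
rewrite /c0_norm -ca -rmorphM; congr _%:C.
apply/eqP; rewrite eq_le leZ//=.
have [a0|a0] := eqVneq a 0.
  have [->] : c%:C = 0 by rewrite ca a0 normr0.
  by rewrite mul0r sup_norm_ge0.
have c0 : 0 < c by rewrite -ltcR ca rmorph0 normr_gt0.
have := leZ a^-1 c^-1 (a *: x); rewrite scalerA mulVf// scale1r.
rewrite ler_pdivlMl//; apply.
by rewrite normfV -ca fmorphV.
Qed.

Fact c0_norm_eq0 x : c0_norm x = 0 -> x = 0.
Proof.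
move=> [x0]; apply: c0_sum_ext => i; apply/eqP.
by rewrite -normr_le0 -Re_norm lecR -x0 sup_norm_ub.
Qed.

HB.instance Definition _ := Lmodule_isNormed.Build R[i] c0_sum
  c0_normD c0_normZ c0_norm_eq0.

Lemma c0_sum_normE x : `|x| = (sup_norm x)%:C. Proof. by []. Qed.

End c0_sum.

(** Only the normed space structure of this C*-algebra is built: its product
    and involution play no role for isometries. *)
Definition compact_algebra (R : realType) (I : Type) (H : I -> hilbertType R) :
  normedModType R[i] := c0_sum (fun i => compact_op (H i)).

Definition unit_sphere (K : numFieldType) (V : normedModType K) : set V :=
  [set x | `|x| = 1].
Arguments unit_sphere {K} V _.

Section real_maps.
Variables (R : realType) (V : normedModType R[i]) (W : normedModType R).
Implicit Type F : V -> W.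

(** The cast accounts for the norm of [V] being [R[i]]-valued. *)
Definition isometry_on (D : set V) F :=
  forall x y, D x -> D y -> (`|F x - F y|)%:C = `|x - y|.

Definition real_linear F :=
  (forall x y, F (x + y) = F x + F y) /\
  (forall (a : R) x, F (a%:C *: x) = a *: F x).

End real_maps.

(* Main.v *)
(** Let [e] run over the rank-one partial isometries ("atoms") of [A]. The
    functional [af e] takes the value [1] at [e], every [x] attains its norm
    under some [af e], and the face [F_e] of the unit ball on which [af e] is
    [1] is [e] plus the unit ball of the operators orthogonal to [e]. Since the
    points [e + y] with [|y| < 1] are smooth, the isometry [f] maps [F_e] onto a
    convex subset of the sphere of [Y], and Hahn-Banach provides a functional
    [psi] of norm one which is [1] on [f F_e].

    Suppose every atom is orthogonal to another one. Comparing distances inside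
    faces shows that [f] is affine on discs and cubes spanned by orthogonal
    atoms, so [psi \o f] is additive on orthogonal atoms; in a two-by-two corner
    the bound [psi \o f <= 1] forces [psi \o f] to be the cosine on rotations,
    which gives [psi (f v) = Re (af e v)] for all atoms [v], and then on the
    whole sphere by spectral approximation.

    Otherwise [A] is one-dimensional, and an alternating form on [Y] that is
    maximal on pairs of points of the circle yields the coordinates of [f].

    In both cases the real-linear functionals [phi] on [A] for which some
    linear [psi] satisfies [psi \o f = phi] on the sphere separate points,
    hence the homogeneous extension of [f] is additive. *)
From HB Require Import structures.
Require Import Defs.
From mathcomp Require Import all_boot all_order all_algebra.
From mathcomp Require Import sesquilinear complex ring lra.
From mathcomp Require Import all_classical all_reals all_analysis.

Set Implicit Arguments.
Unset Strict Implicit.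
Unset Printing Implicit Defensive.
Import Order.TTheory GRing.Theory Num.Theory.
Import numFieldNormedType.Exports.
Import Normc.

Local Open Scope classical_set_scope.
Local Open Scope ring_scope.
Local Open Scope complex_scope.

(** * Real-valued norms *)

(** No algebraic property of [f] is given, not even that it is odd, so all linear information has to
    be extracted from distances. Two configurations are rigid enough. Distance 2: unit vectors whose
    sum has norm 2 have a common atom [r] with [af r] equal to 1 at both, and antipodes chosen in
    [Y] can be pulled back since [f] is onto. Distances adding up along a multiple of an atom [e]:
    tangency of discs then forces orthogonality to [e]. Both use only the properties collected in
    [atomic]; operators on Hilbert spaces appear where these are verified. The case distinction
    arises because affinity is found inside faces: a circle of multiples of [e] enters a face only
    after translation by an atom orthogonal to [e], while in the one-dimensional algebra every face
    is a single point. *)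

Section complex_modulus.
Variable R : realType.
Implicit Types (a b z : R[i]) (s t : R).

Lemma normc_ge0 z : 0 <= normc z.
Proof. by case: z => x y; exact: sqrtr_ge0. Qed.

Lemma sqr_normcE z : normc z ^+ 2 = complex.Re z ^+ 2 + complex.Im z ^+ 2.
Proof. by case: z => x y; rewrite sqr_sqrtr// addr_ge0 ?sqr_ge0. Qed.

Lemma normcR t : normc t%:C = `|t|.
Proof. by rewrite /= expr0n addr0 sqrtr_sqr. Qed.

Lemma normcN1 : normc (-1 : R[i]) = 1.
Proof. by rewrite normcN normc1. Qed.

Lemma normc_conj z : normc (Num.conj z) = normc z.
Proof. by case: z => x y /=; rewrite sqrrN. Qed.

Lemma conjR t : Num.conj t%:C = t%:C :> R[i].
Proof. by apply/eqP; rewrite eq_complex /= oppr0 !eqxx. Qed.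

Lemma mulc_conj z : z * Num.conj z = (normc z ^+ 2)%:C.
Proof.
rewrite sqr_normcE; case: z => x y; apply/eqP.
by rewrite eq_complex /=; apply/andP; split; apply/eqP; ring.
Qed.

Lemma realC_neq0 t : t != 0 -> t%:C != 0 :> R[i].
Proof. by move=> t0; rewrite eq_complex /= eqxx andbT. Qed.

Lemma Re_le_normc z : `|complex.Re z| <= normc z.
Proof.
rewrite -[leLHS]sqrtr_sqr -(ger0_norm (normc_ge0 z)) -[leRHS]sqrtr_sqr.
by rewrite ler_sqrt ?sqr_ge0// sqr_normcE lerDl sqr_ge0.
Qed.

Lemma Im_le_normc z : `|complex.Im z| <= normc z.
Proof.
rewrite -[leLHS]sqrtr_sqr -(ger0_norm (normc_ge0 z)) -[leRHS]sqrtr_sqr.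
by rewrite ler_sqrt ?sqr_ge0// sqr_normcE lerDr sqr_ge0.
Qed.

Lemma normc_le z s : 0 <= s ->
  (normc z <= s) = (complex.Re z ^+ 2 + complex.Im z ^+ 2 <= s ^+ 2).
Proof. by move=> s0; rewrite -sqr_normcE ler_sqr// nnegrE normc_ge0. Qed.

Lemma normc_eq1 z :
  normc z = 1 <-> complex.Re z ^+ 2 + complex.Im z ^+ 2 = 1.
Proof.
rewrite -sqr_normcE; split=> [->|/eqP]; first by rewrite expr1n.
by rewrite sqrp_eq1 ?normc_ge0// => /eqP.
Qed.

(** The discs with centers [- t b] and [(1 - t) b] and radii [t |b|] and [(1 - t) |b|] are
    externally tangent at 0. Weighting the squared inequalities by [1 - t] and [t] cancels the cross
    terms and leaves [|a|^2 <= 0]. *)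
Lemma touching_discs a b t : 0 <= t <= 1 ->
  normc (a + t%:C * b) <= t * normc b ->
  normc (a - (1 - t)%:C * b) <= (1 - t) * normc b -> a = 0.
Proof.
case: a b => x y [u v] /andP[t0 t1].
rewrite !normc_le ?mulr_ge0 ?normc_ge0 ?subr_ge0//.
rewrite !exprMn !sqr_normcE /= => h1 h2.
have t10 : 0 <= 1 - t by rewrite subr_ge0.
have {}h1 := ler_wpM2l t10 h1; have {}h2 := ler_wpM2l t0 h2.
have x0 := sqr_ge0 x; have y0 := sqr_ge0 y.
have /eqP : x ^+ 2 = 0 by lra.
have /eqP : y ^+ 2 = 0 by lra.
by rewrite !sqrf_eq0 => /eqP -> /eqP ->.
Qed.

Lemma normc_le1_Re1 z : normc z <= 1 -> complex.Re z = 1 -> z = 1.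
Proof.
case: z => x y; rewrite normc_le// expr1n /= => h x1; rewrite x1 in h *.
have y0 := sqr_ge0 y.
have /eqP : y ^+ 2 = 0 by lra.
by rewrite sqrf_eq0 => /eqP ->.
Qed.

Lemma normc_add_sub_le1 z : normc (1 + z) <= 1 -> normc (1 - z) <= 1 -> z = 0.
Proof.
case: z => x y; rewrite !normc_le// expr1n /= => h1 h2.
have x0 := sqr_ge0 x; have y0 := sqr_ge0 y.
have /eqP : x ^+ 2 = 0 by lra.
have /eqP : y ^+ 2 = 0 by lra.
by rewrite !sqrf_eq0 => /eqP -> /eqP ->.
Qed.

End complex_modulus.

Section vector_norm.
Variables (R : realType) (V : normedModType R[i]).
Implicit Types x y : V.

Definition vnorm x : R := complex.Re `|x|.

Lemma vnormE x : (vnorm x)%:C = `|x|. Proof. exact: Re_norm. Qed.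

Lemma vnorm_ge0 x : 0 <= vnorm x. Proof. exact: Re_norm_ge0. Qed.

Lemma vnorm0 : vnorm 0 = 0. Proof. by rewrite /vnorm normr0. Qed.

Lemma vnorm_eq0 x : vnorm x = 0 -> x = 0.
Proof. by move=> x0; apply/eqP; rewrite -normr_eq0 -vnormE x0. Qed.

Lemma vnormZ (a : R[i]) x : vnorm (a *: x) = normc a * vnorm x.
Proof. exact: Re_normZ. Qed.

 
Lemma vnormZr (a : R) x : vnorm (a%:C *: x) = `|a| * vnorm x.
Proof. by rewrite vnormZ normcR. Qed.

Lemma vnormD x y : vnorm (x + y) <= vnorm x + vnorm y.
Proof. exact: Re_normD. Qed.

Lemma vnormN x : vnorm (- x) = vnorm x.
Proof. by rewrite /vnorm normrN. Qed.

Lemma vnormB x y : vnorm (x - y) <= vnorm x + vnorm y.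
Proof. by rewrite (le_trans (vnormD _ _))// vnormN. Qed.

Lemma vdistC x y : vnorm (x - y) = vnorm (y - x).
Proof. by rewrite -vnormN opprB. Qed.

Lemma unit_sphereE x : unit_sphere V x <-> vnorm x = 1.
Proof. by rewrite /unit_sphere /= -vnormE; split=> [[]//|->]. Qed.

End vector_norm.

(** * Atoms and faces *)

Section atomic.
Variables (R : realType) (A : normedModType R[i]).

Definition lin4 (u11 u12 u21 u22 : A) (a11 a12 a21 a22 : R[i]) : A :=
  a11 *: u11 + a12 *: u12 + a21 *: u21 + a22 *: u22.

(** [u11, u12, u21, u22] behave like the elementary two-by-two matrices as far
    as atoms are concerned: orthonormal bases [p, p'] and [q, q'] of the plane
    give the orthogonal atoms [p q^T] and [p' q'^T]. *)
Definition matrix_units (E : Type) (av : E -> A) (ap : E -> A -> Prop)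
    (u11 u12 u21 u22 : A) :=
  forall p1 p2 q1 q2 p1' p2' q1' q2' : R[i],
    p1 * p1^* + p2 * p2^* = 1 -> q1 * q1^* + q2 * q2^* = 1 ->
    p1' * p1'^* + p2' * p2'^* = 1 -> q1' * q1'^* + q2' * q2'^* = 1 ->
    p1 * p1'^* + p2 * p2'^* = 0 -> q1 * q1'^* + q2 * q2'^* = 0 ->
  exists e e' : E, [/\ ap e (av e'),
    av e = lin4 u11 u12 u21 u22 (p1 * q1) (p1 * q2) (p2 * q1) (p2 * q2)
  & av e' =
    lin4 u11 u12 u21 u22 (p1' * q1') (p1' * q2') (p2' * q1') (p2' * q2')].

(** An atom [e] stands for a rank-one partial isometry [av e], sending a unit
    vector [eta] to a unit vector [xi]; [af e x] is the coefficient
    [<x eta, xi>], [ap e x] says that [x eta = 0] and that the range of [x] is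
    orthogonal to [xi], and [ar a e] is the atom [a *: av e]. In [two_atoms] the
    phases of the two pairs of vectors are absorbed in [a] and the [u_ij], so
    that the coordinates of [e'] are real. *)
Record atomic := Atomic {
  atom :> Type;
  av : atom -> A;
  af : atom -> A -> R[i];
  ap : atom -> A -> Prop;
  ar : R[i] -> atom -> atom;
  afL : forall e a x y, af e (a *: x + y) = a * af e x + af e y;
  af_le : forall e x, normc (af e x) <= vnorm x;
  afv : forall e, af e (av e) = 1;
  af_attain : forall x, x <> 0 -> exists e, af e x = (vnorm x)%:C;
  af_inj : forall r e, af r (av e) = 1 -> af r =1 af e;
  ap0 : forall e, ap e 0;
  apL : forall e a x y, ap e x -> ap e y -> ap e (a *: x + y);
  ap_af : forall e x, ap e x -> af e x = 0;
  ap_face : forall e x, vnorm x <= 1 -> af e x = 1 -> ap e (x - av e);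
  ap_norm : forall e a x, ap e x -> normc a <= 1 -> vnorm x <= 1 ->
    vnorm (a *: av e + x) <= 1;
  arv : forall e a, normc a = 1 -> av (ar a e) = a *: av e;
  arf : forall e a x, normc a = 1 -> af (ar a e) x = a^* * af e x;
  arp : forall e a x, normc a = 1 -> ap (ar a e) x <-> ap e x;
  no_infinite_frame : forall (v : nat -> atom) x (eps : R), 0 < eps ->
    (forall m n, m != n -> ap (v m) (av (v n))) ->
    ~ (forall n, eps <= complex.Re (af (v n) x));
  two_atoms : forall e e', [\/ ap e (av e'),
    exists2 a, normc a = 1 & av e' = a *: av e
  | exists u12 u21 u22 a (c s c' s' : R),
    [/\ matrix_units av ap (av e) u12 u21 u22,
        [/\ normc a = 1, c ^+ 2 + s ^+ 2 = 1 & c' ^+ 2 + s' ^+ 2 = 1],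
        av e' = a *: lin4 (av e) u12 u21 u22
          (c * c')%:C (c * s')%:C (s * c')%:C (s * s')%:C
      & af e (av e') = a * (c * c')%:C]]
}.

End atomic.

Section peirce.
Variables (R : realType) (A : normedModType R[i]) (E : atomic A).
Implicit Types (e r : E) (x y z D : A) (a : R[i]) (t : R).

Lemma af0 e : af e 0 = 0.
Proof. exact: ap_af (ap0 _). Qed.

Lemma afD e x y : af e (x + y) = af e x + af e y.
Proof. by have := afL e 1 x y; rewrite scale1r mul1r. Qed.

Lemma afZ e a x : af e (a *: x) = a * af e x.
Proof. by have := afL e a x 0; rewrite af0 !addr0. Qed.

Lemma afN e x : af e (- x) = - af e x.
Proof. by rewrite -scaleN1r afZ mulN1r. Qed.

Lemma afB e x y : af e (x - y) = af e x - af e y.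
Proof. by rewrite afD afN. Qed.

Lemma apZ e a x : ap e x -> ap e (a *: x).
Proof. by move=> /(apL a)/(_ (ap0 e)); rewrite addr0. Qed.

Lemma apD e x y : ap e x -> ap e y -> ap e (x + y).
Proof. by move=> ex ey; have := apL 1 ex ey; rewrite scale1r. Qed.

Lemma apN e x : ap e x -> ap e (- x).
Proof. by rewrite -scaleN1r; exact: apZ. Qed.

Lemma apB e x y : ap e x -> ap e y -> ap e (x - y).
Proof. by move=> ex ey; apply: apD => //; exact: apN. Qed.

Lemma ap_sum e (K : Type) (s : seq K) (P : pred K) (c : K -> A) :
  (forall k, P k -> ap e (c k)) -> ap e (\sum_(k <- s | P k) c k).
Proof. by move=> h; elim/big_ind: _ => //; [exact: ap0|exact: apD]. Qed.

Lemma vnorm_atom e : vnorm (av e) = 1.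
Proof.
apply/eqP; rewrite eq_le; apply/andP; split.
  have := @ap_norm _ _ E e 1 0 (ap0 e).
  by rewrite normc1 vnorm0 scale1r addr0; apply.
by have := af_le e (av e); rewrite afv normc1.
Qed.

Definition face e x := vnorm x <= 1 /\ af e x = 1.

Lemma face_norm e x : face e x -> vnorm x = 1.
Proof.
move=> [x1 ex]; apply/eqP; rewrite eq_le x1 /=.
by have := af_le e x; rewrite ex normc1.
Qed.

Lemma face_ap e x : face e x -> ap e (x - av e).
Proof. by case; exact: ap_face. Qed.

Lemma atom_face e : face e (av e).
Proof. by split; [rewrite vnorm_atom|rewrite afv]. Qed.

Lemma faceD e y : ap e y -> vnorm y <= 1 -> face e (av e + y).
Proof.
move=> ey y1; split; last by rewrite afD afv ap_af// addr0.
by have := ap_norm ey _ y1 (a := 1); rewrite normc1 scale1r; apply.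
Qed.

(** With [y = x - av e] and [s = vnorm y > 1], the vector [y - av e] is [s] times
    [- s^-1 e + s^-1 y], an orthogonal sum of norm at most 1. Then [2 y = (y - e) + x] gives
    [2 s <= s + 1], a contradiction. *)
Lemma face_sub_le1 e x : face e x -> vnorm (x - av e) <= 1.
Proof.
move=> ex; have ey := face_ap ex; have [x1 _] := ex.
set y := x - av e in ey *.
have [//|y1] := leP (vnorm y) 1.
have y0 : 0 < vnorm y := lt_trans ltr01 y1.
have nC : (vnorm y)%:C != 0 :> R[i] by rewrite realC_neq0// gt_eqF.
have : vnorm (y - av e) <= vnorm y.
  have -> : y - av e = (vnorm y)%:C *:
      ((- (vnorm y)%:C^-1) *: av e + (vnorm y)%:C^-1 *: y).
    by rewrite scalerDr !scalerA mulrN divff// scaleN1r scale1r addrC.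
  rewrite vnormZr ger0_norm ?vnorm_ge0//.
  rewrite ler_piMr ?vnorm_ge0//; apply: ap_norm; first exact: apZ.
    by rewrite normcN normcV normcR ger0_norm ?vnorm_ge0// invf_le1// ltW.
  by rewrite vnormZ normcV normcR ger0_norm ?vnorm_ge0// mulVf// gt_eqF.
have := vnormD (y - av e) x.
rewrite (_ : y - av e + x = 2%:C *: y); last first.
  by rewrite rmorph_nat scaler_nat mulr2n -addrA [- _ + _]addrC.
by rewrite vnormZr ger0_norm//; lra.
Qed.

Lemma face_split e x : face e x ->
  exists y, [/\ ap e y, vnorm y <= 1 & x = av e + y].
Proof.
move=> ex; exists (x - av e); split; [exact: face_ap|exact: face_sub_le1|].
by rewrite addrC subrK.
Qed.

Lemma face_sum2 e x y : face e x -> face e y -> vnorm (x + y) = 2.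
Proof.
move=> [x1 ex] [y1 ey]; apply/eqP; rewrite eq_le; apply/andP; split.
  by apply: le_trans (vnormD _ _) _; rewrite -[2]/(1 + 1) lerD.
have := af_le e (x + y); rewrite afD ex ey.
by rewrite -[1 + 1]/(2%:R) -(rmorph_nat (real_complex R)) normcR ger0_norm.
Qed.

Lemma af_Re_le r x : complex.Re (af r x) <= vnorm x.
Proof.
exact: le_trans (ler_norm _) (le_trans (Re_le_normc _) (af_le _ _)).
Qed.

Lemma af_attain2 x y : vnorm x <= 1 -> vnorm y <= 1 -> vnorm (x + y) = 2 ->
  exists2 r : E, af r x = 1 & af r y = 1.
Proof.
move=> x1 y1 xy.
have xy0 : x + y <> 0 by move=> xy0; move: xy; rewrite xy0 vnorm0; lra.
have [r] := af_attain E xy0; rewrite xy afD => rxy.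
have := congr1 (@complex.Re _) rxy; rewrite raddfD /= => Rxy.
have := af_Re_le r x; have := af_Re_le r y => ry rx.
exists r; apply: normc_le1_Re1.
- exact: le_trans (af_le _ _) x1.
- by lra.
- exact: le_trans (af_le _ _) y1.
- by lra.
Qed.

(** [av e + y] is a smooth point of the unit ball when [vnorm y < 1]. *)
Lemma face_smooth e y z : ap e y -> vnorm y < 1 -> vnorm z <= 1 ->
  vnorm (av e + y + z) = 2 -> face e z.
Proof.
move=> ey y1 z1 xz; have [ex _] := faceD ey (ltW y1).
have [r rx rz] := af_attain2 ex z1 xz.
suff re : af r (av e) = 1 by split=> //; rewrite -(af_inj re).
move: rx; rewrite afD => rx.
have [y0|y0] := eqVneq y 0; first by move: rx; rewrite y0 af0 addr0 => <-.
set b := af r y in rx.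
have s0 : 0 < vnorm y.
  by rewrite lt_neqAle vnorm_ge0 andbT eq_sym; apply/eqP => /vnorm_eq0/eqP; exact/negP.
have ey' : ap e ((vnorm y)^-1%:C *: y) by exact: apZ.
have y'1 : vnorm ((vnorm y)^-1%:C *: y) <= 1.
  by rewrite vnormZr ger0_norm ?invr_ge0 ?vnorm_ge0// mulVf// gt_eqF.
(* [r] is evaluated at the orthogonal sum of [a *: av e] and the normalized [y]. With
   [k = (vnorm y)^-1 > 1], the choices [a = 1] and [a = -1] give [|1 + (k - 1) b| <= 1] and
   [|(k + 1) b - 1| <= 1], which together force [b = 0]. *)
have h a : normc a <= 1 -> normc (a * (1 - b) + (vnorm y)^-1%:C * b) <= 1.
  move=> a1; have := le_trans (af_le r _) (ap_norm ey' a1 y'1).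
  by rewrite afD !afZ -/b -rx addrK.
have k1 : 1 < (vnorm y)^-1 by rewrite invf_gt1.
suff b0 : b = 0 by rewrite -rx b0 addr0.
have := h 1; have := h (-1); rewrite normcN1 normc1 mul1r.
case: b {rx h} => u v; move: (vnorm y)^-1 k1 => k k1.
move=> /(_ (lexx _)) + /(_ (lexx _)).
rewrite !normc_le// !expr1n /= => h1 h2.
have {}h1 : (k + 1) * (- 2 * u + (k + 1) * (u ^+ 2 + v ^+ 2)) <= 0 by lra.
have {}h2 : (k - 1) * (2 * u + (k - 1) * (u ^+ 2 + v ^+ 2)) <= 0 by lra.
rewrite pmulr_rle0 in h1; last by lra.
rewrite pmulr_rle0 in h2; last by lra.
have h : k * (u ^+ 2 + v ^+ 2) <= 0 by lra.
rewrite pmulr_rle0 in h; last by lra.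
have u0 := sqr_ge0 u; have v0 := sqr_ge0 v.
have /eqP : u ^+ 2 = 0 by lra.
have /eqP : v ^+ 2 = 0 by lra.
by rewrite !sqrf_eq0 => /eqP -> /eqP ->.
Qed.

(** Orthogonality to an atom is read off from two distances, which an isometry can transport.
    Tangent discs make the coefficient of [x] at [e] vanish; then [x + b e], divided by a suitable
    [b], lies in the face of [e], whose points differ from [e] by vectors orthogonal to [e]. *)
Lemma ap_touch e x a t : 0 <= t <= 1 -> a != 0 ->
  vnorm (x + (t%:C * a) *: av e) <= t * normc a ->
  vnorm (x - ((1 - t)%:C * a) *: av e) <= (1 - t) * normc a -> ap e x.
Proof.
move=> t01 a0 h1 h2.
have ex0 : af e x = 0.
  apply: (@touching_discs _ _ a t t01).
    by rewrite -[X in _ + X](mulr1) -(afv e) -afZ -afD (le_trans (af_le _ _)).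
  by rewrite -[X in _ - X](mulr1) -(afv e) -afZ -afB (le_trans (af_le _ _)).
have key b : b != 0 -> vnorm (x + b *: av e) <= normc b -> ap e x.
  move=> b0 xb.
  have nb : 0 < normc b.
    rewrite lt_neqAle normc_ge0 andbT eq_sym; apply: contra_neq b0.
    exact: eq0_normc.
  have /(@ap_face _ _ E e) : vnorm (b^-1 *: (x + b *: av e)) <= 1.
    by rewrite vnormZ normcV mulrC ler_pdivrMr// mul1r.
  rewrite afZ afD afZ ex0 add0r afv mulr1 mulVf// => /(_ erefl).
  rewrite scalerDr scalerA mulVf// scale1r addrK => /(apZ b).
  by rewrite scalerA divff// scale1r.
have [t0|t0] := eqVneq t 0.
  apply: (key (- a)); first by rewrite oppr_eq0.
  by move: h2; rewrite t0 subr0 !mul1r normcN scaleNr.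
case/andP: t01 => t_ge0 t_le1.
apply: (key (t%:C * a)); first by rewrite mulf_neq0// realC_neq0.
by rewrite normcM normcR ger0_norm.
Qed.

(** For the normalization [y] of [x], every [a e + y] with [|a| <= 1] is in the unit ball, and
    [af r] is there [1 + a * af r (av e)]; [a = 1] and [a = -1] give [af r (av e) = 0]. So [e + y]
    and [y] both lie in the face of [r], and their difference [e] is orthogonal to [r]. *)
Lemma ap_attain e r x : ap e x -> x <> 0 -> af r x = (vnorm x)%:C -> ap r (av e).
Proof.
move=> ex x0 rx.
have s0 : 0 < vnorm x.
  by rewrite lt_neqAle vnorm_ge0 andbT eq_sym; apply/eqP => /vnorm_eq0.
set y := (vnorm x)^-1%:C *: x.
have ey : ap e y by exact: apZ.
have y1 : vnorm y <= 1.
  by rewrite vnormZr ger0_norm ?invr_ge0 ?vnorm_ge0// mulVf// gt_eqF.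
have ry : af r y = 1.
  by rewrite afZ rx -rmorphM mulVf ?rmorph1// gt_eqF.
have h a : normc a <= 1 -> normc (1 + a * af r (av e)) <= 1.
  move=> a1; have := le_trans (af_le r _) (ap_norm ey a1 y1).
  by rewrite afD afZ ry addrC.
have re0 : af r (av e) = 0.
  apply: normc_add_sub_le1.
    by have := h 1; rewrite mul1r; apply; rewrite normc1.
  by have := h (-1); rewrite mulN1r; apply; rewrite normcN1.
have [ey1 _] := faceD ey y1.
have := ap_face ey1 (_ : af r _ = 1); rewrite afD re0 ry add0r => /(_ erefl) h1.
by have := apB h1 (ap_face y1 ry); rewrite opprB addrA subrK addrK.
Qed.

Lemma ap_sym e r : ap e (av r) -> ap r (av e).
Proof.
move=> er; apply: (ap_attain er); last by rewrite afv vnorm_atom.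
by move=> r0; have := vnorm_atom r; rewrite r0 vnorm0; lra.
Qed.

Lemma ap_exists (K : Type) (v : K -> E) x : (forall k, ap (v k) x) -> x <> 0 ->
  exists r, [/\ af r x = (vnorm x)%:C, forall k, ap (v k) (av r)
    & forall k, ap r (av (v k))].
Proof.
move=> vx x0; have [r rx] := af_attain E x0; exists r; split=> // k.
  by apply: ap_sym; exact: (ap_attain (vx k)).
exact: (ap_attain (vx k)).
Qed.

Lemma vnorm_frame (K : eqType) (v : K -> E) (c : K -> R[i]) (s : seq K) :
  (forall j k, j != k -> ap (v j) (av (v k))) -> (forall k, normc (c k) <= 1) ->
  uniq s -> vnorm (\sum_(k <- s) c k *: av (v k)) <= 1.
Proof.
move=> vv c1; elim: s => [|k s ih] /=; first by rewrite big_nil vnorm0.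
case/andP=> ks us; rewrite big_cons; apply: ap_norm => //; last exact: ih.
rewrite big_seq_cond; apply: ap_sum => j /andP[js _]; apply: apZ; apply: vv.
by apply: contraNneq ks => ->.
Qed.

End peirce.

(** * Isometries of the unit sphere *)

(** The points at parameters [t] and [1 - t] have sum [u + v], of norm 2, and each has norm at most
    1, so neither can be shorter. *)
Lemma norm_segment (R : realType) (Y : normedModType R) (u v : Y) t :
  `|u| = 1 -> `|v| = 1 -> `|u + v| = 2 -> 0 <= t <= 1 ->
  `|(1 - t) *: u + t *: v| = 1.
Proof.
move=> u1 v1 uv /andP[t0 t1].
have le1 s : 0 <= s -> s <= 1 -> `|(1 - s) *: u + s *: v| <= 1.
  move=> s0 s1; apply: le_trans (ler_normD _ _) _.
  by rewrite !normrZ u1 v1 !ger0_norm ?subr_ge0//; lra.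
apply/eqP; rewrite eq_le le1//=.
have := ler_normD ((1 - t) *: u + t *: v) ((1 - (1 - t)) *: u + (1 - t) *: v).
rewrite addrACA -!scalerDl [X in X *: u](_ : _ = 1); last by ring.
rewrite [X in X *: v](_ : _ = 1); last by ring.
have := le1 (1 - t); rewrite !scale1r uv; lra.
Qed.

Section frame.
Variables (R : realType) (A : normedModType R[i]) (E : atomic A).
Variables (K : finType) (v : K -> E).
Hypothesis v_ortho : forall j k, j != k -> ap (v j) (av (v k)).
Implicit Types (a b c : K -> R) (j k : K) (s t : R).

Definition frame_sum c : A := \sum_k (c k)%:C *: av (v k).

Lemma frame_sumE c k : frame_sum c =
  (c k)%:C *: av (v k) + \sum_(j | j != k) (c j)%:C *: av (v j).
Proof. by rewrite /frame_sum (bigD1 k). Qed.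

Lemma ap_frame_rest c k : ap (v k) (\sum_(j | j != k) (c j)%:C *: av (v j)).
Proof. by apply: ap_sum => j jk; apply: apZ; apply: v_ortho; rewrite eq_sym. Qed.

Lemma af_frame_sum c k : af (v k) (frame_sum c) = (c k)%:C.
Proof.
by rewrite (frame_sumE c k) afD afZ afv mulr1 (ap_af (ap_frame_rest c k)) addr0.
Qed.

Lemma ap_frame_sum (r : E) c : (forall k, ap r (av (v k))) -> ap r (frame_sum c).
Proof. by move=> rv; apply: ap_sum => k _; exact: apZ. Qed.

Lemma vnorm_frame_sum c : (forall k, `|c k| <= 1) -> vnorm (frame_sum c) <= 1.
Proof.
move=> c1; rewrite /frame_sum -big_enum /=.
by apply: vnorm_frame (enum_uniq _) => // k; rewrite normcR.
Qed.

Lemma frame_sum_affine a b t :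
  (1 - t)%:C *: frame_sum a + t%:C *: frame_sum b =
  frame_sum (fun k => (1 - t) * a k + t * b k).
Proof.
rewrite /frame_sum !scaler_sumr -big_split; apply: eq_bigr => k _ /=.
by rewrite !scalerA -scalerDl -!rmorphM -rmorphD.
Qed.

Lemma frame_sum_upd c k s :
  frame_sum c - frame_sum [eta c with k |-> s] = (c k - s)%:C *: av (v k).
Proof.
rewrite (frame_sumE c k) (frame_sumE _ k) /= eqxx.
rewrite [X in _ - (_ + X)](eq_bigr (fun j => (c j)%:C *: av (v j))); last first.
  by move=> j /negPf ->.
by rewrite opprD addrACA subrr addr0 rmorphB scalerBl.
Qed.

Lemma frame_sum_face c k : (forall j, `|c j| <= 1) -> c k = 1 ->
  face (v k) (frame_sum c).
Proof.
by move=> c1 ck; split; [exact: vnorm_frame_sum|rewrite af_frame_sum ck].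
Qed.

Lemma frame_sum_faceN c k : (forall j, `|c j| <= 1) -> c k = -1 ->
  face (ar (-1) (v k)) (frame_sum c).
Proof.
move=> c1 ck; split; first exact: vnorm_frame_sum.
rewrite arf ?normcN1// af_frame_sum ck rmorphN rmorph1 rmorphN rmorph1.
by rewrite mulrNN mulr1.
Qed.

End frame.

Section sphere_isometry.
Variables (R : realType) (A : normedModType R[i]) (E : atomic A).
Variables (Y : normedModType R) (f : A -> Y).
Hypothesis f_isom : forall x y, vnorm x = 1 -> vnorm y = 1 ->
  `|f x - f y| = vnorm (x - y).
Hypothesis f_norm : forall x, vnorm x = 1 -> `|f x| = 1.
Hypothesis f_surj : forall y, `|y| = 1 -> exists2 x, vnorm x = 1 & f x = y.
Implicit Types (e r w : E) (x y z : A) (t : R).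

Lemma f_inj x y : vnorm x = 1 -> vnorm y = 1 -> f x = f y -> x = y.
Proof.
move=> x1 y1 xy; apply/eqP; rewrite -subr_eq0; apply/eqP/vnorm_eq0.
by rewrite -f_isom// xy subrr normr0.
Qed.

Lemma vnormN1 x : vnorm x = 1 -> vnorm (- x) = 1.
Proof. by rewrite vnormN. Qed.

Lemma f_opp x : vnorm x = 1 -> exists2 y, vnorm y = 1 & f y = - f x.
Proof. by move=> x1; apply: f_surj; rewrite normrN f_norm. Qed.

Lemma norm2 (y : Y) : `|y| = 1 -> `|y + y| = 2.
Proof. by move=> y1; rewrite -mulr2n normrMn y1. Qed.

Lemma faceN_rot e x : face (ar (-1) e) x <-> face e (- x).
Proof.
rewrite /face vnormN arf ?normcN1// afN.
by rewrite rmorphN rmorph1 mulN1r.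
Qed.

(** Since [av e] is a smooth point, a unit vector at distance 2 from [- av e] lies in the face
    ([star]). The preimage [e'] of [- f (- av e)] is such a vector, and then so is [y]: [vnorm (y +
    av e) = |f e' - f x| = vnorm (e' - x) = 2]. *)
Lemma face_antipodeN e x : face e (- x) -> exists2 y, face e y & f y = - f x.
Proof.
move=> ex; have x1 : vnorm x = 1 by rewrite -vnormN (face_norm ex).
have v1 := vnorm_atom e; have v1' := vnormN1 v1.
have star y : vnorm y = 1 -> vnorm (y + av e) = 2 -> face e y.
  move=> y1 y2; apply: (@face_smooth _ _ E e 0 y); rewrite ?vnorm0 ?y1//.
    exact: ap0.
  by rewrite addr0 addrC.
have [e' e'1 fe'] := f_opp v1'.
have ee' : face e e'.
  by apply: star => //; rewrite -(opprK (av e)) -f_isom// fe' -opprD normrN norm2// f_norm.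
have [y y1 fy] := f_opp x1; exists y => //; apply: star => //.
rewrite -(opprK (av e)) -f_isom// fy -opprD normrN -(opprK (f (- av e))) -fe'.
by rewrite f_isom// -vnormN opprB addrC (face_sum2 ex ee').
Qed.

Lemma face_antipode e x : face e x -> exists2 y, face e (- y) & f y = - f x.
Proof.
move=> ex; have /face_antipodeN[y ey fy] : face (ar (-1) e) (- x).
  by apply/faceN_rot; rewrite opprK.
by exists y => //; apply/faceN_rot.
Qed.

Lemma norm_face_sum e x y : face e x -> face e y -> `|f x + f y| = 2.
Proof.
move=> ex ey; have [y' ey' fy'] := face_antipode ey.
have y'1 : vnorm y' = 1 by rewrite -vnormN (face_norm ey').
by rewrite -(opprK (f y)) -fy' f_isom ?(face_norm ex)// (face_sum2 ex ey').
Qed.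

Lemma norm_face_segment e x y t : face e x -> face e y -> 0 <= t <= 1 ->
  `|(1 - t) *: f x + t *: f y| = 1.
Proof.
move=> ex ey; apply: norm_segment; last exact: norm_face_sum ex ey.
  exact: f_norm (face_norm ex).
exact: f_norm (face_norm ey).
Qed.

(** The image of a face is star-shaped about the images of its smooth points,
    which are dense in it. *)
Lemma image_face_star e x y t : ap e x -> vnorm x < 1 -> face e y ->
  0 <= t <= 1 ->
  exists2 z, face e z & f z = (1 - t) *: f (av e + x) + t *: f y.
Proof.
move=> ex x1 ey t01; have ex' := faceD ex (ltW x1).
have x'1 := face_norm ex'.
have w1 := norm_face_segment ex' ey t01; set w := _ + _ in w1.
have [z z1 fz] : exists2 z, vnorm z = 1 & f z = - w.
  by apply: f_surj; rewrite normrN.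
suff /face_antipodeN[z' ez' fz'] : face e (- z).
  by exists z' => //; rewrite fz' fz opprK.
apply: (face_smooth ex x1); first by rewrite vnormN z1.
rewrite -f_isom// fz opprK.
rewrite (_ : f (av e + x) + w =
    2 *: ((1 - t / 2) *: f (av e + x) + (t / 2) *: f y)).
  rewrite normrZ ger0_norm// (norm_face_segment ex' ey) ?mulr1//; lra.
rewrite /w addrA -[X in X + _ + _]scale1r -scalerDl scalerDr !scalerA.
by congr (_ *: _ + _ *: _); field.
Qed.

(** Replacing [x = av e + x0] by the smooth point [av e + (1 - d / 2) x0] moves the barycenter in
    [Y] by at most [d / 2]. The star-shaped case puts the new barycenter in the image of the face,
    and [af e] is a contraction, so [af e z] is within [d] of 1 for every [d > 0]. *)
Lemma image_face_convex e x y t : face e x -> face e y -> 0 <= t <= 1 ->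
  exists2 z, face e z & f z = (1 - t) *: f x + t *: f y.
Proof.
move=> ex ey t01; have x1 := face_norm ex; have y1 := face_norm ey.
have [z z1 fz] := f_surj (norm_face_segment ex ey t01).
exists z => //; split; first by rewrite z1.
have [x0 [ex0 x01 xE]] := face_split ex.
have x0_ge0 := vnorm_ge0 x0.
apply/eqP; rewrite -subr_eq0; apply/eqP/eq0_normc/eqP.
rewrite eq_le normc_ge0 andbT; apply/ler_addgt0Pr => d d0; rewrite add0r.
have [d1|d1] := leP 2 d.
  apply: le_trans d1.
  have [_ <-] := atom_face e; rewrite -afB; apply: le_trans (af_le _ _) _.
  by apply: le_trans (vnormB _ _) _; rewrite z1 vnorm_atom.
have ex0' : ap e ((1 - d / 2)%:C *: x0) by exact: apZ.
have x0'1 : vnorm ((1 - d / 2)%:C *: x0) < 1.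
  rewrite vnormZr ger0_norm; last by lra.
  by apply: le_lt_trans (_ : 1 - d / 2 < 1); [rewrite ler_piMr//; lra|lra].
have [z' ez' fz'] := image_face_star ex0' x0'1 ey t01.
have [_ <-] := ez'; rewrite -afB; apply: le_trans (af_le _ _) _.
rewrite -f_isom ?(face_norm ez')// fz fz' opprD addrACA subrr addr0 -scalerBr.
rewrite normrZ f_isom//; last by rewrite (face_norm (faceD ex0' (ltW x0'1))).
rewrite xE opprD addrACA subrr add0r.
rewrite (_ : x0 - _ = (d / 2)%:C *: x0); last first.
  by rewrite rmorphB rmorph1 scalerBl scale1r opprB addrC subrK.
case/andP: t01 => t0 t1.
rewrite vnormZr !ger0_norm; [|lra|lra].
have d2 : d / 2 * vnorm x0 <= d / 2 by rewrite ler_piMr//; lra.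
apply: le_trans (_ : d / 2 * vnorm x0 <= _); last by lra.
by rewrite ler_piMl//; [rewrite mulr_ge0//; lra|lra].
Qed.

Lemma bary_face e x y z t : vnorm z = 1 -> face e x -> face e y ->
  0 <= t <= 1 -> f z = (1 - t) *: f x + t *: f y -> face e z.
Proof.
move=> z1 ex ey t01 fz; have [z' ez' fz'] := image_face_convex ex ey t01.
by rewrite (f_inj z1 (face_norm ez') _)// fz'.
Qed.

Lemma bary_conical x y z x' y' z' t : 0 <= t <= 1 ->
  vnorm x = 1 -> vnorm y = 1 -> vnorm z = 1 ->
  vnorm x' = 1 -> vnorm y' = 1 -> vnorm z' = 1 ->
  f z = (1 - t) *: f x + t *: f y -> f z' = (1 - t) *: f x' + t *: f y' ->
  vnorm (z - z') <= (1 - t) * vnorm (x - x') + t * vnorm (y - y').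
Proof.
move=> /andP[t0 t1] x1 y1 z1 x'1 y'1 z'1 fz fz'.
rewrite -f_isom// fz fz' opprD addrACA -!scalerBr.
apply: le_trans (ler_normD _ _) _.
by rewrite !normrZ !f_isom// !ger0_norm// subr_ge0.
Qed.

Lemma face_subr r x : ap r x -> vnorm x <= 1 -> face (ar (-1) r) (x - av r).
Proof.
move=> rx x1; have -> : x - av r = av (ar (-1) r) + x.
  by rewrite arv ?normcN1// scaleN1r addrC.
by apply: faceD => //; apply/arp; rewrite ?normcN1.
Qed.

(** If [z] differed from the barycenter [c] by some [D] orthogonal to all the
    [v k], an atom [r] at which [D] attains its norm would be at distance less
    than 1 from both [D] and [- D]. *)
Lemma bary_rigid (K : Type) (v : K -> E) x y z t : 0 <= t <= 1 ->
  vnorm x = 1 -> vnorm y = 1 -> vnorm z = 1 ->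
  f z = (1 - t) *: f x + t *: f y ->
  (forall k, ap (v k) (z - ((1 - t)%:C *: x + t%:C *: y))) ->
  (forall r, (forall k, ap r (av (v k))) -> ap r x /\ ap r y) ->
  z = (1 - t)%:C *: x + t%:C *: y.
Proof.
move=> t01 x1 y1 z1 fz vD vr; set c := (X in z - X) in vD *.
apply/eqP; rewrite -subr_eq0; apply/eqP; apply: contrapT => D0.
have [r [rD _ rv]] := ap_exists vD D0.
have [rx ry] := vr r rv.
have s0 : 0 < vnorm (z - c).
  by rewrite lt_neqAle vnorm_ge0 andbT eq_sym; apply/eqP => /vnorm_eq0.
have rc : af r c = 0 by apply: ap_af; apply: apD; exact: apZ.
have rz : af r z = (vnorm (z - c))%:C by rewrite -rD afB rc subr0.
have le1 u : vnorm u = 1 -> vnorm (u : A) <= 1 by move=> ->.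
have fx := face_subr rx (le1 _ x1); have fy := face_subr ry (le1 _ y1).
(* Both [x - av r] and [y - av r] lie in the face of [- av r], hence so does [z']. It is at distance
   at most 1 from [z], whereas [af r (z - z')] has real part [vnorm (z - c) + 1]. *)
have [z' [z'1 rz'] fz'] := image_face_convex fx fy t01.
have := bary_conical t01 x1 y1 z1 (face_norm fx) (face_norm fy)
  (face_norm (conj z'1 rz')) fz fz'.
rewrite !subKr vnorm_atom !mulr1 subrK => h.
have := le_trans (af_Re_le r (z - z')) h.
rewrite afB raddfB rz /=.
move: rz'; rewrite arf ?normcN1// rmorphN rmorph1 mulN1r.
move=> /(congr1 (@complex.Re _)); rewrite raddfN /= => rz' h'.
by lra.
Qed.

Lemma bary_common x z t : vnorm x = 1 -> vnorm z = 1 ->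
  f z = (1 - t) *: f x + t *: f x -> z = x.
Proof. by move=> x1 z1; rewrite -scalerDl subrK scale1r => /f_inj; exact. Qed.

(** Let [z] be the preimage of the right-hand side and [c] the expected point. As [z] is in the face
    of [w], [z - c] is orthogonal to [w]; as [z] is at distances [t |b - a|] and [(1 - t) |b - a|]
    from the two end points, [ap_touch] makes [z - c] orthogonal to [e]. Then [bary_rigid] gives
    [z = c]. *)
Lemma disc_affine w e (a b : R[i]) t : ap w (av e) ->
  normc a <= 1 -> normc b <= 1 -> 0 <= t <= 1 ->
  f (av w + ((1 - t)%:C * a + t%:C * b) *: av e) =
  (1 - t) *: f (av w + a *: av e) + t *: f (av w + b *: av e).
Proof.
move=> we a1 b1 t01.
have fw d : normc d <= 1 -> face w (av w + d *: av e).
  by move=> d1; apply: faceD; [exact: apZ|rewrite vnormZ vnorm_atom mulr1].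
have [z wz fz] := image_face_convex (fw _ a1) (fw _ b1) t01.
set x := av w + a *: _ in fz *; set y := av w + b *: _ in fz *.
have x1 : vnorm x = 1 := face_norm (fw _ a1).
have y1 : vnorm y = 1 := face_norm (fw _ b1).
have z1 := face_norm wz.
have cE : (1 - t)%:C *: x + t%:C *: y =
    av w + ((1 - t)%:C * a + t%:C * b) *: av e.
  rewrite /x /y !scalerDr addrACA -scalerDl -rmorphD subrK scale1r.
  by rewrite !scalerA -scalerDl.
rewrite -cE -fz; congr f; apply/esym.
apply: (@bary_rigid bool (fun k => if k then w else e) _ _ _ t) => //.
- case.
    rewrite cE opprD addrA; apply: apB; last exact: apZ.
    exact: face_ap.
  have [ab|ab] := eqVneq a b.
    rewrite (bary_common x1 z1 (t := t)); last by rewrite {2}/x ab.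
    rewrite /y -ab -/x -scalerDl -rmorphD subrK scale1r subrr; exact: ap0.
  apply: (@ap_touch _ _ E e _ (b - a) t) => //; first by rewrite subr_eq0 eq_sym.
    rewrite [X in vnorm X](_ : _ = z - x).
      rewrite -f_isom// fz -[X in _ - X]scale1r.
      rewrite addrAC -scalerBl addrAC subrr add0r scaleNr addrC -scalerBr.
      rewrite normrZ f_isom// ger0_norm; last by case/andP: t01.
      rewrite ler_wpM2l//; first by case/andP: t01.
      rewrite /x /y opprD addrACA subrr add0r -scalerBl vnormZ vnorm_atom.
      by rewrite mulr1.
    rewrite cE /x -addrA !opprD -(addrA (- av w)) -!(scaleNr _ (av e)) -scalerDl.
    by rewrite rmorphB rmorph1; congr (_ + (_ + _ *: _)); ring.
  rewrite [X in vnorm X](_ : _ = z - y).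
    rewrite -f_isom// fz -[X in _ - X]scale1r.
    rewrite -addrA -scalerBl -[t - 1]opprB scaleNr -scalerBr.
    have t10 : 0 <= 1 - t by case/andP: t01; lra.
    rewrite normrZ f_isom// ger0_norm// ler_wpM2l//.
    rewrite /x /y opprD addrACA subrr add0r -scalerBl vnormZ vnorm_atom.
    by rewrite mulr1 -normcN opprB.
  rewrite cE /y -addrA !opprD -(addrA (- av w)) -!(scaleNr _ (av e)) -scalerDl.
  by rewrite rmorphB rmorph1; congr (_ + (_ + _ *: _)); ring.
- move=> r rv; have /= rw := rv true; have /= re := rv false.
  have [wz1 wzv] := (face_norm (atom_face w), apZ).
  by split; apply: apD => //; exact: apZ.
Qed.

(** The preimage [z] of the antipode of [f (- u)], with [u := w + e], lies in
    the faces of [w] and [e]; if [z <> u], an atom at which [z - u] attains its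
    norm contradicts the isometry. *)
Lemma odd_two_atoms w e : ap w (av e) ->
  f (- (av w + av e)) = - f (av w + av e).
Proof.
move=> we; have ew := ap_sym we; set u := _ + _.
have fw : face w u by apply: faceD; rewrite ?vnorm_atom.
have fe : face e u by rewrite /u addrC; apply: faceD; rewrite ?vnorm_atom.
have u1 := face_norm fw; have Nu1 := vnormN1 u1.
have [z z1 fz] := f_opp Nu1.
have fwz : face w z.
  have := @face_antipodeN w (- u); rewrite opprK => /(_ fw)[z' wz' fz'].
  by rewrite (f_inj z1 (face_norm wz') _)// fz'.
have fez : face e z.
  have := @face_antipodeN e (- u); rewrite opprK => /(_ fe)[z' wz' fz'].
  by rewrite (f_inj z1 (face_norm wz') _)// fz'.
suff zu : z = u by rewrite -[LHS]opprK -fz zu.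
apply/eqP; rewrite -subr_eq0; apply/eqP; apply: contrapT => D0.
have vD (k : bool) : ap (if k then w else e) (z - u).
  case: k.
    by rewrite /u opprD addrA; apply: apB => //; exact: face_ap.
  by rewrite /u [_ + av e]addrC opprD addrA; apply: apB => //; exact: face_ap.
have [r [rD _ rv]] := ap_exists vD D0.
have ru : ap r u by apply: apD; [exact: (rv true)|exact: (rv false)].
have s0 : 0 < vnorm (z - u).
  by rewrite lt_neqAle vnorm_ge0 andbT eq_sym; apply/eqP => /vnorm_eq0.
have fr : face r (av r - u).
  by apply: faceD; [exact: apN|rewrite vnormN u1].
have [z' rz' fz'] := face_antipode fr.
have z'1 : vnorm z' = 1 by rewrite -vnormN (face_norm rz').
have zz' : vnorm (z - z') <= 1.
  rewrite -f_isom// fz fz' -opprD normrN f_isom//; last exact: face_norm fr.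
  by rewrite opprB addKr vnormN vnorm_atom.
have := le_trans (af_Re_le r (z - z')) zz'.
have -> : z - z' = (z - u) + u - z' by rewrite subrK.
rewrite afB afD rD (ap_af ru) addr0 raddfB /=.
case: rz' => _; rewrite afN => /(congr1 (@complex.Re _)); rewrite raddfN /=.
by move=> ? ?; lra.
Qed.

(** Induction on the number of coordinates at which [a] and [b] are not both [1]
    or both [-1]: replacing such a coordinate by [1] or [-1] gives two points to
    compare distances with, which determine it in the preimage of the right-hand
    side. *)
Lemma cube_affine (K : finType) (v : K -> E) (k0 : K) (a b : K -> R) t :
  (forall j k, j != k -> ap (v j) (av (v k))) ->
  (forall k, `|a k| <= 1) -> (forall k, `|b k| <= 1) ->
  a k0 = 1 -> b k0 = 1 -> 0 <= t <= 1 ->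
  f (frame_sum v (fun k => (1 - t) * a k + t * b k)) =
  (1 - t) *: f (frame_sum v a) + t *: f (frame_sum v b).
Proof.
move=> vv + + + + t01.
pose free (a b : K -> R) k := ~~ ((a k == b k) && (`|a k| == 1)).
have [n] := ubnP #|[pred k | free a b k]|.
elim: n a b => // n ih a b; rewrite ltnS => ab a1 b1 ak0 bk0.
set x := frame_sum v a; set y := frame_sum v b.
have fx : face (v k0) x := frame_sum_face vv a1 ak0.
have fy : face (v k0) y := frame_sum_face vv b1 bk0.
have [z fz zE] := image_face_convex fx fy t01.
have [[x1 y1] z1] := (face_norm fx, face_norm fy, face_norm fz).
rewrite -zE -frame_sum_affine -/x -/y; congr f; apply/esym.
apply: (bary_rigid t01 x1 y1 z1 zE (v := v)); last first.
  by move=> r rv; split; exact: ap_frame_sum.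
move=> k; rewrite frame_sum_affine.
set c := fun k => (1 - t) * a k + t * b k.
have [/andP[/eqP abk ak1]|kfree] := boolP ((a k == b k) && (`|a k| == 1)).
  have ck : c k = a k by rewrite /c -abk -mulrDl subrK mul1r.
  have : a k = 1 \/ a k = -1.
    by move: ak1; rewrite eqr_norml ler01 andbT => /orP[]/eqP; [left|right].
  case=> ak.
    have zk : face (v k) z.
      apply: (bary_face z1 _ _ t01 zE); apply: frame_sum_face => //.
      by rewrite -abk.
    rewrite (frame_sumE _ _ k) ck ak scale1r opprD addrA.
    by apply: apB; [exact: face_ap|exact: ap_frame_rest].
  have zk : face (ar (-1) (v k)) z.
    apply: (bary_face z1 _ _ t01 zE); apply: frame_sum_faceN => //.
    by rewrite -abk.
  rewrite (frame_sumE _ _ k) ck ak opprD addrA.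
  apply: apB; last exact: ap_frame_rest.
  move: (face_ap zk); rewrite arv ?normcN1// => /arp.
  by rewrite rmorphN rmorph1; apply; exact: normcN1.
have k0k : k != k0.
  by apply: contraNneq kfree => ->; rewrite ak0 bk0 normr1 !eqxx.
have c1 j : `|c j| <= 1.
  have := a1 j; have := b1 j; rewrite !ler_norml => /andP[? ?] /andP[? ?].
  by case/andP: t01 => t0 t1; apply/andP; split; rewrite /c; nra.
have upd1 (u : K -> R) (s : R) j : (forall j, `|u j| <= 1) -> `|s| = 1 ->
    `|[eta u with k |-> s] j| <= 1.
  by move=> u1 s1 /=; case: ifP => // _; rewrite s1.
have comp (s : R) : `|s| = 1 ->
    vnorm (z - frame_sum v c + (c k - s)%:C *: av (v k)) <=
    (1 - t) * `|a k - s| + t * `|b k - s|.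
  move=> s1; set a' := [eta a with k |-> s]; set b' := [eta b with k |-> s].
  have a'1 j : `|a' j| <= 1 by exact: upd1.
  have b'1 j : `|b' j| <= 1 by exact: upd1.
  have a'k0 : a' k0 = 1 by rewrite /a' /= eq_sym (negPf k0k).
  have b'k0 : b' k0 = 1 by rewrite /b' /= eq_sym (negPf k0k).
  have c'E : (fun k => (1 - t) * a' k + t * b' k) = [eta c with k |-> s].
    apply/funext => j /=; rewrite /a' /b' /=; case: ifP => // _.
    by rewrite -mulrDl subrK mul1r.
  have := ih a' b' _ a'1 b'1 a'k0 b'k0; rewrite c'E => ih'.
  rewrite -frame_sum_upd // addrA subrK.
  have fa' := frame_sum_face vv a'1 a'k0.
  have fb' := frame_sum_face vv b'1 b'k0.
  have fc' : face (v k0) (frame_sum v [eta c with k |-> s]).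
    apply: (frame_sum_face vv); first by move=> j; exact: upd1.
    by rewrite /= eq_sym (negPf k0k) /c ak0 bk0 !mulr1 subrK.
  have [[x'1 y'1] c'1] := (face_norm fa', face_norm fb', face_norm fc').
  apply: le_trans (bary_conical t01 x1 y1 z1 x'1 y'1 c'1 zE (ih' _)) _.
    apply: leq_trans ab; apply: proper_card; apply/properP; split.
      apply/fintype.subsetP => j; rewrite !inE /free /a' /b' /=.
      by case: ifP => // _; rewrite s1 !eqxx.
    by exists k; rewrite !inE// /free /a' /b' /= !eqxx s1 eqxx.
  by rewrite !frame_sum_upd// !vnormZr !vnorm_atom !mulr1.
have c11 : -1 <= c k <= 1 by rewrite -ler_norml.
have ak11 : -1 <= a k <= 1 by rewrite -ler_norml.
have bk11 : -1 <= b k <= 1 by rewrite -ler_norml.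
(* [comp] bounds the distances from [z] to the points whose [k]-th coordinate is 1 or -1; they are
   the norms of the difference shifted by [c k - 1] and [c k + 1] along [av (v k)]. Writing these
   shifts as [t a] and [- (1 - t) a] gives [a = -2] and [t = (1 - c k) / 2]. *)
apply: (@ap_touch _ _ E _ _ (-2)%:C ((1 - c k) / 2)).
- by apply/andP; split; lra.
- by apply: realC_neq0; rewrite oppr_eq0.
- have := comp 1 (normr1 _); rewrite normcR normrN (ger0_norm (ler0n R 2)).
  rewrite (_ : ((1 - c k) / 2)%:C * (-2)%:C = (c k - 1)%:C).
    move=> /le_trans; apply; rewrite (distrC (a k)) (distrC (b k)) !ger0_norm; [|lra|lra].
    by rewrite /c; lra.
  by rewrite -rmorphM; congr (_%:C); field.
- have := comp (-1) (normrN1 _); rewrite normcR normrN (ger0_norm (ler0n R 2)).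
  rewrite -scaleNr (_ : - ((1 - (1 - c k) / 2)%:C * (-2)%:C) = (c k - (-1))%:C).
    move=> /le_trans; apply; rewrite !opprK !ger0_norm; [|lra|lra].
    by rewrite /c; lra.
  by rewrite -rmorphM -rmorphN; congr (_%:C); field.
Qed.

End sphere_isometry.

(** * Hahn-Banach *)

Section hahn_banach.
Variables (R : realType) (V : lmodType R).
Implicit Types (p : V -> R) (x y : V) (t : R).

Definition sublinear p :=
  (forall x y, p (x + y) <= p x + p y) /\
  (forall t x, 0 <= t -> p (t *: x) = t * p x).

Lemma sublinear0 p : sublinear p -> p 0 = 0.
Proof. by case=> _ /(_ 0 0 (lexx _)); rewrite scale0r mul0r. Qed.

Lemma sublinearN p x : sublinear p -> - p (- x) <= p x.
Proof.
by move=> ps; have [/(_ x (- x)) + _] := ps; rewrite subrr sublinear0//; lra.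
Qed.

(** The infimum of [p (y + t x) - t p x] over [t >= 0] is sublinear, below [p],
    and its value at [- x] is at most [- p x]. *)
Lemma sublinear_lower p x : sublinear p ->
  exists q, [/\ sublinear q, forall y, q y <= p y & q (- x) <= - p x].
Proof.
move=> ps; have [pD pZ] := ps.
pose S y := [set p (y + t *: x) - t * p x | t in [set t | 0 <= t]].
have Slb y : lbound (S y) (- p (- y)).
  move=> _ [t /= t0 <-]; have := pD (y + t *: x) (- y).
  by rewrite addrAC subrr add0r pZ//; lra.
have S0 y : S y !=set0 by exists (p (y + 0 *: x) - 0 * p x), 0 => //=.
have Sle y t : 0 <= t -> inf (S y) <= p (y + t *: x) - t * p x.
  by move=> t0; apply: ge_inf; [exists (- p (- y)); exact: Slb|exists t].
exists (fun y => inf (S y)); split.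
- have half y z : inf (S (y + z)) <= inf (S y) + inf (S z).
    rewrite -lerBlDr; apply: lb_le_inf => // _ [t /= t0 <-].
    rewrite lerBlDr -lerBlDl; apply: lb_le_inf => // _ [s /= s0 <-].
    rewrite lerBlDl; apply: le_trans (Sle _ (t + s) (addr_ge0 t0 s0)) _.
    have := pD (y + t *: x) (z + s *: x).
    by rewrite addrACA -scalerDl mulrDl; lra.
  split=> // t y; rewrite le_eqVlt => /predU1P[<-|t0].
    rewrite scale0r mul0r; apply/eqP; rewrite eq_le; apply/andP; split.
      have := Sle 0 0 (lexx _).
      by rewrite scale0r addr0 mul0r subr0 sublinear0.
    apply: lb_le_inf => // r /Slb; apply: le_trans.
    by rewrite oppr0 sublinear0// oppr0.
  have le_scale s z : 0 < s -> inf (S (s *: z)) <= s * inf (S z).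
    move=> s0; rewrite -ler_pdivrMl//; apply: lb_le_inf => // _ [r /= r0 <-].
    rewrite ler_pdivrMl//; apply: le_trans (Sle _ (s * r) _) _.
      by rewrite mulr_ge0// ltW.
    by rewrite -scalerA -scalerDr pZ ?(ltW s0)// mulrBr mulrA.
  apply/eqP; rewrite eq_le le_scale//=.
  have := le_scale t^-1 (t *: y); rewrite invr_gt0 scalerA mulVf ?gt_eqF//.
  by rewrite scale1r ler_pdivlMl//; apply.
- by move=> y; apply: le_trans (Sle y 0 (lexx _)) _; rewrite scale0r addr0 mul0r subr0.
- apply: le_trans (Sle (- x) 1 ler01) _.
  by rewrite scale1r addNr sublinear0// add0r mul1r.
Qed.

(** Zorn's lemma, with pointwise infima of chains, gives a minimal sublinear [q] below [p]. It is
    linear: [sublinear_lower] at [x] returns a sublinear functional below [q] with value at most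
    [- q x] at [- x], so minimality yields [q (- x) = - q x], which turns subadditivity into
    additivity. *)
Lemma hahn_banach p : sublinear p ->
  exists psi : V -> R, (forall t x y, psi (t *: x + y) = t * psi x + psi y) /\
    forall x, psi x <= p x.
Proof.
move=> ps.
pose T := {q : V -> R | sublinear q /\ forall x, q x <= p x}.
pose below (q q' : T) := `[< forall x, sval q' x <= sval q x >].
have [[q [qs qp]] qmin] : exists q : T, forall q', below q q' -> q' = q.
  apply: Zorn.
  - by move=> q; apply/asboolP.
  - move=> q1 q2 q3 /asboolP h1 /asboolP h2; apply/asboolP => x.
    exact: le_trans (h2 x) (h1 x).
  - move=> [q1 h1] [q2 h2] /asboolP /= le1 /asboolP /= le2; apply: eq_exist.
    by apply/funext => x; apply/eqP; rewrite eq_le le1 le2.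
  move=> C totC; have [[q0 Cq0]|C0] := pselect (exists q, C q); last first.
    have pp : sublinear p /\ forall x, p x <= p x by [].
    by exists (exist _ p pp : T) => s Cs; exfalso; apply: C0; exists s.
  pose S x := [set sval q x | q in C].
  have Slb x : has_lbound (S x).
    exists (- p (- x)) => _ [[q [qs qp]] _ <-] /=.
    by apply: le_trans (sublinearN _ qs); rewrite lerN2.
  have S0 x : S x !=set0 by exists (sval q0 x), q0.
  have Sle q x : C q -> inf (S x) <= sval q x.
    by move=> Cq; apply: ge_inf => //; exists q.
  have infP : sublinear (fun x => inf (S x)) /\ forall x, inf (S x) <= p x.
    split; last first.
      move=> x; apply: le_trans (Sle q0 x Cq0) _.
      by case: (svalP q0).
    split=> [x y|t x t0].
      rewrite -lerBlDr; apply: lb_le_inf => // _ [q1 Cq1 <-].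
      rewrite lerBlDr -lerBlDl; apply: lb_le_inf => // _ [q2 Cq2 <-].
      rewrite lerBlDl.
      wlog le12 : x y q1 q2 Cq1 Cq2 / below q1 q2.
        move=> h; have [/h|/h] := totC _ _ Cq1 Cq2; first exact.
        by rewrite [x + y]addrC [sval q1 x + _]addrC; apply.
      apply: le_trans (Sle q2 _ Cq2) _.
      have [[+ _] _] := svalP q2 => /(_ x y)/le_trans; apply.
      by rewrite lerD2r; move/asboolP: le12.
    have [<-|t_neq0] := eqVneq 0 t.
      rewrite scale0r mul0r.
      have -> : S 0 = [set 0].
        apply/seteqP; split=> [_ [q _ <-]|_ ->] /=.
          by apply: sublinear0; case: (svalP q).
        by exists q0 => //; apply: sublinear0; case: (svalP q0).
      by rewrite inf1.
    have t_gt0 : 0 < t by rewrite lt_neqAle t_neq0.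
    apply/eqP; rewrite eq_le; apply/andP; split.
      rewrite -ler_pdivrMl//; apply: lb_le_inf => // _ [q Cq <-].
      rewrite ler_pdivrMl//; apply: le_trans (Sle q _ Cq) _.
      by have [[_ ->]] := svalP q.
    apply: lb_le_inf => // _ [q Cq <-].
    have [[_ -> //] _] := svalP q.
    by rewrite ler_pM2l//; exact: Sle.
  by exists (exist _ (fun x => inf (S x)) infP : T) => s Cs; apply/asboolP => x; exact: Sle.
have qN x : q (- x) = - q x.
  have [q' [q's q'q q'x]] := sublinear_lower x qs.
  have q'P : sublinear q' /\ forall x, q' x <= p x.
    by split=> // y; exact: le_trans (q'q y) (qp y).
  have := qmin (exist _ q' q'P : T); rewrite /below /=.
  move=> /(_ (asboolT q'q)) /(congr1 sval) /= q'E.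
  apply/eqP; rewrite eq_le -{1}q'E q'x /=.
  by have := sublinearN (- x) qs; rewrite opprK.
have qD x y : q (x + y) = q x + q y.
  have [qD _] := qs; apply/eqP; rewrite eq_le qD /=.
  by have := qD (x + y) (- y); rewrite addrK qN; lra.
exists q; split=> // t x y; rewrite qD; congr (_ + _).
have [_ qZ] := qs; have [/qZ->//|t0] := leP 0 t.
by rewrite -[t]opprK scaleNr qN qZ ?oppr_ge0 ?(ltW t0)// !mulNr.
Qed.

End hahn_banach.

(** Hahn-Banach is applied to the infimum of [|y + t u| - t] over [u] in [G] and [t >= 0], which is
    bounded below by [- |y|] because [|u| = 1]. It is at most [|y|] (take [t = 0]) and at most -1 at
    [- u] (take [t = 1]), which forces [psi u = 1]. Convexity makes it subadditive: [t u + s v] is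
    [(t + s) w] with [w] in [G]. *)
Lemma support_functional (R : realType) (Y : normedModType R) (G : set Y) :
  (forall u v (t : R), G u -> G v -> 0 <= t <= 1 -> G ((1 - t) *: u + t *: v)) ->
  (forall u, G u -> `|u| = 1) ->
  exists psi : Y -> R,
    [/\ forall t x y, psi (t *: x + y) = t * psi x + psi y,
        forall x, psi x <= `|x| & forall u, G u -> psi u = 1].
Proof.
move=> Gconv G1.
have [[u0 Gu0]|G0] := pselect (exists u, G u); last first.
  exists (fun=> 0); split=> [t x y|//|u Gu]; first by rewrite mulr0 addr0.
  by exfalso; apply: G0; exists u.
pose S y := [set `|y + ut.2 *: ut.1| - ut.2 | ut in [set ut : Y * R | G ut.1 /\ 0 <= ut.2]].
have Slb y : lbound (S y) (- `|y|).
  move=> _ [[u t] /= [Gu t0] <-]; rewrite lerBrDr.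
  have := ler_normB (y + t *: u) y.
  by rewrite addrAC subrr add0r normrZ G1// mulr1 ger0_norm//; lra.
have S0 y : S y !=set0 by exists (`|y + 0 *: u0| - 0), (u0, 0) => /=.
have Sle y u t : G u -> 0 <= t -> inf (S y) <= `|y + t *: u| - t.
  by move=> Gu t0; apply: ge_inf; [exists (- `|y|); exact: Slb|exists (u, t)].
have Ssub : sublinear (fun y => inf (S y)).
  have Sub y z : inf (S (y + z)) <= inf (S y) + inf (S z).
    rewrite -lerBlDr; apply: lb_le_inf => // _ [[u t] /= [Gu t0] <-].
    rewrite lerBlDr -lerBlDl; apply: lb_le_inf => // _ [[v s] /= [Gv s0] <-].
    rewrite lerBlDl.
    have [w Gw ->] : exists2 w, G w & `|y + t *: u| - t + (`|z + s *: v| - s) =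
        `|y + t *: u| + `|z + s *: v| - (t + s).
      by exists u => //; ring.
    have [w' Gw' E] : exists2 w, G w & t *: u + s *: v = (t + s) *: w.
      have [ts0|ts0] := eqVneq (t + s) 0.
        have t00 : t = 0 by lra. 
        have s00 : s = 0 by lra.
        by exists u => //; rewrite t00 s00 addr0 !scale0r addr0.
      have tsp : 0 < t + s by rewrite lt_neqAle eq_sym ts0 addr_ge0.
      exists ((1 - s / (t + s)) *: u + (s / (t + s)) *: v).
        apply: Gconv => //; apply/andP; split; first by rewrite divr_ge0// ltW.
        by rewrite ler_pdivrMr// mul1r lerDr.
      by rewrite scalerDr !scalerA; congr (_ *: _ + _ *: _); field.
    apply: le_trans (Sle _ _ _ Gw' (addr_ge0 t0 s0)) _.
    by rewrite lerD2r -E addrACA; exact: ler_normD.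
  split=> // t y; rewrite le_eqVlt => /predU1P[<-|t0].
    rewrite scale0r mul0r; apply/eqP; rewrite eq_le; apply/andP; split.
      by have := Sle 0 u0 0 Gu0 (lexx _); rewrite scale0r addr0 normr0 subr0.
    by apply: lb_le_inf => // r /Slb; rewrite normr0 oppr0.
  have le_scale s z : 0 < s -> inf (S (s *: z)) <= s * inf (S z).
    move=> s0; rewrite -ler_pdivrMl//; apply: lb_le_inf => // _ [[u r] /= [Gu r0] <-].
    rewrite ler_pdivrMl//; apply: le_trans (Sle _ u (s * r) _ _) _ => //.
      by rewrite mulr_ge0// ltW.
    by rewrite -scalerA -scalerDr normrZ gtr0_norm// mulrBr.
  apply/eqP; rewrite eq_le le_scale//=.
  have := le_scale t^-1 (t *: y); rewrite invr_gt0 scalerA mulVf ?gt_eqF//.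
  by rewrite scale1r ler_pdivlMl//; apply.
have [psi [psiL psile]] := hahn_banach Ssub.
have psi_le y : psi y <= `|y|.
  apply: le_trans (psile y) _.
  by have := Sle y u0 0 Gu0 (lexx _); rewrite scale0r addr0 subr0.
exists psi; split=> // u Gu; apply/eqP; rewrite eq_le.
have := psi_le u; rewrite G1// => -> /=.
have psi0 : psi 0 = 0 by have := psiL 1 0 0; rewrite scale1r addr0 mul1r; lra.
have := psiL (-1) u 0; rewrite addr0 psi0 addr0 mulN1r scaleN1r => psiN.
have := le_trans (psile (- u)) (Sle _ u 1 Gu ler01).
by rewrite scale1r addNr normr0 psiN; lra.
Qed.

(** * The functional supporting the image of a face *)

Section plane.
Variable R : realType.
Implicit Types (q r s t : R).

Lemma half_itv : 0 <= (1 / 2 : R) <= 1.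
Proof. by apply/andP; split; lra. Qed.

Lemma circle_max q :
  (forall c s, c ^+ 2 + s ^+ 2 = 1 -> c + s * q <= 1) -> q = 0.
Proof.
move=> h; have q0 := sqr_ge0 q.
have d0 : 4 + q ^+ 2 != 0 by apply: lt0r_neq0; lra.
(* The point of the circle with half-angle tangent [q / 2], rational in [q]; there [c + s q] exceeds
   1 by [2 q^2 / (4 + q^2)]. *)
have := h ((4 - q ^+ 2) / (4 + q ^+ 2)) (4 * q / (4 + q ^+ 2)).
have -> : ((4 - q ^+ 2) / (4 + q ^+ 2)) ^+ 2 + (4 * q / (4 + q ^+ 2)) ^+ 2 = 1.
  by field.
have -> : (4 - q ^+ 2) / (4 + q ^+ 2) + 4 * q / (4 + q ^+ 2) * q =
    (4 + 3 * q ^+ 2) / (4 + q ^+ 2) by field.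
move=> /(_ erefl); rewrite ler_pdivrMr; last by lra.
move=> h'; have /eqP : q ^+ 2 = 0 by lra.
by rewrite sqrf_eq0 => /eqP.
Qed.

Lemma affine_disc (g : R[i] -> R) :
  (forall a b t, normc a <= 1 -> normc b <= 1 -> 0 <= t <= 1 ->
    g ((1 - t)%:C * a + t%:C * b) = (1 - t) * g a + t * g b) ->
  forall a, normc a <= 1 ->
  g a = g 0 + complex.Re a * (g 1 - g 0) + complex.Im a * (g 'i - g 0).
Proof.
move=> gA.
have c0 : normc (0 : R[i]) <= 1 by rewrite normc0 ler01.
have gZ t a : normc a <= 1 -> 0 <= t <= 1 ->
    g (t%:C * a) = g 0 + t * (g a - g 0).
  by move=> a1 t01; have := gA 0 a t c0 a1 t01; rewrite mulr0 add0r => ->; ring.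
have gN a : normc a <= 1 -> g (- a) = g 0 - (g a - g 0).
  move=> a1; have h : 0 <= 1 / 2 <= (1 : R) := half_itv.
  have Na1 : normc (- a) <= 1 by rewrite normcN.
  have := gA a (- a) (1 / 2) a1 Na1 h.
  rewrite mulrN -mulrBl -rmorphB.
  rewrite [X in X%:C * a](_ : _ = 0); last by field.
  by rewrite mul0r => ->; field.
have gR t a : normc a <= 1 -> `|t| <= 1 -> g (t%:C * a) = g 0 + t * (g a - g 0).
  rewrite ler_norml => a1 /andP[tN1 t1].
  have [t0|t0] := leP 0 t; first by apply: gZ => //; rewrite t0.
  have h : 0 <= - t <= 1 by apply/andP; split; lra.
  have := gN _ (_ : normc ((- t)%:C * a) <= 1).
  rewrite gZ// rmorphN mulNr opprK => -> //; first by ring.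
  by rewrite -mulNr -rmorphN normcM normcR normrN ltr0_norm// mulr_ile1 ?normc_ge0//; lra.
move=> a a1.
have x1 : `|complex.Re a| <= 1 := le_trans (Re_le_normc a) a1.
have y1 : `|complex.Im a| <= 1 := le_trans (Im_le_normc a) a1.
have i1 : normc ('i : R[i]) <= 1 by rewrite /= expr0n expr1n add0r sqrtr1.
have e1 : normc (1 : R[i]) <= 1 by rewrite normc1.
have h : 0 <= 1 / 2 <= (1 : R) := half_itv.
have X1 : normc ((complex.Re a)%:C * 1 : R[i]) <= 1 by rewrite mulr1 normcR.
have Y1 : normc ((complex.Im a)%:C * 'i : R[i]) <= 1.
  by rewrite normcM normcR mulr_ile1 ?normc_ge0.
have := gA _ _ _ X1 Y1 h; rewrite !gR//.
have := gZ (1 / 2) a a1 h.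
rewrite [X in g X = _ -> _ -> _](_ : _ =
  (1 - 1 / 2)%:C * ((complex.Re a)%:C * 1) + (1 / 2)%:C * ((complex.Im a)%:C * 'i)).
  by move=> -> ; lra.
case: a {a1 x1 y1 X1 Y1} => x y; apply/eqP; rewrite eq_complex /=.
by apply/andP; split; apply/eqP; field.
Qed.

End plane.

(** * Linear combinations in two-by-two corners *)

Section lin4.
Variables (R : realType) (A : normedModType R[i]) (u11 u12 u21 u22 : A).
Local Notation L := (lin4 u11 u12 u21 u22).

Lemma lin4D a11 a12 a21 a22 b11 b12 b21 b22 :
  L a11 a12 a21 a22 + L b11 b12 b21 b22 =
  L (a11 + b11) (a12 + b12) (a21 + b21) (a22 + b22).
Proof.
by rewrite /lin4 !scalerDl addrACA; congr (_ + _); rewrite addrACA;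
  congr (_ + _); rewrite addrACA.
Qed.

Lemma lin4Z (a a11 a12 a21 a22 : R[i]) :
  a *: L a11 a12 a21 a22 = L (a * a11) (a * a12) (a * a21) (a * a22).
Proof. by rewrite /lin4 !scalerDr !scalerA. Qed.

Lemma lin4N (a11 a12 a21 a22 : R[i]) :
  - L a11 a12 a21 a22 = L (- a11) (- a12) (- a21) (- a22).
Proof. by rewrite -scaleN1r lin4Z !mulN1r. Qed.

Lemma lin4_scale (b12 b21 b22 a11 a12 a21 a22 : R[i]) :
  lin4 u11 (b12 *: u12) (b21 *: u21) (b22 *: u22) a11 a12 a21 a22 =
  L a11 (a12 * b12) (a21 * b21) (a22 * b22).
Proof. by rewrite /lin4 !scalerA. Qed.

End lin4.

Section matrix_units.
Variables (R : realType) (A : normedModType R[i]) (E : atomic A).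

(** Multiplying the second coordinates of the basis vectors by phases preserves the orthonormality
    relations, so phases can be moved into the [u_ij]. This supplies further corners with the same
    [u11]. *)
Lemma matrix_units_scale (u11 u12 u21 u22 : A) (b d : R[i]) :
  normc b = 1 -> normc d = 1 ->
  matrix_units (@av _ _ E) (@ap _ _ E) u11 u12 u21 u22 ->
  matrix_units (@av _ _ E) (@ap _ _ E) u11 (b *: u12) (d *: u21) ((d * b) *: u22).
Proof.
move=> b1 d1 M p1 p2 q1 q2 p1' p2' q1' q2' hp hq hp' hq' hpp hqq.
have bb : b * b^* = 1 by rewrite mulc_conj b1 expr1n rmorph1.
have dd : d * d^* = 1 by rewrite mulc_conj d1 expr1n rmorph1.
have J (x y z : R[i]) : z * z^* = 1 -> (z * x) * (z * y)^* = x * y^*.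
  by move=> zz; rewrite rmorphM mulrACA zz mul1r.
have := M p1 (d * p2) q1 (b * q2) p1' (d * p2') q1' (b * q2').
rewrite !J// => /(_ hp hq hp' hq' hpp hqq)[e [e' [ee' eE e'E]]].
exists e, e'; split=> //; rewrite (eE, e'E) lin4_scale; congr lin4; ring.
Qed.

End matrix_units.

(** * Singular value approximation *)

Section spectral.
Variables (R : realType) (A : normedModType R[i]) (E : atomic A).
Implicit Types (e r : E) (x y : A).

Lemma peel e y : y <> 0 -> af e y = (vnorm y)%:C ->
  [/\ ap e (y - (vnorm y)%:C *: av e),
      vnorm (y - (vnorm y)%:C *: av e) <= vnorm y
    & forall r, ap r y -> ap r (av e)].
Proof.
move=> y0 ey; have s0 : 0 < vnorm y.
  by rewrite lt_neqAle vnorm_ge0 andbT eq_sym; apply/eqP => /vnorm_eq0.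
have sC : (vnorm y)%:C != 0 :> R[i] by rewrite realC_neq0// gt_eqF.
have fe : face e ((vnorm y)%:C^-1 *: y).
  split; last by rewrite afZ ey mulVf.
  by rewrite vnormZ normcV normcR gtr0_norm// mulVf// gt_eqF.
have yE : y - (vnorm y)%:C *: av e =
    (vnorm y)%:C *: ((vnorm y)%:C^-1 *: y - av e).
  by rewrite scalerBr scalerA divff// scale1r.
split; first by rewrite yE; apply: apZ; exact: face_ap.
  by rewrite yE vnormZr gtr0_norm// ler_piMr ?vnorm_ge0//; exact: (face_sub_le1 fe).
by move=> r ry; apply: ap_sym; exact: ap_attain ry y0 ey.
Qed.

(** Greedy singular value decomposition: repeatedly remove the norm times an
    atom attaining it. *)
Lemma frame_approx x (eps : R) : x <> 0 -> 0 < eps ->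
  exists n (v : 'I_n.+1 -> E) (c : 'I_n.+1 -> R),
  [/\ forall j k, j != k -> ap (v j) (av (v k)),
      forall k, 0 <= c k <= vnorm x, c ord0 = vnorm x
    & vnorm (x - frame_sum v c) <= eps].
Proof.
move=> x0 eps0; have [e1 _] := af_attain E x0.
have /choice[pk pkP] : forall y, exists e, y <> 0 -> af e y = (vnorm y)%:C.
  move=> y; have [y0|y0] := pselect (y = 0); first by exists e1.
  by have [e ey] := af_attain E y0; exists e.
pose rem n := iter n (fun y => y - (vnorm y)%:C *: av (pk y)) x.
pose V n := pk (rem n).
have remS n : rem n.+1 = rem n - (vnorm (rem n))%:C *: av (V n) by [].
have step n : rem n <> 0 -> [/\ ap (V n) (rem n.+1),
    vnorm (rem n.+1) <= vnorm (rem n) & forall r, ap r (rem n) -> ap r (av (V n))].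
  by move=> n0; apply: peel => //; exact: pkP.
have rem_ap n : (forall k, (k < n)%N -> rem k <> 0) ->
    forall j, (j < n)%N -> ap (V j) (rem n).
  elim: n => // n ih n0 j; have [vn _ rn] := step n (n0 n (ltnSn n)).
  rewrite ltnS leq_eqVlt => /predU1P[->//|jn].
  have jr : ap (V j) (rem n) by apply: ih => // k kn; apply: n0; exact: ltnW.
  by rewrite remS; apply: apB => //; apply: apZ; exact: rn.
have V_ap n : (forall k, (k < n)%N -> rem k <> 0) ->
    forall j k, (j < n)%N -> (k < n)%N -> j != k -> ap (V j) (av (V k)).
  move=> n0 j k jn kn; rewrite neq_ltn => /orP[jk|kj].
    have [_ _] := step k (n0 k kn); apply; apply: rem_ap => // l lk.
    by apply: n0; exact: ltn_trans kn.
  have [_ _ h] := step j (n0 j jn); apply: ap_sym; apply: h.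
  by apply: rem_ap => // l lj; apply: n0; exact: ltn_trans jn.
have remE n : x = \sum_(k < n) (vnorm (rem k))%:C *: av (V k) + rem n.
  elim: n => [|n ih]; first by rewrite big_ord0 add0r.
  by rewrite big_ord_recr /= -addrA [_ *: _ + _]addrC subrK.
(* The index is shifted by one so that an atom is removed even if [vnorm x <= eps], which secures
   [c ord0 = vnorm x]. Without termination, the coefficient of [x] at [V n.+1] would be
   [vnorm (rem n.+1) > eps] for all [n], against [no_infinite_frame]. *)
have ex_n : exists n, vnorm (rem n.+1) <= eps.
  apply: contrapT => no.
  have gt n : eps < vnorm (rem n.+1).
    by rewrite ltNge; apply/negP => le; apply: no; exists n.
  have n0 n : rem n <> 0.
    case: n => [//|n] rn; have := gt n; rewrite rn vnorm0.
    by rewrite ltNge ltW.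
  apply: (@no_infinite_frame _ _ E (fun n => V n.+1) x eps eps0).
    move=> m n mn; apply: (V_ap (maxn m.+2 n.+2)) => //; rewrite leq_max leqnn// orbT//.
  move=> n; rewrite [x in af _ x](remE n.+1) afD ap_af ?add0r.
    by rewrite pkP; [exact: (ltW (gt n))|exact: n0].
  apply: ap_sum => k _; apply: apZ; apply: (V_ap n.+2) => //.
    by rewrite (ltn_trans (ltn_ord k)).
  by rewrite gtn_eqF.
have [n le_n min_n] := ex_minnP ex_n.
have n0 k : (k < n.+1)%N -> rem k <> 0.
  case: k => [//|k]; rewrite ltnS => kn rk.
  by have := min_n k; rewrite rk vnorm0 ltW// => /(_ isT); rewrite leqNgt kn.
exists n, (fun k => V k), (fun k => vnorm (rem k)); split=> //.
- by move=> j k jk; apply: (V_ap n.+1).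
- move=> [k kn]; rewrite vnorm_ge0 /=; elim: k kn => [//|k ih] kn.
  have [_ h _] := step k (n0 k (ltnW kn)).
  by apply: le_trans h _; apply: ih; exact: ltnW.
- by rewrite [X in X - _](remE n.+1) addrAC subrr add0r.
Qed.

End spectral.

(** * Values of the supporting functional on the sphere *)

Section functional.
Variables (R : realType) (A : normedModType R[i]) (E : atomic A).
Variables (Y : normedModType R) (f : A -> Y).
Hypothesis f_isom : forall x y, vnorm x = 1 -> vnorm y = 1 ->
  `|f x - f y| = vnorm (x - y).
Hypothesis f_norm : forall x, vnorm x = 1 -> `|f x| = 1.
Hypothesis f_surj : forall y, `|y| = 1 -> exists2 x, vnorm x = 1 & f x = y.
Hypothesis rank2 : forall e : E, exists w : E, ap e (av w).
Variables (e0 : E) (psi : Y -> R).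
Hypothesis psiL : forall t x y, psi (t *: x + y) = t * psi x + psi y.
Hypothesis psi_le : forall y, psi y <= `|y|.
Hypothesis psi1 : forall x, face e0 x -> psi (f x) = 1.
Implicit Types (e w : E) (x : A) (a b : R[i]) (s t c : R).

Let h x := psi (f x).

Lemma psi0 : psi 0 = 0.
Proof. by have := psiL 1 0 0; rewrite scale1r addr0 mul1r; lra. Qed.

Lemma psiZ t y : psi (t *: y) = t * psi y.
Proof. by have := psiL t y 0; rewrite !addr0 psi0 addr0. Qed.

Lemma psiD y z : psi (y + z) = psi y + psi z.
Proof. by have := psiL 1 y z; rewrite scale1r mul1r. Qed.

Lemma psiN y : psi (- y) = - psi y.
Proof. by rewrite -scaleN1r psiZ mulN1r. Qed.

Lemma h_lipschitz x (y : A) : vnorm x = 1 -> vnorm y = 1 -> h x - h y <= vnorm (x - y).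
Proof. by move=> x1 y1; rewrite -f_isom// /h -psiN -psiD. Qed.

Lemma h_le x : vnorm x = 1 -> h x <= 1.
Proof. by move=> x1; rewrite /h -(f_norm x1). Qed.

Let discA := @disc_affine _ _ E _ f f_isom f_norm f_surj.

Lemma h_disc w e a : ap w (av e) -> normc a <= 1 ->
  h (av w + a *: av e) = h (av w) +
    complex.Re a * (h (av w + av e) - h (av w)) +
    complex.Im a * (h (av w + 'i *: av e) - h (av w)).
Proof.
move=> we a1.
have := @affine_disc _ (fun a => h (av w + a *: av e)) _ a a1.
rewrite scale0r addr0 scale1r; apply=> b d t b1 d1 t01.
by rewrite /h discA// psiD !psiZ.
Qed.

Lemma h_mid w e : ap w (av e) ->
  h (av w + av e) + h (av w - av e) = 2 * h (av w).
Proof.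
move=> we; have := h_disc we (a := -1); rewrite normcN1 scaleN1r => /(_ (lexx _)) ->.
by rewrite !raddfN /=; ring.
Qed.

(** Add the midpoint identities for [w + e, w - e] and for [e + w, e - w]: the values at [w - e] and
    [e - w] cancel because [f] is odd at a sum of two orthogonal atoms. *)
Lemma h_add w e : ap w (av e) -> h (av w + av e) = h (av w) + h (av e).
Proof.
move=> we; have ew := ap_sym we.
have wNe : ap w (av (ar (-1) e)) by rewrite arv ?normcN1// scaleN1r; exact: apN.
have := odd_two_atoms f_isom f_norm f_surj wNe.
rewrite arv ?normcN1// scaleN1r opprB.
move=> /(congr1 psi); rewrite psiN -/(h _) -/(h _) => hodd.
have := h_mid we; have := h_mid ew; rewrite [av e + av w]addrC hodd; lra.
Qed.

Lemma vnorm_rot e a : normc a = 1 -> vnorm (a *: av e) = 1.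
Proof. by move=> a1; rewrite vnormZ a1 vnorm_atom mulr1. Qed.

Lemma normci : normc ('i : R[i]) = 1.
Proof. by rewrite /= expr0n expr1n add0r sqrtr1. Qed.

(** Translated by an orthogonal atom [w], the circle of [e] bounds a disc in the face of [w], where
    [h] is affine in the coefficient; [h_add] removes the translation. *)
Lemma h_rot e a : normc a = 1 ->
  h (a *: av e) = complex.Re a * h (av e) + complex.Im a * h ('i *: av e).
Proof.
move=> a1; have [w /ap_sym we] := rank2 e.
have add b : normc b = 1 -> h (av w + b *: av e) = h (av w) + h (b *: av e).
  by move=> b1; rewrite -arv// h_add// arv//; exact: apZ.
have := h_disc we (a := a); rewrite a1 => /(_ (lexx _)).
by rewrite !add ?normci// h_add//; lra.
Qed.

Lemma h_e0 : h (av e0) = 1. Proof. exact: psi1 (atom_face _). Qed.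

Lemma h_ortho e : ap e0 (av e) -> h (av e) = 0.
Proof.
move=> e0e; have := h_add e0e; rewrite h_e0 /h psi1; first by lra.
by apply: faceD; rewrite ?vnorm_atom.
Qed.

Lemma h_rot_e0 a : normc a = 1 -> h (a *: av e0) = complex.Re a.
Proof.
move=> a1; rewrite h_rot// h_e0 mulr1 (_ : h ('i *: _) = 0) ?mulr0 ?addr0//.
apply: circle_max => c s cs1.
have n1 : normc (c +i* s) = 1 by apply/normc_eq1.
by have := h_le (vnorm_rot e0 n1); rewrite h_rot// h_e0 mulr1.
Qed.

Local Notation matrix_units := (matrix_units (@av _ _ E) (@ap _ _ E)).

(** [matrix_units] yields [u22] orthogonal to some atom with the same operator as [e0]. By [af_inj]
    the two coefficient functionals agree, so the sum of [av e0] and [u22] is in the face of [e0],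
    and subtracting [av e0] leaves a vector orthogonal to [e0]. *)
Lemma corner_diag u12 u21 u22 : matrix_units (av e0) u12 u21 u22 ->
  exists2 e : E, av e = u22 & ap e0 (av e).
Proof.
move=> M; have := M 1 0 1 0 0 1 0 1.
rewrite !conjC0 !conjC1 !(mulr0, mul0r, mulr1, mul1r) !(addr0, add0r).
move=> /(_ erefl erefl erefl erefl erefl erefl)[e [e' [ee' ]]].
rewrite /lin4 !scale0r !scale1r !(addr0, add0r) => eE e'E.
exists e' => //.
have e_e0 : af e (av e0) = 1 by rewrite -eE afv.
have ee1 : face e (av e + av e') by apply: faceD; rewrite ?vnorm_atom.
have := @ap_face _ _ E e0 (av e + av e') (proj1 ee1).
rewrite -(af_inj e_e0) (proj2 ee1) eE => /(_ erefl).
by rewrite addrAC subrr add0r.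
Qed.

(** A phase times a rotation is a combination, with unimodular coefficients, of
    the orthogonal spectral atoms of the quarter turn. *)
Lemma rotation_frame u12 u21 u22 : matrix_units (av e0) u12 u21 u22 ->
  exists A1 B1 A2 B2, forall a c s, normc a = 1 -> c ^+ 2 + s ^+ 2 = 1 ->
  let x := lin4 (av e0) u12 u21 u22
    (a * c%:C) (- (a * s%:C)) (a * s%:C) (a * c%:C) in
  vnorm x = 1 /\
  h x = complex.Re (a * (c -i* s)) * A1 + complex.Im (a * (c -i* s)) * B1 +
    (complex.Re (a * (c +i* s)) * A2 + complex.Im (a * (c +i* s)) * B2).
Proof.
move=> M; pose k : R := Num.sqrt 2^-1.
have kk : k * k = 1 / 2 by rewrite -expr2 sqr_sqrtr ?div1r// invr_ge0 ler0n.
(* The vectors [(1, 'i)] and [('i, 1)], scaled by [k], are eigenvectors of the quarter turn [J] for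
   [- 'i] and ['i]; [e] and [e'] are the projections onto them, so
   [c + s J = (c - 'i s) e + (c + 'i s) e']. *)
have := M k%:C (0 +i* k) k%:C (0 -i* k) (0 +i* k) k%:C (0 -i* k) k%:C.
have eqC (x y z w : R) : x = z -> y = w -> x +i* y = z +i* w by move=> -> ->.
case; [by apply: eqC; lra..|] => e [e' [ee' eE e'E]].
exists (h (av e)), (h ('i *: av e)), (h (av e')), (h ('i *: av e')).
move=> a c s a1 cs1 x.
have n1 : normc (a * (c -i* s)) = 1.
  by rewrite normcM a1 mul1r; apply/normc_eq1; rewrite /= sqrrN.
have n2 : normc (a * (c +i* s)) = 1 by rewrite normcM a1 mul1r; apply/normc_eq1.
have ee2 : ap (ar (a * (c -i* s)) e) (av (ar (a * (c +i* s)) e')).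
  by apply/arp => //; rewrite arv//; exact: apZ.
rewrite -!h_rot// -!arv// -h_add//.
suff -> : x = av (ar (a * (c -i* s)) e) + av (ar (a * (c +i* s)) e').
  by split=> //; apply: face_norm (faceD ee2 _); rewrite vnorm_atom.
rewrite /x !arv// eE e'E !lin4Z lin4D.
congr lin4; case: a {a1 n1 n2 ee2 x} => x y; apply: eqC => /=;
  by rewrite !(mulrN, mulNr, mulr0, mul0r, subr0, sub0r, addr0, add0r, opprK)
    ?kk; field.
Qed.

(** The identity of the corner, [e0 + u22], is in the face of [e0], which gives [A1 + A2 = 1]. For
    [a = 1] the value is then [c + s (B2 - B1)], bounded by 1 on the circle, so [B1 = B2]. *)
Lemma rotation_coefs u12 u21 u22 : matrix_units (av e0) u12 u21 u22 ->
  exists A1 B A2, A1 + A2 = 1 /\ forall a c s, normc a = 1 -> c ^+ 2 + s ^+ 2 = 1 ->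
  h (lin4 (av e0) u12 u21 u22 (a * c%:C) (- (a * s%:C)) (a * s%:C) (a * c%:C)) =
  complex.Re (a * (c -i* s)) * A1 + complex.Re (a * (c +i* s)) * A2 +
  (complex.Im (a * (c -i* s)) + complex.Im (a * (c +i* s))) * B.
Proof.
move=> M; have [A1 [B1 [A2 [B2 hM]]]] := rotation_frame M.
have [e eE e0e] := corner_diag M.
have cs10 : (1 : R) ^+ 2 + 0 ^+ 2 = 1 by rewrite expr1n expr0n addr0.
have AA : A1 + A2 = 1.
  have [_] := hM 1 1 0 (normc1 _) cs10; rewrite /lin4 !(mulr1, mul1r, mulr0, oppr0).
  rewrite !scale0r !addr0 !scale1r -eE /= !(oppr0, mul0r, addr0, mul1r) => <-.
  by apply: psi1; apply: faceD; rewrite ?vnorm_atom.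
exists A1, B1, A2; split=> // a c s a1 cs1; have [_ ->] := hM a c s a1 cs1.
suff -> : B2 = B1 by ring.
apply/eqP; rewrite -subr_eq0; apply/eqP/circle_max => c' s' cs1'.
have [/h_le + xE] := hM 1 c' s' (normc1 _) cs1'.
by rewrite xE !mul1r /=; nra.
Qed.

Lemma h_rotation_real u12 u21 u22 c s :
  matrix_units (av e0) u12 u21 u22 -> c ^+ 2 + s ^+ 2 = 1 ->
  h (lin4 (av e0) u12 u21 u22 c%:C (- s%:C) s%:C c%:C) = c.
Proof.
move=> /rotation_coefs[A1 [B [A2 [AA hM]]]] cs1.
have := hM 1 c s (normc1 _) cs1; rewrite !mul1r /= => ->.
by rewrite addNr mul0r addr0 -mulrDr AA mulr1.
Qed.

(** The bound [h <= 1] at the rotations makes their [h] equal to [c]; applying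
    this to the corner with rescaled matrix units removes the remaining freedom
    for other phases. *)
Lemma h_rotation u12 u21 u22 a c s :
  matrix_units (av e0) u12 u21 u22 -> normc a = 1 -> c ^+ 2 + s ^+ 2 = 1 ->
  h (lin4 (av e0) u12 u21 u22
    (a * c%:C) (- (a * s%:C)) (a * s%:C) (a * c%:C)) = complex.Re a * c.
Proof.
move=> M a1 cs1; have [A1 [B [A2 [AA hM]]]] := rotation_coefs M.
have [e eE e0e] := corner_diag M.
have cs10 : (1 : R) ^+ 2 + 0 ^+ 2 = 1 by rewrite expr1n expr0n addr0.
have cs01 : (0 : R) ^+ 2 + 1 ^+ 2 = 1 by rewrite expr1n expr0n add0r.
(* At ['i] times the identity both summands, ['i *: av e0] and ['i *: u22], have value 0, whereas
   the formula gives [2 B]. *)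
have B0 : B = 0.
  have := hM 'i 1 0 normci cs10.
  rewrite /lin4 !(mulr1, mulr0, oppr0) !scale0r !addr0 -eE -!arv ?normci//.
  rewrite h_add; last by apply/arp; rewrite ?normci// arv ?normci//; exact: apZ.
  rewrite [h (av (ar _ e))]h_ortho; last by rewrite arv ?normci//; exact: apZ.
  by rewrite arv ?normci// h_rot_e0 ?normci//=; lra.
(* Scaling [u12] and [u21] by ['i] and [u22] by -1 turns ['i] times the quarter turn into the real
   quarter turn of another corner, with value 0; the formula gives [A1 - A2]. *)
have A12 : A1 = A2.
  have := hM 'i 0 1 normci cs01.
  have Mi := matrix_units_scale normci normci M.
  have := h_rotation_real Mi cs01; rewrite lin4_scale.
  rewrite !(mulr0, mulr1, mulN1r, mul1r, mul0r).
  by move=> -> /=; lra.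
rewrite hM//.
have -> : A1 = 1 / 2 by lra.
have -> : A2 = 1 / 2 by lra.
by rewrite B0; case: a {a1} => x y /=; field.
Qed.

(** In the corner, [e] and its orthogonal complement [e2] have for sum and
    difference a rotation and a reflection, where [h] is known. *)
Lemma h_atom e : h (av e) = complex.Re (af e0 (av e)).
Proof.
have [e0e|[a a1 eE]|] := two_atoms e0 e.
- by rewrite h_ortho// ap_af.
- by rewrite eE h_rot_e0// afZ afv mulr1.
case=> u12 [u21 [u22 [a [c [s [c' [s' [M [a1 cs1 cs1'] eE afE]]]]]]]].
rewrite afE.
have aa : a * a^* = 1 by rewrite mulc_conj a1 expr1n rmorph1.
have J (x y : R) : (a * x%:C) * (a * y%:C)^* = (x * y)%:C.
  by rewrite rmorphM mulrACA aa mul1r [X in _ * X]conjR rmorphM.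
have := M (a * c%:C) (a * s%:C) c'%:C s'%:C
  (a * (- s)%:C) (a * c%:C) (- s')%:C c'%:C.
rewrite !J !conjR -!rmorphM -!rmorphD.
have eqC (x y : R) : x = y -> x%:C = y%:C :> R[i] by move=> ->.
case; [by apply: eqC; lra..|] => e1 [e2 [e12 e1E e2E]].
have {}eE : av e = av e1 by rewrite eE e1E lin4Z; congr lin4; rewrite rmorphM; ring.
have CS (x y x' y' : R) : x ^+ 2 + y ^+ 2 = 1 -> x' ^+ 2 + y' ^+ 2 = 1 ->
    (x * x' + y * y') ^+ 2 + (y * x' - x * y') ^+ 2 = 1.
  move=> xy xy'; transitivity ((x ^+ 2 + y ^+ 2) * (x' ^+ 2 + y' ^+ 2)); first by ring.
  by rewrite xy xy' mulr1.
have h1 := h_rotation M a1 (CS _ _ _ _ cs1 cs1').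
have cs1'' : c' ^+ 2 + (- s') ^+ 2 = 1 by rewrite sqrrN.
(* Changing the signs of [u12] and [u22] turns the reflection in [av e1 - av e2] into a rotation. *)
have M' := matrix_units_scale (@normcN1 R) (@normc1 R) M.
have := h_rotation M' a1 (CS _ _ _ _ cs1 cs1''); rewrite lin4_scale => h2.
have s1 : av e1 + av e2 = lin4 (av e0) u12 u21 u22 (a * (c * c' + s * s')%:C)
    (- (a * (s * c' - c * s')%:C)) (a * (s * c' - c * s')%:C)
    (a * (c * c' + s * s')%:C).
  by rewrite e1E e2E lin4D; congr lin4; rewrite ?rmorphB ?rmorphD !rmorphM ?rmorphN; ring.
have s2 : av e1 - av e2 = lin4 (av e0) u12 u21 u22 (a * (c * c' + s * - s')%:C)
    (- (a * (s * c' - c * - s')%:C) * -1) (a * (s * c' - c * - s')%:C * 1)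
    (a * (c * c' + s * - s')%:C * (1 * -1)).
  by rewrite e1E e2E lin4N lin4D; congr lin4; rewrite ?rmorphB ?rmorphD !rmorphM ?rmorphN; ring.
have := h_mid e12; rewrite s1 s2 h1 h2 eE.
case: a {a1 afE aa J e1E e2E h1 h2 s1 s2} => x y /=; lra.
Qed.

(** One coordinate is added at a time: the midpoint of [d s] and [u k (c k)] is
    also the midpoint of [d (k :: s)] and [u k 0]. *)
Lemma h_frame_sum (K : finType) (v : K -> E) (k0 : K) (c : K -> R) :
  (forall j k, j != k -> ap (v j) (av (v k))) ->
  (forall k, 0 <= c k <= 1) -> c k0 = 1 ->
  h (frame_sum v c) = \sum_k c k * h (av (v k)).
Proof.
move=> vv c01 ck0.
have abs_c k : `|c k| <= 1 by case/andP: (c01 k) => ? ?; rewrite ger0_norm.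
pose d (s : seq K) k := if (k == k0) || (k \in s) then c k else 0.
have d1 (s : seq K) k : `|d s k| <= 1.
  by rewrite /d; case: ifP => // _; rewrite normr0.
have dk0 (s : seq K) : d s k0 = 1 by rewrite /d eqxx.
have h01 := @half_itv R.
have cube := cube_affine f_isom f_norm f_surj vv.
pose u k (w : R) j := if j == k0 then 1 else if j == k then w else 0.
have u1 k (w : R) j : 0 <= w <= 1 -> `|u k w j| <= 1.
  move=> /andP[? ?]; rewrite /u; case: ifP => _; first by rewrite normr1.
  by case: ifP => _; rewrite ?normr0// ger0_norm.
have uk0 k (w : R) : u k w k0 = 1 by rewrite /u eqxx.
have uE k (w : R) : k != k0 -> frame_sum v (u k w) = av (v k0) + w%:C *: av (v k).
  move=> kk0; rewrite (frame_sumE _ _ k0) uk0 scale1r; congr (_ + _).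
  rewrite (bigD1 k)//= /u (negPf kk0) eqxx big1 ?addr0// => j /andP[jk0 jk].
  by rewrite (negPf jk0) (negPf jk) scale0r.
have single k (z : R) : k != k0 -> 0 <= z <= 1 ->
    h (frame_sum v (u k z)) = h (av (v k0)) + z * h (av (v k)).
  move=> kk0 z01; have := cube k0 (u k 0) (u k 1) z _ _ (uk0 _ _) (uk0 _ _) z01.
  rewrite (_ : (fun j => _) = u k z); last first.
    by apply/funext => j; rewrite /u; case: ifP => _; [|case: ifP => _]; ring.
  rewrite /h => -> => [|j|j]; last 2 first.
  - by apply: u1; rewrite lexx ler01.
  - by apply: u1; rewrite lexx ler01.
  rewrite !uE// scale0r addr0 scale1r psiD !psiZ -!/(h _) h_add; first by ring.
  by apply: vv; rewrite eq_sym.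
have main (s : seq K) : uniq s -> k0 \notin s ->
    h (frame_sum v (d s)) = h (av (v k0)) + \sum_(k <- s) c k * h (av (v k)).
  elim: s => [_ _|k s ih /= /andP[ks us]].
    rewrite big_nil addr0; congr h.
    rewrite (frame_sumE _ _ k0) dk0 scale1r big1 ?addr0// => j jk0.
    by rewrite /d (negPf jk0) scale0r.
  rewrite inE negb_or => /andP[k0k k0s].
  have kk0 : k != k0 by rewrite eq_sym.
  have eqm : (fun j => (1 - 1 / 2) * d s j + 1 / 2 * u k (c k) j) =
             (fun j => (1 - 1 / 2) * d (k :: s) j + 1 / 2 * u k 0 j).
    apply/funext => j; rewrite /d /u inE.
    have [->|jk0] /= := eqVneq j k0; first by rewrite ck0.
    have [->|jk] /= := eqVneq j k; last by [].
    by rewrite (negPf ks) ?orbF ?(negPf kk0) /=; field.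
  have u01 j : `|u k 0 j| <= 1 by apply: u1; rewrite lexx ler01.
  have uc1 j : `|u k (c k) j| <= 1 by exact: u1.
  have := cube k0 _ _ _ (d1 s) uc1 (dk0 s) (uk0 _ _) h01.
  rewrite eqm (cube k0 _ _ _ (d1 (k :: s)) u01 (dk0 _) (uk0 _ _) h01).
  move=> /(congr1 psi); rewrite !psiD !psiZ -!/(h _) ih// !single//.
    by rewrite big_cons; lra.
  by rewrite lexx ler01.
have := main [seq k <- enum K | k != k0] (filter_uniq _ (enum_uniq _)).
rewrite mem_filter eqxx => /(_ isT).
rewrite (_ : d _ = c); last first.
  apply/funext => k; rewrite /d mem_filter mem_enum andbT.
  by case: eqVneq => //= ->.
move=> ->; rewrite big_filter big_enum_cond /= [RHS](bigD1 k0)//= ck0 mul1r.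
by congr (_ + _); apply: eq_bigl => k; rewrite inE.
Qed.

Lemma h_frame_sum_af (K : finType) (v : K -> E) (k0 : K) (c : K -> R) :
  (forall j k, j != k -> ap (v j) (av (v k))) ->
  (forall k, 0 <= c k <= 1) -> c k0 = 1 ->
  h (frame_sum v c) = complex.Re (af e0 (frame_sum v c)).
Proof.
move=> vv c01 ck0; rewrite (h_frame_sum vv c01 ck0).
rewrite /frame_sum (big_morph (af e0) (afD e0) (af0 e0)).
rewrite (big_morph (@complex.Re R) (raddfD _) (raddf0 _)).
apply: eq_bigr => k _; rewrite h_atom afZ.
by case: (af e0 _) => x y /=; rewrite mul0r subr0.
Qed.

Lemma h_af x : vnorm x = 1 -> h x = complex.Re (af e0 x).
Proof.
move=> x1; have x0 : x <> 0.
  by move=> x0; move: x1; rewrite x0 vnorm0 => /esym/eqP; rewrite oner_eq0.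
suff close (eps : R) : 0 < eps -> `|h x - complex.Re (af e0 x)| <= eps.
  apply/eqP; rewrite -subr_eq0 -normr_eq0 eq_le normr_ge0 andbT.
  by apply/ler_addgt0Pr => d d0; rewrite add0r close.
move=> eps0; have eps20 : 0 < eps / 2 by rewrite divr_gt0.
have [n [v [c [vv c01 c0 xc]]]] := frame_approx E x0 eps20.
rewrite x1 in c0 c01; set y := frame_sum v c in xc.
have abs_c k : `|c k| <= 1 by case/andP: (c01 k) => ? ?; rewrite ger0_norm.
have y1 : vnorm y = 1 := face_norm (frame_sum_face vv abs_c c0).
have yx : vnorm (y - x) <= eps / 2 by rewrite vdistC.
have hy := h_frame_sum_af vv c01 c0; rewrite -/y in hy.
have := h_lipschitz x1 y1; have := h_lipschitz y1 x1.
have := af_Re_le e0 (x - y); have := af_Re_le e0 (y - x).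
rewrite !afB !raddfB /= => ? ? ? ?.
by rewrite ler_norml; apply/andP; split; lra.
Qed.

End functional.

(** * Linear extension *)

Section extension.
Variables (R : realType) (A : normedModType R[i]).
Variables (Y : normedModType R) (f : A -> Y).
Hypothesis f_norm : forall x, vnorm x = 1 -> `|f x| = 1.
Hypothesis f_surj : forall y, `|y| = 1 -> exists2 x, vnorm x = 1 & f x = y.

Let F x := vnorm x *: f ((vnorm x)^-1%:C *: x).

Lemma normalized (x : A) : x <> 0 -> vnorm ((vnorm x)^-1%:C *: x) = 1.
Proof.
move=> x0; rewrite vnormZr ger0_norm ?invr_ge0 ?vnorm_ge0// mulVf//.
by apply/eqP => /vnorm_eq0.
Qed.

Lemma F0 : F 0 = 0. Proof. by rewrite /F vnorm0 scale0r. Qed.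

Lemma vnormFE x : `|F x| = vnorm x.
Proof.
have [->|x0] := eqVneq x 0; first by rewrite /F vnorm0 scale0r normr0.
by rewrite normrZ f_norm ?mulr1 ?ger0_norm ?vnorm_ge0//; apply/normalized/eqP.
Qed.

Lemma F_sphere (x : A) : vnorm x = 1 -> F x = f x.
Proof. by move=> x1; rewrite /F x1 invr1 rmorph1 !scale1r. Qed.

Lemma F_surj y : exists x, F x = y.
Proof.
have [->|y0] := eqVneq y 0; first by exists 0; rewrite /F vnorm0 scale0r.
have [|x x1 fx] := @f_surj (`|y|^-1 *: y).
  by rewrite normrZ normfV normr_id mulVf// normr_eq0.
exists (`|y|%:C *: x).
have xy : vnorm (`|y|%:C *: x) = `|y| by rewrite vnormZr x1 normr_id mulr1.
rewrite /F xy scalerA -rmorphM mulVf ?normr_eq0// rmorph1 scale1r fx.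
by rewrite scalerA divff ?normr_eq0// scale1r.
Qed.

Lemma linear_extension :
  (forall x, x <> 0 -> exists (phi : A -> R) (psi : Y -> R),
    [/\ phi x <> 0,
        forall (t : R) x y, phi (t%:C *: x + y) = t * phi x + phi y,
        forall t x y, psi (t *: x + y) = t * psi x + psi y
      & forall x, vnorm x = 1 -> psi (f x) = phi x]) ->
  exists! F : A -> Y,
    [/\ real_linear F, isometry_on [set: A] F, range F = [set: Y]
      & forall x, unit_sphere A x -> F x = f x].
Proof.
move=> sep.
(* By surjectivity, the defect [z - w] of a desired identity is itself a value [F z']. Each
   linearized pair then gives [phi z' = psi z - psi w = 0], and since the [phi] separate points of
   [A], [z' = 0]. *)
have eqF z w z' : (forall phi psi,
    (forall (t : R) (x y : A), phi (t%:C *: x + y) = t * phi x + phi y) ->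
    (forall t x y, psi (t *: x + y) = t * psi x + psi y) ->
    (forall x, psi (F x) = phi x) -> psi z = psi w :> R) -> F z' = z - w -> z = w.
  move=> h z'E; apply/eqP; rewrite -subr_eq0 -z'E.
  have [->|/eqP z'0] := eqVneq z' 0; first by rewrite /F vnorm0 scale0r.
  have [phi [psi [phi0 phiL psiL pf]]] := sep z' z'0.
  exfalso; apply: phi0.
  have psi0 : psi 0 = 0 by have := psiL 1 0 0; rewrite scale1r addr0 mul1r; lra.
  have phi0 : phi 0 = 0 by have := phiL 1 0 0; rewrite scaler0 addr0 mul1r; lra.
  have psiF x : psi (F x) = phi x.
    have [->|/eqP x0] := eqVneq x 0; first by rewrite F0 psi0 phi0.
    have := psiL (vnorm x) (f ((vnorm x)^-1%:C *: x)) 0; rewrite addr0 -/(F x) => ->.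
    rewrite pf ?normalized// psi0 addr0.
    have := phiL (vnorm x)^-1 x 0; rewrite phi0 !addr0 => ->.
    by rewrite mulrA divff ?mul1r//; apply/eqP => /vnorm_eq0.
  rewrite -psiF z'E -scaleN1r addrC psiL mulN1r (h _ _ phiL psiL psiF); lra.
have FD x y : F (x + y) = F x + F y.
  have [z' z'E] := F_surj (F (x + y) - (F x + F y)).
  apply: (eqF _ _ z') => // phi psi phiL psiL pF.
  have := psiL 1 (F x) (F y); have := phiL 1 x y.
  by rewrite !scale1r !mul1r !pF => -> ->.
have FZ (a : R) x : F (a%:C *: x) = a *: F x.
  have [z' z'E] := F_surj (F (a%:C *: x) - (a *: F x)).
  apply: (eqF _ _ z') => // phi psi phiL psiL pF.
  have := psiL a (F x) 0; have := phiL a x 0.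
  by rewrite !addr0 pF -[in psi 0]F0 !pF => -> ->.
exists F; split.
  split=> //.
  - move=> x y _ _; have -> : F x - F y = F (x - y).
      by rewrite FD -[in F (- y)]scaleN1r -(rmorph1 (real_complex R)) -rmorphN FZ scaleN1r.
    by rewrite vnormFE vnormE.
  - by apply/seteqP; split=> // y _; have [x <-] := F_surj y; exists x.
  - by move=> x /unit_sphereE; exact: F_sphere.
move=> G [[_ GZ] _ _ Gf]; apply/funext => x.
have [->|/eqP x0] := eqVneq x 0.
  by have := GZ 0 0; rewrite rmorph0 !scale0r => ->; rewrite /F vnorm0 scale0r.
rewrite /F -Gf; last by apply/unit_sphereE; exact: normalized.
rewrite GZ scalerA divff ?scale1r//; by apply/eqP => /vnorm_eq0.
Qed.

End extension.

(** * Isometries of the circle *)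

Section quadrant.
Variables (R : realType) (Y : normedModType R) (g : R[i] -> Y) (X Z : Y -> R).
Implicit Types (a b c : R[i]) (t : R).
Hypothesis g_isom : forall a b, normc a = 1 -> normc b = 1 ->
  `|g a - g b| = normc (a - b).
Hypothesis g_norm : forall a, normc a = 1 -> `|g a| = 1.
Hypothesis g_surj : forall y, `|y| = 1 -> exists2 a, normc a = 1 & g a = y.

(** The preimage of [- g a] is at distance 2 from [a], and on the round circle only [- a] is. *)
Lemma g_opp a : normc a = 1 -> g (- a) = - g a.
Proof.
move=> a1; have [b b1 gb] : exists2 b, normc b = 1 & g b = - g a.
  by apply: g_surj; rewrite normrN g_norm.
rewrite -gb; congr g; have := g_isom b1 a1; rewrite gb -opprD normrN.
rewrite -mulr2n normrMn g_norm//.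
move/normc_eq1: a1; move/normc_eq1: b1; case: a {gb} => x y; case: b => z w /=.
move=> b1 a1 /esym ab; have := sqr_normcE ((z +i* w) - (x +i* y)).
rewrite /= in ab *; rewrite ab => h.
have x0 := sqr_ge0 (x + z); have y0 := sqr_ge0 (y + w).
have /eqP : (x + z) ^+ 2 = 0 by lra.
have /eqP : (y + w) ^+ 2 = 0 by lra.
rewrite !sqrf_eq0 !addr_eq0 => /eqP -> /eqP ->.
by rewrite -[- (_ +i* _)]/((- - z) +i* (- - w)) !opprK.
Qed.

Hypothesis XL : forall t y z, X (t *: y + z) = t * X y + X z.
Hypothesis ZL : forall t y z, Z (t *: y + z) = t * Z y + Z z.
Hypothesis XZ_le : forall y, X y ^+ 2 + Z y ^+ 2 <= `|y| ^+ 2.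
Hypothesis X1 : X (g 1) = 1.
Hypothesis Z1 : Z (g 1) = 0.
Hypothesis Xi : X (g 'i) = 0.
Hypothesis Zi : Z (g 'i) = 1.

Let XD y z : X (y + z) = X y + X z.
Proof. by have := XL 1 y z; rewrite scale1r mul1r. Qed.
Let ZD y z : Z (y + z) = Z y + Z z.
Proof. by have := ZL 1 y z; rewrite scale1r mul1r. Qed.
Let X0 : X 0 = 0. Proof. by have := XD 0 0; rewrite addr0; lra. Qed.
Let Z0 : Z 0 = 0. Proof. by have := ZD 0 0; rewrite addr0; lra. Qed.
Let XS t y : X (t *: y) = t * X y.
Proof. by have := XL t y 0; rewrite X0 !addr0. Qed.
Let ZS t y : Z (t *: y) = t * Z y.
Proof. by have := ZL t y 0; rewrite Z0 !addr0. Qed.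

Let P a := [/\ normc a = 1, 0 <= complex.Re a, 0 <= complex.Im a,
  X (g a) = complex.Re a & Z (g a) = complex.Im a].

Lemma norm_gD a b : normc a = 1 -> normc b = 1 -> `|g a + g b| = normc (a + b).
Proof.
move=> a1 b1; rewrite -[g b]opprK -g_opp// g_isom ?opprK//.
by rewrite normcN.
Qed.

(** If [g a + g b] is proportional to [g c] then [c] is at least as close to
    [1] and to ['i] as the direction [m] of [a + b], hence equal to it. *)
Lemma quadrant_mid a b : P a -> P b -> P ((normc (a + b))^-1%:C * (a + b)).
Proof.
move=> [a1 ax ay Xa Za] [b1 bx by_ Xb Zb].
pose n := normc (a + b).
have n0 : 0 < n.
  rewrite lt_neqAle normc_ge0 andbT eq_sym; apply/eqP => n0.
  have ab0 : a + b = 0 by exact: eq0_normc.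
  have := congr1 (@complex.Re R) ab0; have := congr1 (@complex.Im R) ab0.
  rewrite !raddfD /= => h1 h2.
  have hx : complex.Re a = 0 by lra.
  have hy : complex.Im a = 0 by lra.
  by move/normc_eq1: a1; rewrite hx hy; lra.
have [c c1 gc] : exists2 c, normc c = 1 & g c = n^-1 *: (g a + g b).
  apply: g_surj; rewrite normrZ norm_gD// gtr0_norm ?invr_gt0//.
  by rewrite mulVf// gt_eqF.
set m := n^-1%:C * (a + b).
have m1 : normc m = 1 by rewrite normcM normcR gtr0_norm ?invr_gt0// mulVf// gt_eqF.
have mx : complex.Re m = n^-1 * (complex.Re a + complex.Re b).
  by rewrite /m; case: (a) (b) => [? ?] [? ?] /=; ring.
have my : complex.Im m = n^-1 * (complex.Im a + complex.Im b).
  by rewrite /m; case: (a) (b) => [? ?] [? ?] /=; ring.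
have Xc : X (g c) = complex.Re m by rewrite gc XS XD Xa Xb mx.
have Zc : Z (g c) = complex.Im m by rewrite gc ZS ZD Za Zb my.
have mx0 : 0 <= complex.Re m by rewrite mx mulr_ge0 ?invr_ge0 ?addr_ge0// ltW.
have my0 : 0 <= complex.Im m by rewrite my mulr_ge0 ?invr_ge0 ?addr_ge0// ltW.
have i1 : normc ('i : R[i]) = 1 by apply/normc_eq1; rewrite /= expr0n expr1n add0r.
have cm : c = m.
  have := XZ_le (g c + g 1); have := XZ_le (g c + g 'i).
  rewrite !norm_gD ?normc1// !sqr_normcE !XD !ZD X1 Z1 Xi Zi Xc Zc !raddfD /=.
  move/normc_eq1: c1; move/normc_eq1: m1.
  case: c {gc Xc Zc} => x y; case: m {mx my} mx0 my0 => z w /= z0 w0 h1 h2 h3 h4.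
  have xz' : x = z by nra.
  have yw' : y = w by nra.
  by rewrite xz' yw'.
by rewrite /P -/m m1 -cm; split=> //; rewrite ?Xc ?Zc cm.
Qed.

(** With [n = |b + c|] and [d = (b + c) / n], [s b + t c = (s - t) b + t n d]. On the circle
    [|b - d|^2 = 2 - n] and [|b - c|^2 = 4 - n^2 = (2 - n) (2 + n)], hence the factor 2. *)
Lemma quadrant_halve a b c s t : P b -> P c -> 0 <= t <= s ->
  a = s%:C * b + t%:C * c ->
  exists d s' t', [/\ P d, 0 <= s', 0 <= t', a = s'%:C * b + t'%:C * d &
    normc (b - d) ^+ 2 <= normc (b - c) ^+ 2 / 2].
Proof.
move=> Pb Pc /andP[t0 ts] aE.
have := quadrant_mid Pb Pc; set n := normc (b + c) => Pd.
have n0 := normc_ge0 (b + c); rewrite -/n in n0.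
have [nE|nn0] := eqVneq n 0.
  have [d1 _ _ _ _] := Pd; move: d1; rewrite normcM normcR -/n nE mulr0.
  by move=> /eqP; rewrite eq_sym oner_eq0.
exists (n^-1%:C * (b + c)), (s - t), (t * n); split=> //.
- by rewrite subr_ge0.
- exact: mulr_ge0.
- have nC : n%:C != 0 :> R[i] by exact: realC_neq0.
  by rewrite aE rmorphB rmorphM fmorphV; field.
have nk : n^-1 * n = 1 by rewrite mulVf.
have nn : n ^+ 2 = (complex.Re b + complex.Re c) ^+ 2 +
    (complex.Im b + complex.Im c) ^+ 2 by rewrite sqr_normcE !raddfD.
have [b1 _ _ _ _] := Pb; have [c1 _ _ _ _] := Pc.
move/normc_eq1: b1; move/normc_eq1: c1; rewrite !sqr_normcE !raddfB /=.
move: nn nk; rewrite -/n; move: n n0 {nn0 Pd} => n n0.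
case: (b) (c) => x y [z w] /=; move: (n^-1) => k nn nk c1 b1.
have h : (x - k * (x + z)) ^+ 2 + (y - k * (y + w)) ^+ 2 = 2 - n.
  have e1 : 2 * (x * (x + z) + y * (y + w)) = n ^+ 2 by nra.
  have -> : (x - k * (x + z)) ^+ 2 + (y - k * (y + w)) ^+ 2 =
      (x ^+ 2 + y ^+ 2) - k * (2 * (x * (x + z) + y * (y + w))) +
      k ^+ 2 * ((x + z) ^+ 2 + (y + w) ^+ 2) by ring.
  rewrite e1 -nn b1 -exprMn nk expr1n expr2 mulrA nk mul1r; ring.
have h' : (x - z) ^+ 2 + (y - w) ^+ 2 = 4 - n ^+ 2 by nra.
have n2 : n <= 2 by have := sqr_ge0 (x - z); have := sqr_ge0 (y - w); nra.
rewrite [X in X <= _](_ : _ = 2 - n); last by rewrite -h; congr (_ ^+ 2 + _ ^+ 2); ring.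
rewrite [X in _ <= X / 2](_ : _ = 4 - n ^+ 2); last by rewrite -h'; congr (_ ^+ 2 + _ ^+ 2); ring.
nra.
Qed.

(** Bisection of the arc from 1 to ['i], whose chord has square 2: the direction of [b + c] replaces
    the endpoint of smaller weight, so [a] remains a nonnegative combination. *)
Lemma quadrant_approx a n : normc a = 1 ->
  0 <= complex.Re a -> 0 <= complex.Im a ->
  exists b c s t, [/\ P b /\ P c, 0 <= s, 0 <= t, a = s%:C * b + t%:C * c &
    normc (b - c) ^+ 2 <= 2 / 2 ^+ n].
Proof.
move=> a1 ax ay; elim: n => [|n [b [c [s [t [[Pb Pc] s0 t0 aE bc]]]]]].
  have i1 : normc ('i : R[i]) = 1 by apply/normc_eq1; rewrite /= expr0n expr1n add0r.
  exists 1, 'i, (complex.Re a), (complex.Im a); split=> //.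
  - by split; split; rewrite ?normc1 ?i1 ?ler01 ?lexx.
  - by rewrite mulr1 mulrC -complexE.
  - by rewrite sqr_normcE !raddfB /= expr0 divr1; lra.
have bc' : normc (b - c) ^+ 2 / 2 <= 2 / 2 ^+ n.+1.
  have -> : 2 / 2 ^+ n.+1 = 2 / 2 ^+ n / 2 :> R by rewrite [2 ^+ n.+1]exprSr invfM mulrA.
  by rewrite ler_pM2r// invr_gt0.
have [ts|st] := leP t s.
  have [|d [s' [t' [Pd s'0 t'0 aE' h]]]] := quadrant_halve Pb Pc _ aE.
    by rewrite t0.
  by exists b, d, s', t'; split=> //; exact: le_trans h bc'.
have [||d [s' [t' [Pd s'0 t'0 aE' h]]]] := @quadrant_halve a c b t s Pc Pb.
- by rewrite s0 ltW.
- by rewrite aE addrC.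
exists c, d, s', t'; split=> //; apply: le_trans h _.
by rewrite -(normcN (c - b)) opprB.
Qed.

(** As [a] lies on the arc from [b] to [c], [|a - b| <= |b - c|], and by [XZ_le] the coordinates of
    [g a] are as close to those of [g b]. Comparing both pairs with [b] and squaring the triangle
    inequality produces the factor 4. *)
Lemma quadrant_eq a : normc a = 1 -> 0 <= complex.Re a -> 0 <= complex.Im a ->
  X (g a) = complex.Re a /\ Z (g a) = complex.Im a.
Proof.
move=> a1 ax ay.
have bound n : (X (g a) - complex.Re a) ^+ 2 + (Z (g a) - complex.Im a) ^+ 2 <=
    4 * (2 / 2 ^+ n).
  have [b [c [s [t [[Pb Pc] s0 t0 aE bc]]]]] := quadrant_approx n a1 ax ay.
  have [b1 bx by_ Xb Zb] := Pb; have [c1 cx cy _ _] := Pc.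
  have ab : normc (a - b) ^+ 2 <= normc (b - c) ^+ 2.
    move: a1; rewrite aE; move/normc_eq1: b1; move/normc_eq1: c1.
    move=> + + /normc_eq1; rewrite !sqr_normcE.
    case: (b) (c) bx by_ cx cy => x y [z w] /= x0 y0 z0 w0 c1 b1 a1.
    have r0 : 0 <= x * z + y * w by rewrite addr_ge0// mulr_ge0.
    have r1 : x * z + y * w <= 1.
      have := sqr_ge0 (x - z); have := sqr_ge0 (y - w); nra.
    have st1 : 1 <= s + t.
      have : 0 <= s * t * (1 - (x * z + y * w)).
        by rewrite mulr_ge0 ?mulr_ge0// subr_ge0.
      nra.
    have key : x * z + y * w <= s + t * (x * z + y * w) by nra.
    set p := (X in X <= _); set q := (X in _ <= X).
    have -> : p = 2 - 2 * (s + t * (x * z + y * w)) by rewrite /p; nra.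
    have -> : q = 2 - 2 * (x * z + y * w) by rewrite /q; nra.
    lra.
  have h := XZ_le (g a - g b); rewrite g_isom// in h.
  have XB : X (g a - g b) = X (g a) - complex.Re b.
    by rewrite -scaleN1r XD XS Xb mulN1r.
  have ZB : Z (g a - g b) = Z (g a) - complex.Im b.
    by rewrite -scaleN1r ZD ZS Zb mulN1r.
  rewrite XB ZB in h; have {h} := le_trans h (le_trans ab bc); have {ab} := le_trans ab bc.
  rewrite sqr_normcE !raddfB /=.
  move: (X _) (Z _) (complex.Re a) (complex.Im a) (complex.Re b) (complex.Im b).
  move=> u v p q p' q'; move: (2 / 2 ^+ n) => r h1 h2.
  have e1 := sqr_ge0 (u - p' + (p - p')); have e2 := sqr_ge0 (v - q' + (q - q')).
  nra.
have le0 : (X (g a) - complex.Re a) ^+ 2 + (Z (g a) - complex.Im a) ^+ 2 <= 0.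
  apply/ler_addgt0Pr => d d0; rewrite add0r.
  pose n := (Num.truncn (8 / d)).+1; apply: le_trans (bound n) _.
  have n2 : n%:R <= 2 ^+ n :> R by rewrite -natrX ler_nat ltnW// ltn_expl.
  have n8 : 8 / d < n%:R by exact: truncnS_gt.
  rewrite mulrA -[4 * 2](_ : 8 = _); last by ring.
  rewrite ler_pdivrMr ?exprn_gt0// mulrC -ler_pdivrMr//.
  exact: le_trans (ltW n8) n2.
have x0 := sqr_ge0 (X (g a) - complex.Re a).
have z0 := sqr_ge0 (Z (g a) - complex.Im a).
split; apply/eqP; rewrite -subr_eq0 -sqrf_eq0; apply/eqP; lra.
Qed.

End quadrant.

Section circle.
Variables (R : realType) (Y : normedModType R) (g : R[i] -> Y).
Implicit Types (a b c : R[i]) (t : R).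
Hypothesis g_isom : forall a b, normc a = 1 -> normc b = 1 ->
  `|g a - g b| = normc (a - b).
Hypothesis g_norm : forall a, normc a = 1 -> `|g a| = 1.
Hypothesis g_surj : forall y, `|y| = 1 -> exists2 a, normc a = 1 & g a = y.

(** The second quadrant becomes the first one for [b |-> g ('i * b)] with coordinates [(Z, - X)];
    the lower half plane follows since [g] is odd. *)
Lemma coordinates_eq (X Z : Y -> R) :
  (forall t y z, X (t *: y + z) = t * X y + X z) ->
  (forall t y z, Z (t *: y + z) = t * Z y + Z z) ->
  (forall y, X y ^+ 2 + Z y ^+ 2 <= `|y| ^+ 2) ->
  X (g 1) = 1 -> Z (g 1) = 0 -> X (g 'i) = 0 -> Z (g 'i) = 1 ->
  forall a, normc a = 1 -> X (g a) = complex.Re a /\ Z (g a) = complex.Im a.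
Proof.
move=> XL ZL XZ X1 Z1 Xi Zi.
have X0 : X 0 = 0 by have := XL 1 0 0; rewrite scale1r addr0; lra.
have Z0 : Z 0 = 0 by have := ZL 1 0 0; rewrite scale1r addr0; lra.
have XN y : X (- y) = - X y.
  by have := XL (-1) y 0; rewrite scaleN1r !addr0 X0; lra.
have ZN y : Z (- y) = - Z y.
  by have := ZL (-1) y 0; rewrite scaleN1r !addr0 Z0; lra.
have i1 : normc ('i : R[i]) = 1 by apply/normc_eq1; rewrite /= expr0n expr1n add0r.
have ii : 'i * 'i = -1 :> R[i] by rewrite -expr2 sqr_i.
have gN := g_opp g_isom g_norm g_surj.
have g1N : g (-1) = - g 1 by rewrite gN// normc1.
have upper a : normc a = 1 -> 0 <= complex.Im a ->
    X (g a) = complex.Re a /\ Z (g a) = complex.Im a.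
  move=> a1 ay; have [ax|ax] := leP 0 (complex.Re a).
    exact: (quadrant_eq g_isom g_norm g_surj XL ZL XZ X1 Z1 Xi Zi).
  pose g' b := g ('i * b).
  have g'_isom b c : normc b = 1 -> normc c = 1 -> `|g' b - g' c| = normc (b - c).
    by move=> b1 c1; rewrite /g' g_isom ?normcM ?i1 ?mul1r// -mulrBr normcM i1 mul1r.
  have g'_norm b : normc b = 1 -> `|g' b| = 1.
    by move=> b1; rewrite /g' g_norm// normcM i1 mul1r.
  have g'_surj y : `|y| = 1 -> exists2 b, normc b = 1 & g' b = y.
    move=> /g_surj[b b1 <-]; exists (- 'i * b).
      by rewrite normcM normcN i1 mul1r.
    by rewrite /g' mulrA mulrN ii opprK mul1r.
  pose X' y := - X y.
  have X'L t y z : X' (t *: y + z) = t * X' y + X' z by rewrite /X' XL; ring.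
  have ZX' y : Z y ^+ 2 + X' y ^+ 2 <= `|y| ^+ 2 by rewrite /X' sqrrN addrC.
  have aE : a = 'i * (- 'i * a) by rewrite mulrA mulrN ii opprK mul1r.
  have := @quadrant_eq _ _ g' Z X' g'_isom g'_norm g'_surj ZL X'L ZX' _ _ _ _ (- 'i * a).
  rewrite /g' /X' -aE !mulr1 ii g1N ZN XN Zi Xi Z1 X1 !oppr0 opprK.
  case/(_ erefl erefl erefl erefl) => [|||].
  - by rewrite normcM normcN i1 mul1r.
  - by case: (a) ay => x y /= ay; lra.
  - by case: (a) ax => x y /= ax; lra.
  by case: (a) => x y /= h1 h2; split; lra.
move=> a a1; have [ay|ay] := leP 0 (complex.Im a); first exact: upper.
have := upper (- a); rewrite normcN gN// XN ZN => /(_ a1).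
case: (a) ay => x y /= ay []; first by lra.
by move=> h1 h2; split; lra.
Qed.

End circle.

(** * Coordinates from a maximal alternating form *)

Section circle_basis.
Variables (R : realType) (Y : normedModType R) (g : R[i] -> Y).
Implicit Types (a b c : R[i]) (t : R).
Hypothesis g_isom : forall a b, normc a = 1 -> normc b = 1 ->
  `|g a - g b| = normc (a - b).
Hypothesis g_norm : forall a, normc a = 1 -> `|g a| = 1.
Hypothesis g_surj : forall y, `|y| = 1 -> exists2 a, normc a = 1 & g a = y.

Lemma unit_angle a : normc a = 1 ->
  exists2 s, s \in `[- pi, pi] & a = cos s +i* sin s.
Proof.
move=> /normc_eq1; case: a => x y /= xy.
have x1 : -1 <= x <= 1 by apply/andP; have := sqr_ge0 y; split; nra.
have c1 : cos (acos x) = x by rewrite acosK// in_itv.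
have s1 : sin (acos x) = Num.sqrt (1 - x ^+ 2) by rewrite sin_acos.
have sy : 1 - x ^+ 2 = y ^+ 2 by lra.
have a0 := acos_ge0 x1; have ap := acos_lepi x1.
have [y0|y0] := leP 0 y.
  exists (acos x); first by rewrite in_itv /=; apply/andP; split; lra.
  by rewrite c1 s1 sy sqrtr_sqr ger0_norm.
exists (- acos x); first by rewrite in_itv /=; apply/andP; split; lra.
by rewrite cosN sinN c1 s1 sy sqrtr_sqr ltr0_norm// opprK.
Qed.

Let angle (s : R) : R[i] := cos s +i* sin s.

Lemma normc_angle s : normc (angle s) = 1.
Proof. by apply/normc_eq1; rewrite /= cos2Dsin2. Qed.

Lemma angle_continuous (psi : Y -> R) :
  (forall t x y, psi (t *: x + y) = t * psi x + psi y) ->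
  (forall y, psi y <= `|y|) -> continuous (fun s => psi (g (angle s))).
Proof.
move=> psiL psi_le s; apply/cvgrPdist_lt => /= e e0.
have e2 : 0 < e / 2 by rewrite divr_gt0.
near=> t.
have psiB y z : psi y - psi z <= `|y - z|.
  have <- : psi ((-1) *: z + y) = psi y - psi z by rewrite psiL; ring.
  by apply: le_trans (psi_le _) _; rewrite scaleN1r addrC.
have gst : `|g (angle s) - g (angle t)| < e.
  rewrite g_isom ?normc_angle//.
  have ct : `|cos s - cos t| < e / 2.
    by near: t; apply: cvgr_dist_lt e2; exact: continuous_cos.
  have st : `|sin s - sin t| < e / 2.
    by near: t; apply: cvgr_dist_lt e2; exact: continuous_sin.
  have -> : angle s - angle t = (cos s - cos t)%:C + (0 +i* (sin s - sin t)).
    by apply/eqP; rewrite eq_complex /= add0r addr0 !eqxx.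
  apply: le_lt_trans (le_normcD _ _) _; rewrite normcR.
  by rewrite /= expr0n add0r sqrtr_sqr; lra.
have h1 := psiB (g (angle s)) (g (angle t)).
have h2 := psiB (g (angle t)) (g (angle s)); rewrite distrC in h2.
by rewrite ltr_norml; apply/andP; split; lra.
Unshelve. all: by end_near. Qed.

Lemma maximal_pair (psi1 psi2 : Y -> R) :
  (forall t x y, psi1 (t *: x + y) = t * psi1 x + psi1 y) ->
  (forall t x y, psi2 (t *: x + y) = t * psi2 x + psi2 y) ->
  (forall y, psi1 y <= `|y|) -> (forall y, psi2 y <= `|y|) ->
  exists a b, [/\ normc a = 1, normc b = 1 & forall c d, normc c = 1 -> normc d = 1 ->
    psi1 (g c) * psi2 (g d) - psi1 (g d) * psi2 (g c) <=
    psi1 (g a) * psi2 (g b) - psi1 (g b) * psi2 (g a)].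
Proof.
move=> L1 L2 le1 le2.
have c1 := angle_continuous L1 le1; have c2 := angle_continuous L2 le2.
set p1 := fun s => psi1 (g (angle s)) in c1; set p2 := fun s => psi2 (g (angle s)) in c2.
pose F (z : R * R) := p1 z.1 * p2 z.2 - p1 z.2 * p2 z.1.
have fstc (p : R -> R) : continuous p -> continuous (fun z : R * R => p z.1).
  by move=> pc z; apply: (continuous_comp (@cvg_fst _ _ _ _ _) (@pc _)).
have sndc (p : R -> R) : continuous p -> continuous (fun z : R * R => p z.2).
  by move=> pc z; apply: (continuous_comp (@cvg_snd _ _ _ _ _) (@pc _)).
have Fc : continuous F.
  by move=> z; apply: cvgB; apply: cvgM; [exact: fstc|exact: sndc|exact: sndc|exact: fstc].
have pi0 : - pi <= pi :> R by have := @pi_ge0 R; lra.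
have K0 : (`[- pi, pi] `*` `[- pi, pi] : set (R * R)) !=set0.
  by exists (pi, pi); split; rewrite /= in_itv /= lexx pi0.
have [[s t] _ max] := compact_EVT_max K0
  (compact_setX (@segment_compact R (- pi) pi) (@segment_compact R (- pi) pi))
  (continuous_subspaceT Fc).
exists (angle s), (angle t); split; rewrite ?normc_angle// => c d cc1 d1.
have [s' s'pi ->] := unit_angle cc1; have [t' t'pi ->] := unit_angle d1.
by apply: (max (s', t')); rewrite inE.
Qed.

(** Let the alternating form [om] be maximal at [(g a, g b)], with value [M].
    From [2 om(u, v) = - om(u + v, u - v)] and the norms of [g c + g d] and
    [g c - g d] follows [|om(g c, g d)| <= M |Im (c^* d)|]. Hence [b] is
    [+- 'i a], and the coordinates in the basis [g a, g ('i a)] are dominated by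
    real and imaginary parts. *)
Lemma circle_coordinates : exists a0 (X Z : Y -> R),
  [/\ normc a0 = 1, forall t y z, X (t *: y + z) = t * X y + X z,
      forall t y z, Z (t *: y + z) = t * Z y + Z z
    & forall a, normc a = 1 ->
      X (g (a0 * a)) = complex.Re a /\ Z (g (a0 * a)) = complex.Im a].
Proof.
have i1 : normc ('i : R[i]) = 1 by apply/normc_eq1; rewrite /= expr0n expr1n add0r.
have gN := g_opp g_isom g_norm g_surj.
have gD := norm_gD g_isom g_norm g_surj.
have supp a : normc a = 1 -> exists psi : Y -> R,
    [/\ forall t x y, psi (t *: x + y) = t * psi x + psi y,
        forall x, psi x <= `|x| & psi (g a) = 1].
  move=> a1; have [||psi [psiL psi_le psi1]] := @support_functional R Y [set g a].
  - by move=> u v t -> -> _ /=; rewrite -scalerDl subrK scale1r.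
  - by move=> _ ->; exact: g_norm.
  by exists psi; split=> //; exact: psi1.
have [psi1 [L1 le1 psi11]] := supp 1 (normc1 _).
have [psi2 [L2 le2 psi2i]] := supp 'i i1.
pose om y z := psi1 y * psi2 z - psi1 z * psi2 y.
have [a [b [a1 b1 max]]] := maximal_pair L1 L2 le1 le2.
rewrite -/(om _ _) in max; set M := om (g a) (g b) in max.
have {}max c d : normc c = 1 -> normc d = 1 -> om (g c) (g d) <= M by exact: max.
have omC y z : om z y = - om y z by rewrite /om; ring.
have abs_om c d : normc c = 1 -> normc d = 1 -> `|om (g c) (g d)| <= M.
  by move=> c1 d1; rewrite ler_norml lerNl -omC !max.
have psi10 : psi1 0 = 0 by have := L1 1 0 0; rewrite scale1r addr0; lra.
have psi20 : psi2 0 = 0 by have := L2 1 0 0; rewrite scale1r addr0; lra.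
have psi1N y : psi1 (- y) = - psi1 y.
  by have := L1 (-1) y 0; rewrite scaleN1r !addr0 psi10; lra.
have psi2N y : psi2 (- y) = - psi2 y.
  by have := L2 (-1) y 0; rewrite scaleN1r !addr0 psi20; lra.
(* At [(g 1, g 'i)] the form is [1 - psi1 (g 'i) * psi2 (g 1)], with [|psi2 (g 1)| <= 1]. As
   [psi1 (g 1) = 1] while [g 1 + g 'i] and [g 1 - g 'i] have norm less than 2,
   [|psi1 (g 'i)| < 1]. *)
have M0 : 0 < M.
  apply: lt_le_trans (max 1 'i (normc1 _) i1); rewrite /om psi11 psi2i mul1r.
  have D1 y z : psi1 (y + z) = psi1 y + psi1 z.
    by have := L1 1 y z; rewrite scale1r mul1r.
  have h1 := le1 (g 1 + g 'i); have h2 := le1 (g 1 - g 'i).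
  rewrite !D1 psi1N psi11 gD ?normc1// in h1 h2.
  rewrite g_isom ?normc1// in h2.
  have sq (z : R[i]) : complex.Re z = 1 -> complex.Im z ^+ 2 = 1 -> normc z < 2.
    move=> zx zy; have := sqr_normcE z; rewrite zx zy expr1n => h.
    by have := normc_ge0 z; nra.
  have s1 : normc (1 + 'i%C : R[i]) < 2.
    by apply: sq; rewrite raddfD /=; [rewrite addr0|rewrite add0r expr1n].
  have s2 : normc (1 - 'i%C : R[i]) < 2.
    by apply: sq; rewrite raddfB /=; [rewrite subr0|rewrite sub0r sqrrN expr1n].
  have h3 := le2 (g 1); have h4 := le2 (- g 1).
  rewrite psi2N normrN g_norm ?normc1// in h3 h4.
  have p1 : `|psi1 (g 'i)| < 1 by rewrite ltr_norml; apply/andP; split; lra.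
  have q1 : `|psi2 (g 1)| <= 1 by rewrite ler_norml; apply/andP; split; lra.
  rewrite subr_gt0 (le_lt_trans (ler_norm _))// normrM.
  by apply: le_lt_trans p1; rewrite ler_piMr.
have conjE (x y : R) : Num.conj (x +i* y) = x -i* y by [].
have omL t u v z : om (t *: u + v) z = t * om u z + om v z.
  by rewrite /om L1 L2; ring.
have omr t u v z : om z (t *: u + v) = t * om z u + om z v.
  by rewrite /om L1 L2; ring.
have om0 z : om 0 z = 0 by rewrite /om psi10 psi20 !mul0r mulr0 subrr.
have polarE y : exists2 c, normc c = 1 & y = `|y| *: g c.
  have [->|y0] := eqVneq y 0; first by exists 1; rewrite ?normc1// normr0 scale0r.
  have [|c c1 cE] := @g_surj (`|y|^-1 *: y).
    by rewrite normrZ normfV normr_id mulVf ?normr_eq0.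
  by exists c => //; rewrite cE scalerA divff ?normr_eq0// scale1r.
have om_le y z : `|om y z| <= M * (`|y| * `|z|).
  have [c c1 ->] := polarE y; have [d d1 ->] := polarE z.
  have e1 : om (`|y| *: g c) (`|z| *: g d) = (`|y| * `|z|) * om (g c) (g d).
    by rewrite /om -[_ *: g c]addr0 -[_ *: g d]addr0 !L1 !L2 psi10 psi20; ring.
  rewrite e1 !normrM !normrZ !normr_id !g_norm// !mulr1.
  by rewrite mulrC ler_wpM2r ?mulr_ge0// abs_om.
have om_sqr c d : normc c = 1 -> normc d = 1 ->
    om (g c) (g d) ^+ 2 <= M ^+ 2 * complex.Im (Num.conj c * d) ^+ 2.
  move=> c1 d1.
  have h := om_le (g c + g d) (g c - g d).
  rewrite gD// g_isom// in h.
  have e1 : om (g c + g d) (g c - g d) = - 2 * om (g c) (g d).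
    have D1 y z : psi1 (y + z) = psi1 y + psi1 z.
      by have := L1 1 y z; rewrite scale1r mul1r.
    have D2 y z : psi2 (y + z) = psi2 y + psi2 z.
      by have := L2 1 y z; rewrite scale1r mul1r.
    by rewrite /om !D1 !D2 psi1N psi2N; ring.
  have h2 : om (g c + g d) (g c - g d) ^+ 2 <=
      (M * (normc (c + d) * normc (c - d))) ^+ 2.
    rewrite -[X in X <= _]real_normK ?num_real// ler_sqr ?nnegrE//.
    by rewrite mulr_ge0 ?mulr_ge0 ?normc_ge0// ltW.
  rewrite e1 !exprMn !sqr_normcE in h2.
  suff e2 : ((complex.Re (c + d)) ^+ 2 + (complex.Im (c + d)) ^+ 2) *
     ((complex.Re (c - d)) ^+ 2 + (complex.Im (c - d)) ^+ 2) =
     4 * complex.Im (Num.conj c * d) ^+ 2 by rewrite e2 in h2; lra.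
  move/normc_eq1: c1; move/normc_eq1: d1.
  case: (c) (d) => x y [z w]; rewrite conjE /= => d1 c1.
  have -> : ((x + z) ^+ 2 + (y + w) ^+ 2) = 2 + 2 * (x * z + y * w) by nra.
  have -> : ((x - z) ^+ 2 + (y - w) ^+ 2) = 2 - 2 * (x * z + y * w) by nra.
  have e2 : (x * z + y * w) ^+ 2 + (x * w + - y * z) ^+ 2 =
    (x ^+ 2 + y ^+ 2) * (z ^+ 2 + w ^+ 2) by ring.
  rewrite c1 d1 in e2; nra.
have aa : Num.conj a * a = 1 by rewrite mulrC mulc_conj a1 expr1n.
have ia1 : normc ('i * a) = 1 by rewrite normcM i1 mul1r.
set N := om (g a) (g ('i * a)).
have N2 : N ^+ 2 = M ^+ 2.
  have k1 : 1 <= complex.Im (Num.conj a * b) ^+ 2.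
    have := om_sqr a b a1 b1; rewrite -/M => h.
    have M2 : 0 < M ^+ 2 by rewrite exprn_gt0.
    by rewrite -(ler_pM2l M2) mulr1.
  have n1 : normc (Num.conj a * b) = 1 by rewrite normcM normc_conj a1 b1 mulr1.
  have bE : b = a * (Num.conj a * b) by rewrite mulrA [a * _]mulrC aa mul1r.
  move/normc_eq1: n1; move: (Num.conj a * b) k1 bE => [x y] /= k1 bE xy.
  have x0 : x = 0.
    by apply/eqP; rewrite -sqrf_eq0; apply/eqP; have := sqr_ge0 x; lra.
  have : (y - 1) * (y + 1) = 0 by move: xy; rewrite x0; lra.
  move=> /eqP; rewrite mulf_eq0 => /orP[|] /eqP y1.
    suff -> : M = N by [].
    by rewrite /M /N bE x0 (_ : y = 1) ?[a * _]mulrC//; lra.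
  suff -> : M = - N by rewrite sqrrN.
  rewrite /M bE x0 (_ : y = -1); last by lra.
  rewrite (_ : a * _ = - ('i * a)); last first.
    by rewrite mulrC -mulNr; congr (_ * _); apply/eqP; rewrite eq_complex /= oppr0 !eqxx.
  by rewrite gN// -scaleN1r -[_ *: _]addr0 omr [om _ 0]omC om0 -/N; ring.
have N0 : N != 0 by rewrite -sqrf_eq0 N2 expf_neq0// gt_eqF.
(* Cramer's rule in the basis [g a], [g ('i * a)]. Dividing by [N] rather than [M] takes care of the
   orientation, as [N] may be [M] or [- M]. *)
pose X y := N^-1 * om y (g ('i * a)); pose Z y := N^-1 * om (g a) y.
have XL t y z : X (t *: y + z) = t * X y + X z by rewrite /X omL; ring.
have ZL t y z : Z (t *: y + z) = t * Z y + Z z by rewrite /Z omr; ring.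
have XZ y : X y ^+ 2 + Z y ^+ 2 <= `|y| ^+ 2.
  have [b' b'1 ->] := polarE y.
  have {b'1} : exists2 c, normc c = 1 & b' = a * c.
    exists (Num.conj a * b'); first by rewrite normcM normc_conj a1 b'1 mulr1.
    by rewrite mulrA [a * _]mulrC aa mul1r.
  case=> c c1 ->.
  have XS t z : X (t *: z) = t * X z by rewrite -[t *: z]addr0 XL /X om0; ring.
  have ZS t z : Z (t *: z) = t * Z z.
    by rewrite -[t *: z]addr0 ZL /Z [om _ 0]omC om0; ring.
  have ac1 : normc (a * c) = 1 by rewrite normcM a1 c1 mulr1.
  rewrite XS ZS normrZ normr_id g_norm// mulr1 !exprMn -mulrDr.
  rewrite -[X in _ <= X]mulr1 ler_wpM2l ?sqr_ge0//.

  have M2 : 0 < M ^+ 2 by rewrite exprn_gt0.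
  rewrite exprVn N2 -mulrDr ler_pdivrMl// mulr1.
  have h1 := om_sqr (a * c) ('i * a) ac1 ia1.
  have h2 := om_sqr a (a * c) a1 ac1.
  rewrite (mulrA (Num.conj a)) aa mul1r in h2.
  have e1 : Num.conj (a * c) * ('i * a) = Num.conj c * 'i * (Num.conj a * a).
    by rewrite rmorphM /=; ring.
  rewrite e1 aa mulr1 in h1.
  move/normc_eq1: c1 => c1; move: h1 h2 c1; case: (c) => u v; rewrite conjE /=.
  move: (om _ _) (om _ _) => p q h1 h2 c1.
  have e2 : M ^+ 2 = M ^+ 2 * (u * 1 + - v * 0) ^+ 2 + M ^+ 2 * v ^+ 2.
    by rewrite -mulrDr mulr1 mulr0 addr0 c1 mulr1.
  lra.
exists a, X, Z; split=> //.
have g'_isom c d : normc c = 1 -> normc d = 1 ->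
    `|g (a * c) - g (a * d)| = normc (c - d).
  by move=> c1 d1; rewrite g_isom ?normcM ?a1 ?mul1r// -mulrBr normcM a1 mul1r.
have g'_norm c : normc c = 1 -> `|g (a * c)| = 1.
  by move=> c1; rewrite g_norm// normcM a1 mul1r.
have g'_surj y : `|y| = 1 -> exists2 c, normc c = 1 & g (a * c) = y.
  move=> /g_surj[b' b'1 <-]; exists (Num.conj a * b').
    by rewrite normcM normc_conj a1 mul1r.
  by rewrite mulrA [a * _]mulrC aa mul1r.
apply: (coordinates_eq g'_isom g'_norm g'_surj XL ZL XZ).
- by rewrite mulr1 /X mulVf.
- by rewrite mulr1 /Z /om subrr mulr0.
- by rewrite [a * _]mulrC /X /om subrr mulr0.
- by rewrite [a * _]mulrC /Z mulVf.
Qed.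

End circle_basis.

(** * Hilbert spaces and compact operators *)

Section real_topology.
Variables (R : realType) (V : normedModType R[i]).
Implicit Types (x y : V) (d : R).

Lemma nbhs_vnorm x (B : set V) :
  nbhs x B <-> exists2 d, 0 < d & forall y, vnorm (x - y) < d -> B y.
Proof.
split=> [/nbhs_ballP[e /= e0 xB]|[d d0 xB]]; last apply/nbhs_ballP.
  have e0R : 0 < complex.Re e by move: e0; rewrite ltcE => /andP[].
  have eE : (complex.Re e)%:C = e by rewrite RRe_real// gtr0_real.
  exists (complex.Re e) => // y xy; apply: xB.
  by rewrite -ball_normE /ball_ /= -vnormE -eE ltcR.
exists d%:C; first by rewrite /= ltcR.
by move=> y; rewrite -ball_normE /ball_ /= -vnormE ltcR => /xB.
Qed.

Lemma vnorm_dist x y : `|vnorm x - vnorm y| <= vnorm (x - y).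
Proof.
rewrite ler_norml; apply/andP; split.
  have := vnormD (y - x) x; rewrite subrK vdistC; lra.
by have := vnormD (x - y) y; rewrite subrK; lra.
Qed.

Lemma vnorm_continuous : continuous (@vnorm R V).
Proof.
move=> x; apply/cvgrPdist_lt => /= d d0; apply/nbhs_vnorm; exists d => // y xy.
exact: le_lt_trans (vnorm_dist _ _) xy.
Qed.

End real_topology.

Lemma vnorm_complete (R : realType) (V : completeNormedModType R[i])
    (u : nat -> V) :
  (forall d : R, 0 < d -> exists N, forall m n, (N <= m)%N -> (N <= n)%N ->
    vnorm (u m - u n) < d) ->
  exists l, forall d : R, 0 < d -> exists N, forall n, (N <= n)%N ->
    vnorm (l - u n) < d.
Proof.
move=> cu.
have /cvg_ex[l ul] : cvg (u @ \oo).
  apply: cauchy_cvg; apply: cauchy_exP => e e0.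
  have e0R : 0 < complex.Re e by move: e0; rewrite ltcE => /andP[].
  have eE : (complex.Re e)%:C = e by rewrite RRe_real// gtr0_real.
  have [N uN] := cu _ e0R; exists (u N), N => // n /= Nn.
  by rewrite /= -ball_normE /ball_ /= -vnormE -eE ltcR; apply: uN.
exists l => d d0.
have /ul[N _ uN] : nbhs l [set y | vnorm (l - y) < d].
  by apply/nbhs_vnorm; exists d.
by exists N => n Nn; exact: uN.
Qed.

Section hilbert.
Variables (R : realType) (H : hilbertType R).
Implicit Types (x y z : H) (a : R[i]).

Definition dot x y : R[i] := hdot x y.

Lemma dotDl x y z : dot (x + y) z = dot x z + dot y z.
Proof. by rewrite /dot linearDl. Qed.

Lemma dotZl a x y : dot (a *: x) y = a * dot x y.
Proof. by rewrite /dot linearZl_LR. Qed.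

Lemma dotC x y : dot y x = Num.conj (dot x y).
Proof. by rewrite /dot hermC expr0 mul1r. Qed.

Lemma dotxx x : dot x x = (vnorm x ^+ 2)%:C.
Proof. by rewrite /dot hdot_norm -vnormE rmorphXn. Qed.

Lemma dotDr x y z : dot z (x + y) = dot z x + dot z y.
Proof. by rewrite dotC dotDl rmorphD /= -!dotC. Qed.

Lemma dotZr a x y : dot x (a *: y) = Num.conj a * dot x y.
Proof. by rewrite dotC dotZl rmorphM /= -dotC. Qed.

Lemma dot0l x : dot 0 x = 0.
Proof. by rewrite -(scale0r 0) dotZl mul0r. Qed.

Lemma dot0r x : dot x 0 = 0.
Proof. by rewrite dotC dot0l rmorph0. Qed.

Lemma dotNl x y : dot (- x) y = - dot x y.
Proof. by rewrite -scaleN1r dotZl mulN1r. Qed.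

Lemma dotBl x y z : dot (x - y) z = dot x z - dot y z.
Proof. by rewrite dotDl dotNl. Qed.

Lemma Re_dotC x y : complex.Re (dot y x) = complex.Re (dot x y).
Proof. by rewrite dotC; case: (dot x y). Qed.

Lemma sqr_vnormD x y :
  vnorm (x + y) ^+ 2 = vnorm x ^+ 2 + 2 * complex.Re (dot x y) + vnorm y ^+ 2.
Proof.
have := congr1 (@complex.Re R) (dotxx (x + y)).
rewrite dotDl !dotDr !raddfD /= !dotxx /= Re_dotC => <-; ring.
Qed.

Lemma sqr_vnormB x y :
  vnorm (x - y) ^+ 2 = vnorm x ^+ 2 - 2 * complex.Re (dot x y) + vnorm y ^+ 2.
Proof. by rewrite sqr_vnormD vnormN Re_dotC dotNl raddfN /= Re_dotC; ring. Qed.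

Lemma sqr_vnormZ a x : vnorm (a *: x) ^+ 2 = normc a ^+ 2 * vnorm x ^+ 2.
Proof. by rewrite vnormZ exprMn. Qed.

Lemma pythagoras x y : dot x y = 0 ->
  vnorm (x + y) ^+ 2 = vnorm x ^+ 2 + vnorm y ^+ 2.
Proof. by move=> xy; rewrite sqr_vnormD xy /= mulr0 addr0. Qed.

Lemma ler_vnorm x y : (vnorm x <= vnorm y) = (vnorm x ^+ 2 <= vnorm y ^+ 2).
Proof. by rewrite ler_sqr ?nnegrE ?vnorm_ge0. Qed.

Lemma dot_proj x y : vnorm y = 1 -> dot (x - dot x y *: y) y = 0.
Proof. by move=> y1; rewrite dotBl dotZl dotxx y1 expr1n mulr1 subrr. Qed.

Lemma sqr_vnorm_proj x y : vnorm y = 1 ->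
  vnorm x ^+ 2 = vnorm (x - dot x y *: y) ^+ 2 + normc (dot x y) ^+ 2.
Proof.
move=> y1; rewrite -{1}(subrK (dot x y *: y) x) [LHS]pythagoras.
  by rewrite sqr_vnormZ y1 expr1n mulr1.
by rewrite dotZr dot_proj// mulr0.
Qed.

Lemma cauchy_schwarz1 x y : vnorm y = 1 -> normc (dot x y) <= vnorm x.
Proof.
move=> y1; rewrite -ler_sqr ?nnegrE ?vnorm_ge0 ?normc_ge0//.
by rewrite [leRHS](sqr_vnorm_proj x y1) lerDr sqr_ge0.
Qed.

Lemma unit_dot1 x y : vnorm x <= 1 -> vnorm y = 1 -> dot x y = 1 -> x = y.
Proof.
move=> x1 y1 xy; apply/eqP; rewrite -subr_eq0; apply/eqP/vnorm_eq0/eqP.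
rewrite -sqrf_eq0 eq_le sqr_ge0 andbT sqr_vnormB xy y1 /=.
have := vnorm_ge0 x; nra.
Qed.

Lemma unit_dot_norm1 x y : vnorm x = 1 -> vnorm y = 1 -> normc (dot x y) = 1 ->
  x = dot x y *: y.
Proof.
move=> x1 y1 xy; apply/eqP; rewrite -subr_eq0; apply/eqP/vnorm_eq0/eqP.
rewrite -sqrf_eq0; have := sqr_vnorm_proj x y1.
by rewrite xy x1 !expr1n => h; apply/eqP; lra.
Qed.

End hilbert.

Section compact_op_norm.
Variables (R : realType) (V : normedModType R[i]).
Implicit Types (T : compact_op V) (x y : V).

Lemma copD T x y : T (x + y) = T x + T y.
Proof. by have := compact_opL T 1 x y; rewrite !scale1r. Qed.

Lemma cop0 T : T 0 = 0.
Proof.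
by have := compact_opL T (-1) 0 0; rewrite scaler0 addr0 scaleN1r addNr.
Qed.

Lemma copZ T a x : T (a *: x) = a *: T x.
Proof. by have := compact_opL T a x 0; rewrite cop0 !addr0. Qed.

Lemma copB T x y : T (x - y) = T x - T y.
Proof. by rewrite copD -scaleN1r copZ scaleN1r. Qed.

Lemma vnorm_le1 x : (`|x| <= 1) = (vnorm x <= 1).
Proof. by rewrite -vnormE lecE /= eqxx. Qed.

Lemma cop_norm_le T (M : R) :
  (forall x, vnorm x <= 1 -> vnorm (T x) <= M) -> vnorm T <= M.
Proof.
by move=> TM; apply: operator_norm_le => x; rewrite vnorm_le1; exact: TM.
Qed.

Lemma cop_norm_ub T x : vnorm x <= 1 -> vnorm (T x) <= vnorm T.
Proof. by rewrite -vnorm_le1; exact: operator_norm_ub. Qed.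

Lemma cop_norm_ubM T x : vnorm (T x) <= vnorm T * vnorm x.
Proof.
have [->|/eqP x0] := eqVneq x 0.
  by rewrite cop0 !vnorm0 mulr0.
have s0 : 0 < vnorm x.
  by rewrite lt_neqAle vnorm_ge0 andbT eq_sym; apply/eqP => /vnorm_eq0.
have -> : x = (vnorm x)%:C *: ((vnorm x)^-1%:C *: x).
  by rewrite scalerA -rmorphM divff ?gt_eqF// rmorph1 scale1r.
rewrite copZ !vnormZr [in leRHS]mulrCA ler_wpM2l//.
rewrite gtr0_norm ?invr_gt0// mulVf ?gt_eqF// mulr1.
by apply: cop_norm_ub; rewrite vnormZr gtr0_norm ?invr_gt0// mulVf ?gt_eqF.
Qed.

Lemma rscale_continuous x : continuous (fun s : R => s%:C *: x).
Proof.
move=> s B /nbhs_vnorm[d d0 xB].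
have n0 : 0 < vnorm x + 1 by rewrite ltr_wpDl ?vnorm_ge0.
apply/nbhs_ballP; exists (d / (vnorm x + 1)); first by rewrite /= divr_gt0.
move=> t; rewrite -ball_normE /ball_ /= ltr_pdivlMr// => st; apply: xB.
rewrite -scalerBl -rmorphB vnormZr; apply: le_lt_trans st.
by rewrite ler_wpM2l// lerDl.
Qed.

End compact_op_norm.

Section compact_op_hilbert.
Variables (R : realType) (H : hilbertType R).
Implicit Types (T : compact_op H) (x y : H).

(** Compactness provides a vector [y] of maximal norm only in the closure of the image of the unit
    ball. Vectors [u n] with images tending to [y] form a Cauchy sequence by the parallelogram law;
    its limit [l] has [T l = y], and [M <= M * vnorm l] makes it a unit vector. *)
Lemma compact_op_attain T : T <> 0 ->
  exists x, vnorm x = 1 /\ vnorm (T x) = vnorm T.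
Proof.
move=> T0; have M0 : 0 < vnorm T.
  by rewrite lt_neqAle vnorm_ge0 andbT eq_sym; apply/eqP => /vnorm_eq0.
set M := vnorm T in M0 *.
have [_] := compact_opP T; rewrite precompactE; set K := closure _ => cK.
have K0 : K !=set0.
  by exists (T 0); apply: subset_closure; exists 0; rewrite //= normr0.
have [y /set_mem Ky yK] := compact_EVT_max K0 cK
  (continuous_subspaceT (@vnorm_continuous R H)).
have yM : M <= vnorm y.
  apply: cop_norm_le => x x1; apply: yK; apply/mem_set; apply: subset_closure.
  by exists x; rewrite //= vnorm_le1.
have near_y (d : R) : 0 < d -> exists x, vnorm x <= 1 /\ vnorm (y - T x) < d.
  move=> d0; have /Ky[_ [[x /= x1 <-] yx]] : nbhs y [set z | vnorm (y - z) < d].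
    by apply/nbhs_vnorm; exists d.
  by exists x; split=> //; rewrite -vnorm_le1.
have /choice[u uP] : forall n : nat, exists x,
    vnorm x <= 1 /\ vnorm (y - T x) < n.+1%:R^-1.
  by move=> n; apply: near_y; rewrite invr_gt0.
(* The parallelogram law: two almost norming vectors are close. *)
have close x x' (d : R) : 0 < d -> vnorm x <= 1 -> vnorm x' <= 1 ->
    vnorm (y - T x) < d -> vnorm (y - T x') < d ->
    vnorm (x - x') ^+ 2 <= 8 * d / M.
  move=> d0 x1 x'1 yx yx'.
  have h1 : 2 * M - 2 * d <= M * vnorm (x + x').
    apply: le_trans (cop_norm_ubM T _).
    have := vnormD ((y - T x) + (y - T x')) (T (x + x')).
    rewrite copD addrACA !subrK.
    have -> : vnorm (y + y) = 2 * vnorm y.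
      by rewrite -mulr2n -scaler_nat -(rmorph_nat (real_complex R)) vnormZr ger0_norm.
    have := vnormD (y - T x) (y - T x'); lra.
  rewrite sqr_vnormB; have := sqr_vnormD x x'.
  have := vnorm_ge0 x; have := vnorm_ge0 x'; have := vnorm_ge0 (x + x').
  move: (vnorm (x + x')) (vnorm x) (vnorm x') x1 x'1 h1 => p q r q1 r1 h1 p0 r0 q0 h2.
  rewrite ler_pdivlMr//.
  have h3 : M * p ^+ 2 >= 4 * M - 8 * d.
    have := sqr_ge0 (p - 2); rewrite sqrrB => h4.
    have : 0 <= M * (p ^+ 2 - 4 * (p - 1)) by apply: mulr_ge0; [exact: ltW|lra].
    lra.
  have h5 : 0 <= M * (4 - (2 * q ^+ 2 + 2 * r ^+ 2)).
    by apply: mulr_ge0; [exact: ltW|nra].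
  nra.
have inv_lt (d : R) : 0 < d -> exists N, forall n, (N <= n)%N -> n.+1%:R^-1 < d.
  move=> d0; exists (Num.truncn d^-1) => n Nn.
  rewrite invf_plt ?posrE//; apply: lt_le_trans (truncnS_gt _) _.
  by rewrite ler_nat.
have [l ul] : exists l, forall d : R, 0 < d -> exists N, forall n, (N <= n)%N ->
    vnorm (l - u n) < d.
  apply: vnorm_complete => d d0.
  have d'0 : 0 < d ^+ 2 * M / 8 by rewrite divr_gt0// mulr_gt0// exprn_gt0.
  have [N uN] := inv_lt _ d'0; exists N => m n Nm Nn.
  have [um1 um2] := uP m; have [un1 un2] := uP n.
  have dN : 0 < N.+1%:R^-1 :> R by rewrite invr_gt0.
  have le_inv k : (N <= k)%N -> k.+1%:R^-1 <= N.+1%:R^-1 :> R.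
    by move=> Nk; rewrite lef_pV2 ?posrE// ler_nat.
  have := close _ _ _ dN um1 un1 (lt_le_trans um2 (le_inv m Nm))
    (lt_le_trans un2 (le_inv n Nn)).
  rewrite ler_pdivlMr// => h; rewrite -(ltr_pXn2r (_ : 0 < 2)%N) ?nnegrE ?vnorm_ge0 ?ltW//.
  have := uN N (leqnn _); rewrite ltr_pdivlMr// => h'.
  by rewrite -(ltr_pM2r M0); apply: le_lt_trans h _; rewrite mulrC.
have Tl : T l = y.
  apply/esym/eqP; rewrite -subr_eq0; apply/eqP/vnorm_eq0/eqP.
  rewrite eq_le vnorm_ge0 andbT; apply/ler_addgt0Pr => d d0; rewrite add0r.
  have d1 : 0 < d / 2 / M by rewrite !divr_gt0.
  have d2 : 0 < d / 2 by rewrite divr_gt0.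
  have [N1 uN1] := ul _ d1; have [N2 uN2] := inv_lt _ d2.
  pose n := maxn N1 N2; have [_ un] := uP n.
  have := uN1 n (leq_maxl _ _); rewrite ltr_pdivlMr// => h1.
  have h2 := uN2 n (leq_maxr _ _).
  have h3 := cop_norm_ubM T (u n - l).
  rewrite copB [vnorm (u n - l)]vdistC -/M [M * _]mulrC in h3.
  have h4 := vnormD (y - T (u n)) (T (u n) - T l); rewrite addrA subrK in h4.
  apply: le_trans h4 _; rewrite [leRHS](splitr d).
  apply: lerD; first exact: ltW (lt_trans un h2).
  exact: le_trans h3 (ltW h1).
have l1 : vnorm l <= 1.
  apply/ler_addgt0Pl => d d0; have [N uN] := ul _ d0.
  have := vnormD (l - u N) (u N); rewrite subrK; have [uN1 _] := uP N.
  have := uN N (leqnn _); lra.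
have Ml : vnorm (T l) <= M := cop_norm_ub T l1.
have TM : vnorm (T l) = M by apply/eqP; rewrite eq_le Ml Tl.
exists l; split=> //; apply/eqP; rewrite eq_le l1 /= -(ler_pM2l M0) mulr1.
by rewrite -{1}TM; exact: cop_norm_ubM.
Qed.

End compact_op_hilbert.

Section rank_one.
Variables (R : realType) (H : hilbertType R).
Implicit Types (x u v : H).

(** By Cauchy-Schwarz the image of the unit ball lies in the image of the compact square
    [[- c, c]^2], [c = vnorm v], under [(s, t) |-> (s + 'i t) u]. *)
Lemma rank_one_compact u v : compact_operator (fun x => dot x v *: u).
Proof.
split; first by move=> a x y; rewrite dotDl dotZl scalerDl scalerA.
pose c := vnorm v.
pose g (z : R * R) := z.1%:C *: u + z.2%:C *: ('i *: u).
have gc : continuous g.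
  move=> z; apply: cvgD.
    exact: (continuous_comp (@cvg_fst _ _ _ _ _) (@rscale_continuous _ _ _ _)).
  exact: (continuous_comp (@cvg_snd _ _ _ _ _) (@rscale_continuous _ _ _ _)).
have := continuous_compact (continuous_subspaceT gc)
  (compact_setX (@segment_compact R (- c) c) (@segment_compact R (- c) c)).
move=> /(compact_precompact (@norm_hausdorff _ H)).
apply: precompact_subset => _ [x /= x1 <-].
rewrite vnorm_le1 in x1.
have xv : normc (dot x v) <= c.
  have [->|/eqP v0] := eqVneq v 0; first by rewrite dot0r normc0 vnorm_ge0.
  have s0 : 0 < vnorm v.
    by rewrite lt_neqAle vnorm_ge0 andbT eq_sym; apply/eqP => /vnorm_eq0.
  have vE : v = (vnorm v)%:C *: ((vnorm v)^-1%:C *: v).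
    by rewrite scalerA -rmorphM divff ?gt_eqF// rmorph1 scale1r.
  rewrite vE dotZr conjR normcM normcR gtr0_norm// ler_piMr ?vnorm_ge0//.
  apply: le_trans (cauchy_schwarz1 _ _) x1.
  by rewrite vnormZr gtr0_norm ?invr_gt0// mulVf ?gt_eqF.
exists (complex.Re (dot x v), complex.Im (dot x v)).
  by split; rewrite /= in_itv /= -ler_norml; apply: le_trans xv;
    [exact: Re_le_normc|exact: Im_le_normc].
rewrite /g /= scalerA -scalerDl; congr (_ *: _).
by case: (dot x v) => a b; apply/eqP; rewrite eq_complex /=; apply/andP; split; apply/eqP; ring.
Qed.

Definition rank_one u v := CompactOp (rank_one_compact u v).

End rank_one.

(** * The atoms of a compact algebra *)

Section compact_algebra.
Variables (R : realType) (I : Type) (H : I -> hilbertType R).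
Local Notation A := (compact_algebra H).
Implicit Types (x y : A) (i j : I).

(** Being total in [j], with default 0, it lets a single formula define all components of an
    operator concentrated in the summand [i]. *)
Definition transport i j (u : H i) : H j :=
  match pselect (i = j) with
  | left ij => eq_rect i (fun k => H k) u j ij
  | right _ => 0
  end.

Lemma transport_id i (u : H i) : transport i u = u.
Proof.
rewrite /transport; case: pselect => // ii.
by rewrite (Prop_irrelevance ii erefl).
Qed.

Lemma transport_ne i j (u : H i) : i <> j -> transport j u = 0.
Proof. by rewrite /transport; case: pselect. Qed.

Lemma tens_vanishing i (u v : H i) :
  @vanishing R I (fun j => compact_op (H j))
    (fun j => rank_one (transport j u) (transport j v)).
Proof.
move=> e e0; apply: (sub_finite_set _ (finite_set1 i)) => j ej.
apply: contrapT => ji; move: ej; rewrite /mkset.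
rewrite (_ : rank_one _ _ = 0) ?normr0 ?leNgt ?e0//.
apply: compact_op_ext => z /=.
by rewrite (transport_ne u) ?scaler0// => ij; apply: ji.
Qed.

Definition tens i (u v : H i) : A := C0Sum (tens_vanishing u v).

Lemma tensE i (u v z : H i) : tens u v i z = dot z v *: u.
Proof. by rewrite /= !transport_id. Qed.

Lemma tens_ne i j (u v : H i) (z : H j) : i <> j -> tens u v j z = 0.
Proof. by move=> ij; rewrite /= (transport_ne u)// scaler0. Qed.

Lemma algebra_ext x y : (forall i z, x i z = y i z) -> x = y.
Proof. by move=> xy; apply: c0_sum_ext => i; apply: compact_op_ext. Qed.

Lemma vnorm_comp x i : vnorm (x i) <= vnorm x.
Proof. exact: sup_norm_ub. Qed.

Lemma vnorm_app x i (z : H i) : vnorm (x i z) <= vnorm x * vnorm z.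
Proof.
apply: le_trans (cop_norm_ubM _ _) _.
by rewrite ler_wpM2r ?vnorm_ge0// vnorm_comp.
Qed.

Lemma algebra_norm_le x (M : R) : 0 <= M ->
  (forall i (z : H i), vnorm z <= 1 -> vnorm (x i z) <= M) -> vnorm x <= M.
Proof.
by move=> M0 xM; apply: sup_norm_le => // i; apply: cop_norm_le => z; exact: xM.
Qed.

(** Only finitely many components have norm at least [M / 2]. If none had norm [M], the maximum of
    these norms and of [M / 2] would be less than [M] and bound them all. *)
Lemma norm_attained x : x <> 0 ->
  exists i (z : H i), vnorm z = 1 /\ vnorm (x i z) = vnorm x.
Proof.
move=> x0; set M := vnorm x.
have M0 : 0 < M by rewrite lt_neqAle vnorm_ge0 andbT eq_sym; apply/eqP => /vnorm_eq0.
suff [i xi] : exists i, vnorm (x i) = M.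
  have xi0 : x i <> 0 by move=> xi0; move: xi M0; rewrite xi0 vnorm0 => <-; rewrite ltxx.
  by have [z [z1 zx]] := compact_op_attain xi0; exists i, z; rewrite zx.
apply: contrapT => no.
have lt i : vnorm (x i) < M.
  rewrite lt_neqAle vnorm_comp andbT; apply/eqP => xi; apply: no; by exists i.
have M20 : 0 < M / 2 by rewrite divr_gt0.
have /(finite_image (fun i => vnorm (x i))) /finite_seqP[s sE] := c0P x M20.
pose m := \big[Num.max/M / 2]_(r <- s) r.
have mM : m < M.
  rewrite /m big_seq_cond; elim/big_rec: _ => [|r y /andP[rs _] yM]; first by lra.
  rewrite gt_max yM andbT.
  have : [set` s] r by [].
  by rewrite -sE => -[i _ <-].
have : M <= m.
  apply: sup_norm_le => [|i]; first by apply: le_trans (bigmax_ge_id _ _ _ _); exact: ltW.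
  have [xi|xi] := leP (M / 2) (vnorm (x i)).
    have : [set` s] (vnorm (x i)) by rewrite -sE; exists i.
    by move=> xis; exact: (@le_bigmax_seq _ _ _ s (M / 2) _ xpredT id xis).
  by apply: le_trans (ltW xi) _; exact: bigmax_ge_id.
by rewrite leNgt mM.
Qed.

End compact_algebra.

Lemma bessel (R : realType) (H : hilbertType R) (K : eqType) (u : K -> H) (s : seq K) y :
  uniq s -> (forall k, k \in s -> vnorm (u k) = 1) ->
  (forall j k, j \in s -> k \in s -> j != k -> dot (u j) (u k) = 0) ->
  \sum_(k <- s) normc (dot y (u k)) ^+ 2 <= vnorm y ^+ 2.
Proof.
elim: s y => [|k s ih] y /=; first by rewrite big_nil sqr_ge0.
move=> /andP[ks us] u1 uo; rewrite big_cons (sqr_vnorm_proj y (u1 k _)) ?mem_head//.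
rewrite addrC lerD2r; set y' := y - _.
rewrite (eq_big_seq (fun j => normc (dot y' (u j)) ^+ 2)); last first.
  move=> j js; rewrite /y' dotBl dotZl uo ?mulr0 ?subr0//.
  - by rewrite mem_head.
  - by rewrite inE js orbT.
  - by apply: contraNneq ks => ->.
apply: ih => // [j js|j l js ls]; first by apply: u1; rewrite inE js orbT.
by apply: uo; rewrite inE ?js ?ls orbT.
Qed.

Section atoms.
Variables (R : realType) (I : Type) (H : I -> hilbertType R).
Local Notation A := (compact_algebra H).
Implicit Types (x y : A) (i j : I) (a : R[i]).

Lemma appD x y i z : (x + y) i z = x i z + y i z. Proof. by []. Qed.
Lemma appZ a x i z : (a *: x) i z = a *: x i z. Proof. by []. Qed.
Lemma appN x i z : (- x) i z = - x i z. Proof. by []. Qed.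

Lemma tensDl i (u u' v : H i) : tens (u + u') v = tens u v + tens u' v.
Proof.
apply: algebra_ext => j z; rewrite appD; have [ij|ij] := pselect (i = j).
  by subst j; rewrite !tensE scalerDr.
by rewrite !tens_ne// addr0.
Qed.

Lemma tensZl a i (u v : H i) : tens (a *: u) v = a *: tens u v.
Proof.
apply: algebra_ext => j z; rewrite appZ; have [ij|ij] := pselect (i = j).
  by subst j; rewrite !tensE !scalerA mulrC.
by rewrite !tens_ne// scaler0.
Qed.

Lemma tensDr i (u v v' : H i) : tens u (v + v') = tens u v + tens u v'.
Proof.
apply: algebra_ext => j z; rewrite appD; have [ij|ij] := pselect (i = j).
  by subst j; rewrite !tensE dotDr scalerDl.
by rewrite !tens_ne// addr0.
Qed.

Lemma tensZr a i (u v : H i) : tens u (a *: v) = Num.conj a *: tens u v.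
Proof.
apply: algebra_ext => j z; rewrite appZ; have [ij|ij] := pselect (i = j).
  by subst j; rewrite !tensE dotZr scalerA.
by rewrite !tens_ne// scaler0.
Qed.

(** Multiplying [ran] and [dom] by the same phase gives the same operator, so an atom carries more
    data than its [atom_op]. *)
Record rank_one_atom := RankOneAtom {
  idx : I;
  ran : H idx;
  dom : H idx;
  ran1 : vnorm ran = 1;
  dom1 : vnorm dom = 1
}.
Implicit Types e r : rank_one_atom.

Definition atom_op e : A := tens (ran e) (dom e).
Definition atom_fun e x : R[i] := dot (x (idx e) (dom e)) (ran e).
Definition atom_perp e x :=
  x (idx e) (dom e) = 0 /\ forall z, dot (x (idx e) z) (ran e) = 0.

Lemma atom_rot_ran1 a e : normc a = 1 -> vnorm (a *: ran e) = 1.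
Proof. by move=> a1; rewrite vnormZ a1 mul1r ran1. Qed.

Definition atom_rot a e : rank_one_atom :=
  match pselect (normc a = 1) with
  | left a1 => RankOneAtom (atom_rot_ran1 e a1) (dom1 e)
  | right _ => e
  end.

Lemma atom_funL e a x y :
  atom_fun e (a *: x + y) = a * atom_fun e x + atom_fun e y.
Proof. by rewrite /atom_fun appD appZ dotDl dotZl. Qed.

Lemma atom_fun_le e x : normc (atom_fun e x) <= vnorm x.
Proof.
apply: le_trans (cauchy_schwarz1 _ (ran1 e)) _.
by apply: le_trans (vnorm_app _ _) _; rewrite dom1 mulr1.
Qed.

Lemma atom_fun_op e : atom_fun e (atom_op e) = 1.
Proof. by rewrite /atom_fun tensE dotZl !dotxx ran1 dom1 expr1n mulr1. Qed.

Lemma atom_fun_attain x : x <> 0 -> exists e, atom_fun e x = (vnorm x)%:C.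
Proof.
move=> x0; have [i [z [z1 zx]]] := norm_attained x0.
have M0 : vnorm x != 0 by apply/eqP => /vnorm_eq0.
have u1 : vnorm ((vnorm x)^-1%:C *: x i z) = 1.
  by rewrite vnormZr zx ger0_norm ?invr_ge0 ?vnorm_ge0// mulVf.
exists (RankOneAtom u1 z1); rewrite /atom_fun /= dotZr dotxx conjR zx.
by rewrite -rmorphM expr2 mulrA mulVf// mul1r.
Qed.

Lemma atom_perp0 e : atom_perp e 0.
Proof. by split=> [|z]; rewrite ?dot0l. Qed.

Lemma atom_perpL e a x y :
  atom_perp e x -> atom_perp e y -> atom_perp e (a *: x + y).
Proof.
move=> [x0 xr] [y0 yr]; split=> [|z]; rewrite appD appZ.
  by rewrite x0 y0 scaler0 addr0.
by rewrite dotDl dotZl xr yr mulr0 addr0.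
Qed.

Lemma atom_perp_fun e x : atom_perp e x -> atom_fun e x = 0.
Proof. by move=> [x0 _]; rewrite /atom_fun x0 dot0l. Qed.

Lemma atom_rot_op e a : normc a = 1 -> atom_op (atom_rot a e) = a *: atom_op e.
Proof. by move=> a1; rewrite /atom_rot; case: pselect => // ?; exact: tensZl. Qed.

Lemma atom_rot_fun e a x :
  normc a = 1 -> atom_fun (atom_rot a e) x = Num.conj a * atom_fun e x.
Proof.
by move=> a1; rewrite /atom_rot; case: pselect => // ?; rewrite /atom_fun dotZr.
Qed.

Lemma atom_rot_perp e a x :
  normc a = 1 -> atom_perp (atom_rot a e) x <-> atom_perp e x.
Proof.
move=> a1; rewrite /atom_rot; case: pselect => // ?; rewrite /atom_perp /=.
have a0 : Num.conj a != 0.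
  by rewrite conjC_eq0; apply/eqP => a0; move: a1; rewrite a0 normc0; lra.
split=> -[x0 xr]; split=> // z; last by rewrite dotZr xr mulr0.
by have /eqP := xr z; rewrite dotZr mulf_eq0 (negPf a0) => /eqP.
Qed.

(** A product of two inner products of unit vectors equals 1, so both are unimodular. Equality in
    Cauchy-Schwarz makes the ranges and the domains proportional, with phases that cancel in
    [atom_fun]. *)
Lemma atom_fun_inj r e : atom_fun r (atom_op e) = 1 -> atom_fun r =1 atom_fun e.
Proof.
case: r e => [i u v u1 v1] [j u' v' u'1 v'1]; rewrite /atom_fun /atom_op; cbn [idx ran dom].
have [ij|ij] := pselect (j = i); last first.
  by rewrite tens_ne// dot0l => /esym/eqP; rewrite oner_eq0.
subst j; rewrite tensE dotZl => h x.
have c1 : normc (dot v v') <= 1 by rewrite -v1; exact: cauchy_schwarz1.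
have d1 : normc (dot u' u) <= 1 by rewrite -u'1; exact: cauchy_schwarz1.
have cd : normc (dot v v') * normc (dot u' u) = 1 by rewrite -normcM h normc1.
have c0 := normc_ge0 (dot v v'); have d0 := normc_ge0 (dot u' u).
have cE : normc (dot v v') = 1 by nra.
have dE : normc (dot u' u) = 1 by rewrite cE mul1r in cd.
rewrite (unit_dot_norm1 v1 v'1 cE) [in RHS](unit_dot_norm1 u'1 u1 dE).
rewrite copZ dotZl dotZr.
have dd : dot u' u * Num.conj (dot u' u) = 1 by rewrite mulc_conj dE expr1n rmorph1.
suff -> : Num.conj (dot u' u) = dot v v' by [].
by rewrite -[RHS]mulr1 -dd mulrA h mul1r.
Qed.

(** A contraction with [<x v, u> = 1] has [x v = u]. For [w] orthogonal to [v] and [p = <x w, u>],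
    evaluating [x] at [v + s p^* w] gives [(1 + s |p|^2)^2 <= 1 + s^2 |p|^2 |w|^2], and
    [s = 1 / (|w|^2 + 1)] leaves [p = 0]. *)
Lemma atom_perp_face e x :
  vnorm x <= 1 -> atom_fun e x = 1 -> atom_perp e (x - atom_op e).
Proof.
case: e => i u v u1 v1; rewrite /atom_fun /atom_perp /atom_op; cbn [idx ran dom]; move=> x1 xuv.
have xle z : vnorm (x i z) <= vnorm z.
  by apply: le_trans (vnorm_app _ _) _; rewrite ler_piMl ?vnorm_ge0.
have xv : x i v = u by apply: unit_dot1 => //; rewrite -v1.
split=> [|z]; rewrite appD appN tensE.
  by rewrite dotxx v1 expr1n scale1r xv subrr.
rewrite dotBl dotZl dotxx u1 expr1n mulr1.
set w := z - dot z v *: v.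
have wv : dot w v = 0 by exact: dot_proj.
have -> : dot (x i z) u - dot z v = dot (x i w) u.
  by rewrite /w copB copZ dotBl dotZl xv dotxx u1 expr1n mulr1.
set p := dot (x i w) u.
have key (s : R) : 0 < s ->
    2 * normc p ^+ 2 + s * normc p ^+ 4 <= s * (normc p ^+ 2 * vnorm w ^+ 2).
  move=> s0; have := xle (v + (s%:C * Num.conj p) *: w).
  have := cauchy_schwarz1 (x i (v + (s%:C * Num.conj p) *: w)) u1.
  rewrite copD copZ dotDl dotZl -/p xv dotxx u1 expr1n => h1 h2.
  have {h1 h2} := le_trans h1 h2.
  rewrite -ler_sqr ?nnegrE ?normc_ge0 ?vnorm_ge0// pythagoras.
    rewrite v1 sqr_vnormZ normcM normcR normc_conj gtr0_norm// !exprMn expr1n.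
    rewrite -mulrA [_ * p]mulrC mulc_conj -rmorphM -rmorphD.
    rewrite normcR real_normK ?num_real// => h.
    rewrite -(ler_pM2l s0); lra.
  by rewrite dotZr dotC wv rmorph0 mulr0.
have p0 : 0 <= normc p ^+ 2 by exact: sqr_ge0.
have w0 : 0 < vnorm w ^+ 2 + 1 by rewrite ltr_wpDl ?sqr_ge0.
have := key (vnorm w ^+ 2 + 1)^-1; rewrite invr_gt0 => /(_ w0) h.
apply/eq0_normc/eqP; rewrite -sqrf_eq0 eq_le p0 andbT.
have {h} := ler_wpM2l (ltW w0) h.
by rewrite mulrDr !mulrA !divff ?gt_eqF// !mul1r; nra.
Qed.

(** [x] sees only the component of [z] orthogonal to [dom e] and maps it orthogonally to [ran e], so
    Pythagoras combines the two contributions. *)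
Lemma atom_perp_norm e a x : atom_perp e x -> normc a <= 1 -> vnorm x <= 1 ->
  vnorm (a *: atom_op e + x) <= 1.
Proof.
case: e => i u v u1 v1; rewrite /atom_perp /atom_op; cbn [idx ran dom]; move=> [xv xu] a1 x1.
apply: algebra_norm_le => // j z z1; rewrite appD appZ.
have xle w : vnorm (x j w) <= vnorm w.
  by apply: le_trans (vnorm_app _ _) _; rewrite ler_piMl ?vnorm_ge0.
have [ij|ij] := pselect (i = j); last first.
  by rewrite tens_ne// scaler0 add0r (le_trans (xle z)).
subst j; rewrite tensE -(ler_sqr) ?nnegrE ?vnorm_ge0// pythagoras; last first.
  by rewrite !dotZl [dot u _]dotC xu rmorph0 !mulr0.
rewrite !sqr_vnormZ u1 expr1n mulr1.
have -> : x i z = x i (z - dot z v *: v) by rewrite copB copZ xv scaler0 subr0.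
have h1 := xle (z - dot z v *: v); rewrite ler_vnorm in h1.
have h2 := sqr_vnorm_proj z v1.
have h3 : vnorm z ^+ 2 <= 1 by rewrite expr_le1 ?vnorm_ge0.
have h4 : normc a ^+ 2 <= 1 by rewrite expr_le1 ?normc_ge0.
have h5 := sqr_ge0 (normc (dot z v)).
have h6 : normc a ^+ 2 * normc (dot z v) ^+ 2 <= normc (dot z v) ^+ 2.
  by rewrite ler_piMl.
lra.
Qed.

End atoms.

(** * Orthogonal sequences of atoms *)

Section no_infinite_frame.
Variables (R : realType) (I : Type) (H : I -> hilbertType R).
Local Notation A := (compact_algebra H).
Local Notation E := (rank_one_atom H).
Variables (v : nat -> E) (x : A) (eps : R).
Hypothesis eps0 : 0 < eps.
Hypothesis v_ortho : forall m n, m != n -> atom_perp (v m) (atom_op (v n)).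
Hypothesis v_large : forall n, eps <= complex.Re (atom_fun (v n) x).

(** Only finitely many components of [x] have norm at least [eps]. If each index [i] stopped
    occurring from some [N i] on, the atom numbered by the maximum of these [N i] would still have
    one of these finitely many indices. *)
Lemma infinitely_often_idx :
  exists i, forall N, exists2 n, (N <= n)%N & idx (v n) = i.
Proof.
apply: contrapT => no.
have /choice[N NP] : forall i, exists N, forall n, (N <= n)%N -> idx (v n) <> i.
  move=> i; apply: contrapT => noi; apply: no; exists i => N.
  by apply: contrapT => noN; apply: noi; exists N => n Nn vi; apply: noN; exists n.
have fin : finite_set [set i | eps <= vnorm (x i)] := c0P x eps0.
have /finite_seqP[s sE] := finite_image N fin.
pose M := (\max_(k <- s) k)%N.
have leM n : n \in s -> (n <= M)%N.
  by move=> ns; rewrite /M (big_rem _ ns) /= leq_maxl.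
have vM : eps <= vnorm (x (idx (v M))).
  apply: le_trans (v_large M) _; apply: le_trans (ler_norm _) _.
  apply: le_trans (Re_le_normc _) _.
  apply: le_trans (cauchy_schwarz1 _ (ran1 _)) _.
  by apply: le_trans (cop_norm_ubM _ _) _; rewrite dom1 mulr1.
have : N (idx (v M)) \in s.
  have : (N @` [set i | eps <= vnorm (x i)]) (N (idx (v M))) by exists (idx (v M)).
  by rewrite sE.
by move=> /leM NM; exact: NP NM erefl.
Qed.

Lemma atom_transport i (e : E) : idx e = i ->
  [/\ vnorm (transport i (ran e)) = 1, vnorm (transport i (dom e)) = 1,
      atom_fun e x = dot (x i (transport i (dom e))) (transport i (ran e))
    & forall r, idx r = i -> atom_perp r (atom_op e) ->
      dot (transport i (ran e)) (transport i (ran r)) = 0].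
Proof.
case: e => j u w u1 w1; cbn [idx ran dom] => ji; subst j.
rewrite !transport_id; split=> // -[k u' w' u'1 w'1]; cbn [idx ran dom] => ki.
subst k; rewrite transport_id /atom_perp /atom_op; cbn [idx ran dom] => -[_ h].
by have := h w; rewrite tensE dotZl dotxx w1 expr1n mul1r.
Qed.

(** In a recurring summand the vectors [x i (eta n)] have a cluster point [y] by compactness.
    Infinitely many of the orthonormal [xi n] then have [Re <y, xi n> >= eps / 2], against Bessel's
    inequality. *)
Lemma no_infinite_frame_subproof : False.
Proof.
have [i iP] := infinitely_often_idx.
pose D := [set n | idx (v n) = i].
pose xi n := transport i (ran (v n)); pose eta n := transport i (dom (v n)).
have [_] := compact_opP (x i); rewrite precompactE; set K := closure _ => cK.
pose F := filter_from [set: nat]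
  (fun N => [set x i (eta n) | n in [set n | (N <= n)%N /\ D n]]).
have FF : ProperFilter F.
  apply: filter_from_proper; last by move=> N _; have [n Nn vi] := iP N; exists (x i (eta n)), n.
  apply: filter_from_filter; first by exists 0.
  move=> M N _ _; exists (maxn M N) => // _ [n [Mn Dn] <-].
  by move: Mn; rewrite geq_max => /andP[Mn Nn]; split; exists n.
have [|y [_ yF]] := cK F FF.
  exists 0 => // _ [n [_ Dn] <-]; apply: subset_closure; exists (eta n) => //=.
  by rewrite vnorm_le1; have [_ -> _ _] := atom_transport Dn.
have near_y N : exists n, [/\ (N <= n)%N, D n & eps / 2 <= complex.Re (dot y (xi n))].
  have e20 : 0 < eps / 2 by rewrite divr_gt0.
  have F_N : F [set x i (eta n) | n in [set n | (N <= n)%N /\ D n]] by exists N.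
  have yB : nbhs y [set z | vnorm (y - z) < eps / 2].
    by apply/nbhs_vnorm; exists (eps / 2).
  have [_ [[n [Nn Dn] <-] /= yn]] := yF _ _ F_N yB.
  exists n; split=> //; have [xi1 _ fE _] := atom_transport Dn.
  have := v_large n; rewrite fE.
  have := cauchy_schwarz1 (y - x i (eta n)) xi1; rewrite dotBl -/(xi n) -/(eta n).
  have := Re_le_normc (dot y (xi n) - dot (x i (eta n)) (xi n)).
  by rewrite raddfB /= ler_norml => /andP[h1 _] h2 h3; lra.
have seqs k : exists s : seq nat, [/\ uniq s, size s = k,
    forall n, n \in s -> D n & forall n, n \in s -> eps / 2 <= complex.Re (dot y (xi n))].
  elim: k => [|k [s [us sk sD sy]]]; first by exists [::].
  have [n [Nn Dn yn]] := near_y (\max_(j <- s) j)%N.+1.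
  exists (n :: s); split=> /=.
  - rewrite us andbT; apply/negP => ns.
    by move: Nn; rewrite (big_rem _ ns) /= gtn_max ltnn.
  - by rewrite sk.
  - by move=> m; rewrite inE => /predU1P[->|/sD].
  - by move=> m; rewrite inE => /predU1P[->|/sy].
have e4 : 0 < (eps / 2) ^+ 2 by rewrite exprn_gt0// divr_gt0.
pose k := (Num.truncn (vnorm y ^+ 2 / (eps / 2) ^+ 2)).+1.
have [s [us sk sD sy]] := seqs k.
have : \sum_(n <- s) normc (dot y (xi n)) ^+ 2 <= vnorm y ^+ 2.
  apply: bessel => // [n ns|m n ms ns mn].
    by have [] := atom_transport (sD n ns).
  have [_ _ _ h] := atom_transport (sD m ms); apply: h; first exact: sD.
  by apply: v_ortho; rewrite eq_sym.
apply/negP; rewrite -ltNge.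
apply: (@lt_le_trans _ _ (\sum_(n <- s) (eps / 2) ^+ 2)).
  rewrite big_const_seq count_predT sk iter_addr_0 -[X in _ < X]mulr_natl.
  by rewrite -ltr_pdivrMr// truncnS_gt.
rewrite big_seq [leRHS]big_seq; apply: ler_sum => n ns.
rewrite ler_sqr ?nnegrE ?normc_ge0 ?divr_ge0 ?(ltW eps0)//.
exact: le_trans (sy n ns) (le_trans (ler_norm _) (Re_le_normc _)).
Qed.

End no_infinite_frame.

Lemma polar (R : realType) (a : R[i]) :
  exists2 b, normc b = 1 & a = b * (normc a)%:C.
Proof.
have [->|a0] := eqVneq a 0; first by exists 1; rewrite ?normc1// normc0 mulr0.
have n0 : normc a != 0 by apply: contra_neq a0; exact: eq0_normc.
exists (a / (normc a)%:C); last by rewrite mulfVK// realC_neq0.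
by rewrite normcM normcV normcR ger0_norm ?normc_ge0// mulfV.
Qed.

Section unit_vectors.
Variables (R : realType) (H : hilbertType R).
Implicit Types (u v w z : H) (a b : R[i]).

(** The phase [a] of [<v, u>] is split off, and [w] is the normalized rest with that phase removed,
    so both coefficients are real. If [v] is a multiple of [u], the direction [w] is taken from
    [z]. *)
Lemma unit_split u v z : vnorm u = 1 -> vnorm v = 1 -> z - dot z u *: u <> 0 ->
  exists w a (c s : R), [/\ vnorm w = 1, dot w u = 0, normc a = 1,
    c ^+ 2 + s ^+ 2 = 1 & v = a *: (c%:C *: u + s%:C *: w)].
Proof.
move=> u1 v1 z0; have vE := sqr_vnorm_proj v u1; rewrite v1 expr1n in vE.
have [w0|w0] := pselect (v - dot v u *: u = 0).
  exists ((vnorm (z - dot z u *: u))^-1%:C *: (z - dot z u *: u)), (dot v u), 1, 0.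
  split; first exact: normalized.
  - by rewrite dotZl dot_proj// mulr0.
  - move: vE; rewrite w0 vnorm0 expr0n add0r => /esym/eqP.
    by rewrite sqrp_eq1 ?normc_ge0// => /eqP.
  - by rewrite expr1n expr0n addr0.
  - rewrite rmorph1 rmorph0 scale1r scale0r addr0; apply/eqP.
    by rewrite -subr_eq0 w0.
set w := v - _ in w0 vE; have [a a1 aE] := polar (dot v u).
have aa : a * Num.conj a = 1 by rewrite mulc_conj a1 expr1n rmorph1.
exists (Num.conj a *: ((vnorm w)^-1%:C *: w)), a, (normc (dot v u)), (vnorm w).
split=> //.
- by rewrite vnormZ normc_conj a1 mul1r; exact: normalized.
- by rewrite !dotZl dot_proj// !mulr0.
- by rewrite vE addrC.
have s0 : (vnorm w)%:C != 0 :> R[i] by apply: realC_neq0; apply/eqP => /vnorm_eq0.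
rewrite scalerDr !scalerA -aE [X in X *: w](_ : _ = 1) ?scale1r 1?addrC ?subrK//.
rewrite fmorphV; transitivity (a * Num.conj a * ((vnorm w)%:C / (vnorm w)%:C)); first by ring.
by rewrite aa mul1r divff.
Qed.

Lemma dot_comb u w a a' b b' : vnorm u = 1 -> vnorm w = 1 -> dot w u = 0 ->
  dot (a *: u + a' *: w) (b *: u + b' *: w) =
  a * Num.conj b + a' * Num.conj b'.
Proof.
move=> u1 w1 wu; have uw : dot u w = 0 by rewrite dotC wu rmorph0.
rewrite dotDl !dotDr !dotZl !dotZr !dotxx u1 w1 wu uw expr1n rmorph1.
by rewrite !(mulr0, mulr1, addr0, add0r).
Qed.

Lemma vnorm_comb u w a a' : vnorm u = 1 -> vnorm w = 1 -> dot w u = 0 ->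
  a * Num.conj a + a' * Num.conj a' = 1 -> vnorm (a *: u + a' *: w) = 1.
Proof.
move=> u1 w1 wu aa; have := dotxx (a *: u + a' *: w).
rewrite dot_comb// aa => /(congr1 (@complex.Re R)) /= /esym/eqP.
by rewrite sqrp_eq1 ?vnorm_ge0// => /eqP.
Qed.

Lemma collinear u z a : vnorm u = 1 -> z = a *: u -> z - dot z u *: u = 0.
Proof. by move=> u1 ->; rewrite dotZl dotxx u1 expr1n mulr1 subrr. Qed.

End unit_vectors.

(** * Relative position of two atoms *)

Section two_atoms.
Variables (R : realType) (I : Type) (H : I -> hilbertType R).
Local Notation A := (compact_algebra H).
Local Notation E := (rank_one_atom H).

(** [tens] is conjugate-linear in its second argument, hence the conjugates in the domain vectors:
    [p q^T] is realized with range [p1 u + p2 u'] and domain [q1^* w + q2^* w']. *)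
Lemma tens_matrix_units i (u u' w w' : H i) :
  vnorm u = 1 -> vnorm u' = 1 -> dot u' u = 0 ->
  vnorm w = 1 -> vnorm w' = 1 -> dot w' w = 0 ->
  matrix_units (@atom_op _ _ H) (@atom_perp _ _ H)
    (tens u w) (tens u w') (tens u' w) (tens u' w').
Proof.
move=> u1 u'1 uu w1 w'1 ww p1 p2 q1 q2 p1' p2' q1' q2' hp hq hp' hq' pp qq.
have conj_sum (a b c d : R[i]) : Num.conj (a * Num.conj b + c * Num.conj d) =
    Num.conj a * b + Num.conj c * d by rewrite rmorphD !rmorphM /= !conjCK.
have hq1 : vnorm (Num.conj q1 *: w + Num.conj q2 *: w') = 1.
  by apply: vnorm_comb; rewrite // !conjCK -conj_sum hq rmorph1.
have hq1' : vnorm (Num.conj q1' *: w + Num.conj q2' *: w') = 1.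
  by apply: vnorm_comb; rewrite // !conjCK -conj_sum hq' rmorph1.
have hp1 := vnorm_comb u1 u'1 uu hp; have hp1' := vnorm_comb u1 u'1 uu hp'.
have tE a a' b b' : tens (a *: u + a' *: u') (Num.conj b *: w + Num.conj b' *: w') =
    lin4 (tens u w) (tens u w') (tens u' w) (tens u' w')
      (a * b) (a * b') (a' * b) (a' * b') :> A.
  rewrite tensDl !tensZl !tensDr !tensZr !conjCK !scalerDr !scalerA.
  by rewrite /lin4 addrA.
exists (RankOneAtom hp1 hq1), (RankOneAtom hp1' hq1').
rewrite /atom_op /atom_perp; cbn [idx ran dom].
split; [split=> [|z]; rewrite tensE|exact: tE|exact: tE].
  by rewrite dot_comb// !conjCK -conj_sum qq rmorph0 scale0r.
rewrite dotZl dot_comb// (_ : p1' * _ + _ = 0) ?mulr0//.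
have := congr1 Num.conj pp; rewrite conj_sum rmorph0 => <-.
by rewrite [p1' * _]mulrC [p2' * _]mulrC.
Qed.

(** Atoms in different summands are orthogonal, and in a one-dimensional summand they differ by a
    phase. In any other summand the vectors of [e'] are split along those of [e], and the four
    vectors so obtained span a corner. *)
Lemma atom_two_atoms (e e' : E) : [\/ atom_perp e (atom_op e'),
    exists2 a, normc a = 1 & atom_op e' = a *: atom_op e
  | exists u12 u21 u22 a (c s c' s' : R),
    [/\ matrix_units (@atom_op _ _ H) (@atom_perp _ _ H) (atom_op e) u12 u21 u22,
        [/\ normc a = 1, c ^+ 2 + s ^+ 2 = 1 & c' ^+ 2 + s' ^+ 2 = 1],
        atom_op e' = a *: lin4 (atom_op e) u12 u21 u22
          (c * c')%:C (c * s')%:C (s * c')%:C (s * s')%:C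
      & atom_fun e (atom_op e') = a * (c * c')%:C]].
Proof.
case: e e' => i u w u1 w1 [j u' w' u'1 w'1].
rewrite /atom_op /atom_perp /atom_fun; cbn [idx ran dom].
have [ji|ji] := pselect (j = i); last first.
  by apply: Or31; split=> [|z]; rewrite tens_ne// dot0l.
subst j.
have [[z z0]|nz] := pselect (exists z, z - dot z u *: u <> 0); last first.
  have colin z : z = dot z u *: u.
    by apply/eqP; rewrite -subr_eq0; apply/eqP; apply: contrapT => z0; apply: nz; exists z.
  apply: Or32; set b := dot w u.
  have nu z : vnorm z = 1 -> normc (dot z u) = 1.
    by move=> z1; have := congr1 (@vnorm _ _) (colin z); rewrite vnormZ z1 u1 mulr1.
  have bb : Num.conj b * b = 1 by rewrite mulrC mulc_conj nu// expr1n rmorph1.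
  exists (dot u' u * Num.conj (dot w' u * Num.conj b)).
    by rewrite normcM normc_conj normcM normc_conj !nu// !mulr1.
  rewrite [in LHS](colin u') [in LHS](colin w') tensZl tensZr scalerA.
  rewrite [w in RHS](colin w) -/b tensZr scalerA; congr (_ *: _).
  by rewrite -mulrA -rmorphM -mulrA bb mulr1.
have [z' z'0] : exists z', z' - dot z' w *: w <> 0.
  apply: contrapT => nz.
  have colin z' : z' = dot z' w *: w.
    by apply/eqP; rewrite -subr_eq0; apply/eqP; apply: contrapT => h; apply: nz; exists z'.
  apply: z0; apply: (@collinear _ _ _ _ (dot z w / dot u w) u1).
  have n0 : dot u w != 0.
    by apply/eqP => uw; have := colin u; rewrite uw scale0r => u0; move: u1; rewrite u0 vnorm0; lra.
  transitivity ((dot z w / dot u w) *: (dot u w *: w)); last by rewrite -(colin u).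
  by rewrite scalerA divfK//; exact: colin.
have [a [b [c [s [a1 au b1 cs uE]]]]] := unit_split u1 u'1 z0.
have [a' [b' [c' [s' [a'1 a'w b'1 cs' wE]]]]] := unit_split w1 w'1 z'0.
apply: Or33; exists (tens u a'), (tens a w), (tens a a'), (b * Num.conj b'), c, s, c', s'.
split; first exact: tens_matrix_units.
- by split=> //; rewrite normcM normc_conj b1 b'1 mulr1.
- rewrite uE wE tensZl tensZr scalerA; congr (_ *: _).
  rewrite tensDl !tensZl !tensDr !tensZr !conjR !scalerDr !scalerA -!rmorphM.
  by rewrite /lin4 addrA.
- rewrite tensE uE wE !dotZl !dotZr !dotDl !dotDr !dotZl !dotZr !conjR.
  rewrite !dotxx u1 w1 au dotC a'w rmorph0 expr1n rmorph1 !(mulr0, mulr1, addr0).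
  by rewrite rmorphM; ring.
Qed.

Definition compact_atomic : atomic A := {|
  atom := E;
  av := @atom_op R I H;
  af := @atom_fun R I H;
  ap := @atom_perp R I H;
  ar := @atom_rot R I H;
  afL := @atom_funL R I H;
  af_le := @atom_fun_le R I H;
  afv := @atom_fun_op R I H;
  af_attain := @atom_fun_attain R I H;
  af_inj := @atom_fun_inj R I H;
  ap0 := @atom_perp0 R I H;
  apL := @atom_perpL R I H;
  ap_af := @atom_perp_fun R I H;
  ap_face := @atom_perp_face R I H;
  ap_norm := @atom_perp_norm R I H;
  arv := @atom_rot_op R I H;
  arf := @atom_rot_fun R I H;
  arp := @atom_rot_perp R I H;
  no_infinite_frame := @no_infinite_frame_subproof R I H;
  two_atoms := atom_two_atoms |}.

End two_atoms.

(** * The extension theorem *)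

Section rank_one_algebra.
Variables (R : realType) (A : normedModType R[i]) (E : atomic A) (e0 : E).
Hypothesis e0_max : forall w : E, ~ ap e0 (av w).

(** A common two-by-two corner would contain in [u22] an atom orthogonal to [e0]. *)
Lemma atom_colinear (e : E) : exists a, av e = a *: av e0.
Proof.
have [/e0_max//|[a _ ->]|] := two_atoms e0 e; first by exists a.
move=> [u12 [u21 [u22 [_ [_ [_ [_ [_ [M _ _ _]]]]]]]]].
by have [w _ /e0_max] := corner_diag M.
Qed.

(** Peel off an atom [e] at which [x] attains its norm. A nonzero remainder would have a norming
    atom orthogonal to [e]; both being multiples of [av e0], [av e] would be orthogonal to [e]
    itself. *)
Lemma rank_one_span (x : A) : x = af e0 x *: av e0.
Proof.
suff [a ->] : exists a, x = a *: av e0 by rewrite afZ afv mulr1.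
have [->|/eqP x0] := eqVneq x 0; first by exists 0; rewrite scale0r.
have [e ex] := af_attain E x0.
have [a aE] := atom_colinear e.
have [ey _ _] := peel x0 ex; set y := x - _ in ey.
have [y0|/eqP y0] := eqVneq y 0.
  exists ((vnorm x)%:C * a); rewrite -scalerA -aE.
  by apply/eqP; rewrite -subr_eq0 -/y y0.
have [r ry] := af_attain E y0.
have [_ _ /(_ e ey) er] := peel y0 ry.
have [b bE] := atom_colinear r.
have a0 : a != 0.
  by apply/eqP => a0; have := afv e; rewrite aE a0 scale0r af0 => /eqP; rewrite eq_sym oner_eq0.
have : ap e (av e).
  rewrite aE; have -> : av e0 = b^-1 *: av r.
    rewrite bE scalerA mulVf ?scale1r//.
    apply/eqP => b0; have := afv r; rewrite bE b0 scale0r af0 => /eqP.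
    by rewrite eq_sym oner_eq0.
  by apply: apZ; exact: apZ.
by move/ap_af; rewrite afv => /eqP; rewrite oner_eq0.
Qed.

End rank_one_algebra.

Section separation.
Variables (R : realType) (A : normedModType R[i]) (E : atomic A).
Variables (Y : normedModType R) (f : A -> Y).
Hypothesis f_isom : forall x y, vnorm x = 1 -> vnorm y = 1 ->
  `|f x - f y| = vnorm (x - y).
Hypothesis f_norm : forall x, vnorm x = 1 -> `|f x| = 1.
Hypothesis f_surj : forall y, `|y| = 1 -> exists2 x, vnorm x = 1 & f x = y.

Definition linearized (phi : A -> R) (psi : Y -> R) :=
  [/\ forall (t : R) x y, phi (t%:C *: x + y) = t * phi x + phi y,
      forall t x y, psi (t *: x + y) = t * psi x + psi y
    & forall x, vnorm x = 1 -> psi (f x) = phi x].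

Lemma separation x : x <> 0 -> exists phi psi, phi x <> 0 /\ linearized phi psi.
Proof.
move=> x0.
have [rank2|] := pselect (forall e : E, exists w : E, ap e (av w)).
  have [e ex] := af_attain E x0.
  have [||psi [psiL psi_le psi1]] := @support_functional R Y (f @` [set y | face e y]).
  - move=> _ _ t [y ey <-] [z ez <-] t1.
    have [w ew <-] := image_face_convex f_isom f_norm f_surj ey ez t1.
    by exists w.
  - by move=> _ [y /face_norm/f_norm + <-].
  exists (@complex.Re R \o af e), psi; split.
    by rewrite /= ex /= => /vnorm_eq0.
  split=> //.
  - by move=> t y z /=; rewrite afL; case: (af e y) (af e z) => [? ?] [? ?] /=; ring.
  apply: (h_af f_isom f_norm f_surj rank2 psiL psi_le).
  by move=> y ey; apply: psi1; exists y.
move=> /existsNP[e e_max].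
have {}e_max (w : E) : ~ ap e (av w) by move=> ew; apply: e_max; exists w.
have span := rank_one_span e_max.
pose g a := f (a *: av e).
have ve a : vnorm (a *: av e) = normc a by rewrite vnormZ vnorm_atom mulr1.
have [a0 [X [Z [a01 XL ZL h]]]] : exists a0 (X Z : Y -> R),
  [/\ normc a0 = 1, forall t y z, X (t *: y + z) = t * X y + X z,
      forall t y z, Z (t *: y + z) = t * Z y + Z z
    & forall a, normc a = 1 ->
      X (g (a0 * a)) = complex.Re a /\ Z (g (a0 * a)) = complex.Im a].
  apply: circle_coordinates => [a b a1 b1|a a1|y /f_surj[z z1 <-]].
  - by rewrite /g f_isom ?ve// -scalerBl ve.
  - by rewrite /g f_norm// ve.
  - exists (af e z); last by rewrite /g -span.
    by rewrite -ve -span.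
have aa : a0 * Num.conj a0 = 1 by rewrite mulc_conj a01 expr1n.
pose k y := Num.conj a0 * af e y.
have kL (t : R) y z : k (t%:C *: y + z) = t%:C * k y + k z.
  by rewrite /k afL; ring.
have kf y : vnorm y = 1 -> X (f y) = complex.Re (k y) /\ Z (f y) = complex.Im (k y).
  move=> y1; have := h (k y); rewrite /g /k mulrA aa mul1r -span; apply.
  by rewrite normcM normc_conj a01 mul1r -ve -span.
have kx : k x != 0.
  apply/eqP => kx; apply: x0; rewrite (span x).
  have -> : af e x = a0 * k x by rewrite /k mulrA aa mul1r.
  by rewrite kx mulr0 scale0r.
have [xr|/eqP xr] := eqVneq (complex.Re (k x)) 0; last first.
  exists (@complex.Re R \o k), X; split=> //; split=> //.
    by move=> t y z /=; rewrite kL; case: (k y) (k z) => [? ?] [? ?] /=; ring.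
  by move=> y /kf[].
exists (@complex.Im R \o k), Z; split=> /=.
  by move=> xi; move: kx; rewrite eq_complex xr xi !eqxx.
split=> //.
  by move=> t y z /=; rewrite kL; case: (k y) (k z) => [? ?] [? ?] /=; ring.
by move=> y /kf[].
Qed.

End separation.

Theorem corollary5p5 (R : realType) (I : Type) (H : I -> hilbertType R)
    (Y : completeNormedModType R) (f : compact_algebra H -> Y) :
  isometry_on (unit_sphere (compact_algebra H)) f ->
  f @` unit_sphere (compact_algebra H) = unit_sphere Y ->
  exists! F : compact_algebra H -> Y,
    [/\ real_linear F,
        isometry_on [set: compact_algebra H] F,
        range F = [set: Y]
      & forall x, unit_sphere (compact_algebra H) x -> F x = f x].
Proof.
move=> f_iso f_img.
have f_isom x y : vnorm x = 1 -> vnorm y = 1 -> `|f x - f y| = vnorm (x - y).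
  move=> /unit_sphereE x1 /unit_sphereE y1.
  by have := f_iso x y x1 y1; rewrite -vnormE => -[].
have f_norm x : vnorm x = 1 -> `|f x| = 1.
  move=> /unit_sphereE x1; have : (f @` unit_sphere (compact_algebra H)) (f x) by exists x.
  by rewrite f_img.
have f_surj y : `|y| = 1 -> exists2 x, vnorm x = 1 & f x = y.
  move=> y1; have : (f @` unit_sphere (compact_algebra H)) y by rewrite f_img.
  by case=> x /unit_sphereE x1 <-; exists x.
apply: (linear_extension f_norm f_surj) => x x0.
have [phi [psi [phix [phiL psiL h]]]] :=
  separation (@compact_atomic _ _ H) f_isom f_norm f_surj x0.
by exists phi, psi.
Qed.
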